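(* Fix an integer $k\ge3$. Let $\beta\in\mathbb C$ satisfy $$\beta^{k+1}=\frac{1}{1-\left(\tfrac12\right)^{1/k}e^{\pi i/k}},$$ let $\alpha=-\beta^{-k}$, and let $p$ be the polynomial of degree $k$ $$p(z)=\frac{(z-\alpha)(z+\beta)^k-1}{z}.$$ Then $0$ is an isolated point of $\sigma(T_{\overline{z}+p})$, and $\sigma(T_{\overline{z}+p})$ has at most finitely many isolated points.
   Context: $\mathbb D$ is the open unit disk, $dA$ normalized area measure on $\mathbb D$, $L^2_a$ the Bergman space of analytic functions in $L^2(\mathbb D,dA)$, $P$ the orthogonal projection onto $L^2_a$, and $T_\varphi f=P(\varphi f)$ for $\varphi\in L^\infty(\mathbb D)$, $f\in L^2_a$. $\sigma(T)$ denotes the spectrum. *)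

(* Defs.v *)
From HB Require Import structures.
From mathcomp Require Import all_boot all_order all_algebra.
From mathcomp Require Import all_classical all_reals all_analysis.
From mathcomp Require Import complex.
From Stdlib Require ClassicalEpsilon.
Set Implicit Arguments. Unset Strict Implicit. Unset Printing Implicit Defensive.
Import Order.TTheory GRing.Theory Num.Theory.
Local Open Scope ring_scope.
Local Open Scope classical_set_scope.
Local Open Scope complex_scope.

(* Complex numbers are [R[i]] = [complex R] for [R : realType]. *)

Section Bergman.
Variable R : realType.
Notation C := (complex R).

(** Open unit disk as a subset of C and of R * R. *)
Definition unit_disk : set C := [set z | `|z| < 1].
Definition disk2 : set (R * R) := [set xy | xy.1 ^+ 2 + xy.2 ^+ 2 < 1].
Definition toC (xy : R * R) : C := xy.1 +i* xy.2.

(** Lebesgue (area) measure on R^2 = R * R. *)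
Definition area := ((@lebesgue_measure R) \x (@lebesgue_measure R))%E.

(** complex differentiability at every point of the open unit disk *)
Definition holomorphic_on_disk (f : C -> C) : Prop :=
  forall z, z \in unit_disk -> exists c : C, forall eps : R, 0 < eps ->
    exists2 del : R, 0 < del & forall w : C, 0 < `|w - z| < del%:C ->
      `|(f w - f z) / (w - z) - c| < eps%:C.

(** squared modulus, real/imaginary parts as real-valued functions on R*R *)
Definition sqmod (f : C -> C) (xy : R * R) : R := complex.Re (`|f (toC xy)| ^+ 2).

(** Bergman space L^2_a: analytic functions on D with int_D |f|^2 dA < oo;
    we extend them by 0 outside D so that they are genuine functions C -> C
    uniquely determined by their values on D. *)
Definition Bergman : set (C -> C) :=
  [set f | (forall z, ~ (z \in unit_disk) -> f z = 0) /\ holomorphic_on_disk f /\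
           area.-integrable disk2 (fun xy => (sqmod f xy)%:E)].

(** integral over D with respect to the normalized area measure dA = dx dy / pi *)
Definition cintegral (u : C -> C) : C :=
  ((pi^-1 * Rintegral area disk2 (fun xy => complex.Re (u (toC xy))))
   +i* (pi^-1 * Rintegral area disk2 (fun xy => complex.Im (u (toC xy))))).

Definition inner (u v : C -> C) : C := cintegral (fun z => u z * (v z)^*).

Definition bnorm (u : C -> C) : R :=
  Num.sqrt (pi^-1 * Rintegral area disk2 (sqmod u)).

(** T_phi f = P (phi f): the unique g in L^2_a with phi f - g orthogonal to L^2_a *)
Definition is_toeplitz_image (phi f g : C -> C) : Prop :=
  Bergman g /\ forall h, Bergman h -> inner (fun z => phi z * f z - g z) h = 0.

Definition Toeplitz (phi : C -> C) (f : C -> C) : C -> C :=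
  ClassicalEpsilon.epsilon (inhabits (fun _ : C => 0)) (is_toeplitz_image phi f).

(** T - lambda I, as a map on L^2_a *)
Definition Toeplitz_shift (phi : C -> C) (lam : C) (f : C -> C) : C -> C :=
  fun z => Toeplitz phi f z - lam * f z.

(** invertibility in B(L^2_a): a bounded two-sided inverse *)
Definition invertible_on_Bergman (T : (C -> C) -> (C -> C)) : Prop :=
  exists S : (C -> C) -> (C -> C),
    (forall f, Bergman f -> Bergman (S f)) /\
    (forall f, Bergman f -> T (S f) = f) /\
    (forall f, Bergman f -> S (T f) = f) /\
    (exists M : R, forall f, Bergman f -> bnorm (S f) <= M * bnorm f).

Definition spectrum_Toeplitz (phi : C -> C) : set C :=
  [set lam | ~ invertible_on_Bergman (Toeplitz_shift phi lam)].

Definition isolated_point (S : set C) (lam : C) : Prop :=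
  S lam /\ exists2 r : R, 0 < r & forall mu, S mu -> `|mu - lam| < r%:C -> mu = lam.

(** the data of the theorem *)
Definition c_k (k : nat) : C :=
  (((2^-1 : R) `^ (k%:R^-1))%:C * (cos (pi / k%:R) +i* sin (pi / k%:R))).

Definition alpha_of (k : nat) (beta : C) : C := - (beta ^+ k)^-1.

Definition p_of (k : nat) (beta : C) : {poly C} :=
  ((('X - (alpha_of k beta)%:P) * ('X + beta%:P) ^+ k - 1) %/ 'X)%R.

Definition symbol_of (k : nat) (beta : C) : C -> C :=
  fun z => z^* + (p_of k beta).[z].

End Bergman.

(* Main.v *)
(** Writing f = sum a_n z^n, the Bergman space becomes the space W of sequences with
sum |a_n|^2 / (n + 1) finite, and T_zbar acts by a_n |-> (n + 1)/(n + 2) a_(n+1).  With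
G = z^-1 int_0^z f this says T_zbar f = G', so that (T - lam) f = q G' + (p - lam) G for
q = 1 + z (p - lam) = (z - alpha)(z + beta)^k - lam z, a first order differential operator
in G.  The spectrum is read off from the roots of q: a root on the unit circle destroys the
lower bound; otherwise the outer roots are gauged away by an exponential E with E' = s E,
leaving Q G' + s0 G with Q vanishing exactly at the inner roots.  With no inner root there
is a kernel, with at least two the operator is not onto (a dimension count on polynomials),
and with exactly one inner root x it is invertible unless D(x) = x q'(x) is 1/m for some
m >= 1.  An isolated point lam must be of this last kind.  Eliminating lam gives
D(x) = (x + beta)^(k-1) (k x^2 - (k-1) alpha x + alpha beta), which is bounded away from 0 at
such x, so only finitely many m, x and lam occur.  For lam = 0 the inner root is alpha,
D(alpha) = 1/2, and (z - alpha)^2 E^-1 solves the homogeneous equation; for small lam <> 0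
the inner root x has D(x) close to but not 1/2. *)

(* The choice of beta is explained by alpha + beta = beta c with c^k = -1/2: it gives D(alpha) =
   alpha (alpha + beta)^k = -c^k = 1/2. The spectrum is never computed in full, and neither index
   theory nor Rouche's theorem is used. Two implications suffice: a point outside the spectrum has
   exactly one root of q in the closed disk, an inner one; and a spectral point with this root
   pattern has D(x) = 1/m. An isolated point inherits the pattern from nearby points outside the
   spectrum by explicit polynomial estimates. It cannot have a root on the circle, because moving
   that root along the circle produces further spectral points close by. The values 1/m come from
   the recursion (n + s) h_n - x (n + 1) h_(n+1) = g_n with s = -1/D(x), which is the gauged
   equation for one inner root: it is solved from infinity downwards unless s = -m. Holomorphy means
   pointwise differentiability here, so the passage to sequences rests on Goursat's theorem and
   Cauchy's formula; the moments of monomials come from the divergence theorem instead of polar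
   coordinates. *)
Require Import Defs.
From HB Require Import structures.
From mathcomp Require Import all_boot all_order all_algebra.
From mathcomp Require Import all_classical all_reals all_analysis.
From mathcomp Require Import measurable_realfun.
From mathcomp Require Import complex.
From mathcomp Require Import ring lra zify.
Import Order.TTheory GRing.Theory Num.Theory.
Import numFieldNormedType.Exports.
Local Open Scope ring_scope.
Local Open Scope classical_set_scope.
Local Open Scope complex_scope.

(** * Complex numbers and series *)

Section Modulus.
Context {R : realType}.
Notation C := (complex R).
Implicit Types (z w : C) (u v : nat -> C).

(** The norm of [C] takes values in [C]; all estimates use this real-valued modulus instead. *)
Definition cm z : R := complex.Re `|z|.

Lemma cmE z : `|z| = (cm z)%:C.
Proof. by rewrite /cm normc_def. Qed.

Lemma cm_sqrt z : cm z = Num.sqrt ((complex.Re z) ^+ 2 + (complex.Im z) ^+ 2).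
Proof. by rewrite /cm normc_def. Qed.

Lemma cm_sqr z : cm z ^+ 2 = (complex.Re z) ^+ 2 + (complex.Im z) ^+ 2.
Proof. by rewrite cm_sqrt sqr_sqrtr // addr_ge0 // sqr_ge0. Qed.

Lemma cm_ge0 z : 0 <= cm z.
Proof. by rewrite cm_sqrt sqrtr_ge0. Qed.

Lemma cmM z w : cm (z * w) = cm z * cm w.
Proof. by apply: complexI; rewrite rmorphM /= -!cmE normrM. Qed.

Lemma cmD z w : cm (z + w) <= cm z + cm w.
Proof. by rewrite -lecR rmorphD /= -!cmE ler_normD. Qed.

Lemma cm0 : cm 0 = 0.
Proof. by apply: complexI; rewrite -cmE normr0. Qed.

Lemma cm1 : cm 1 = 1.
Proof. by apply: complexI; rewrite -cmE normr1. Qed.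

Lemma cmN z : cm (- z) = cm z.
Proof. by apply: complexI; rewrite -!cmE normrN. Qed.

Lemma cmBC z w : cm (z - w) = cm (w - z).
Proof. by rewrite -opprB cmN. Qed.

Lemma cmB z w : cm (z - w) <= cm z + cm w.
Proof. by rewrite (le_trans (cmD _ _)) // cmN. Qed.

Lemma cmB_ge z w : cm z - cm w <= cm (z - w).
Proof. by rewrite lerBlDr (le_trans _ (cmD _ _)) // subrK. Qed.

Lemma cmD_ge z w : cm z - cm w <= cm (z + w).
Proof. by rewrite -[w in cm (z + w)]opprK -[cm w]cmN cmB_ge. Qed.

Lemma cm_eq0 z : (cm z == 0) = (z == 0).
Proof. by rewrite -(inj_eq (@complexI R)) -cmE normr_eq0. Qed.

Lemma cm_gt0 z : (0 < cm z) = (z != 0).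
Proof. by rewrite lt_def cm_ge0 andbT cm_eq0. Qed.

Lemma cmX z n : cm (z ^+ n) = cm z ^+ n.
Proof. by elim: n => [|n IH]; rewrite ?cm1 // !exprS cmM IH. Qed.

Lemma cmV z : cm z^-1 = (cm z)^-1.
Proof.
have [->|z0] := eqVneq z 0; first by rewrite invr0 cm0 invr0.
apply: (mulfI (x := cm z)); first by rewrite cm_eq0.
by rewrite -cmM divff // cm1 divff // cm_eq0.
Qed.

Lemma cm_real (x : R) : cm x%:C = `|x|.
Proof. by rewrite cm_sqrt /= expr0n addr0 sqrtr_sqr. Qed.

Lemma cm_nat n : cm n%:R = n%:R.
Proof. by rewrite -(rmorph_nat (real_complex R)) cm_real ger0_norm. Qed.

Lemma cm_conj z : cm z^* = cm z.
Proof. by apply: complexI; rewrite -!cmE normcJ. Qed.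

Lemma cm_Re z : `|complex.Re z| <= cm z.
Proof. by rewrite -lecR -cmE normc_ge_Re. Qed.

Lemma cm_Im z : `|complex.Im z| <= cm z.
Proof.
rewrite cm_sqrt -sqrtr_sqr ler_wsqrtr // lerDr sqr_ge0 //.
Qed.

Lemma cm_le_ReIm z : cm z <= `|complex.Re z| + `|complex.Im z|.
Proof.
rewrite -(ler_pXn2r (n := 2)) ?nnegrE ?cm_ge0 ?addr_ge0 // cm_sqr sqrrD !real_normK ?num_real //.
by rewrite lerD2r lerDl mulrn_wge0 // mulr_ge0.
Qed.

Lemma cm_sum I (r : seq I) (P : pred I) (F : I -> C) :
  cm (\sum_(i <- r | P i) F i) <= \sum_(i <- r | P i) cm (F i).
Proof.
elim/big_ind2 : _ => //; first by rewrite cm0.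
by move=> x1 x2 y1 y2 h1 h2; rewrite (le_trans (cmD _ _)) // lerD.
Qed.

Lemma cm_lt1 z : (`|z| < 1) = (cm z < 1).
Proof. by rewrite cmE -[1]/((1:R)%:C) ltcR. Qed.

Lemma Re_sum I (r : seq I) (P : pred I) (F : I -> C) :
  complex.Re (\sum_(i <- r | P i) F i) = \sum_(i <- r | P i) complex.Re (F i).
Proof. by apply: (big_morph (@complex.Re R)) => // -[? ?] [? ?]. Qed.

Lemma Im_sum I (r : seq I) (P : pred I) (F : I -> C) :
  complex.Im (\sum_(i <- r | P i) F i) = \sum_(i <- r | P i) complex.Im (F i).
Proof. by apply: (big_morph (@complex.Im R)) => // -[? ?] [? ?]. Qed.

Lemma ReB z w : complex.Re (z - w) = complex.Re z - complex.Re w.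
Proof. by case: z w => [? ?] [? ?]. Qed.

Lemma ImB z w : complex.Im (z - w) = complex.Im z - complex.Im w.
Proof. by case: z w => [? ?] [? ?]. Qed.

(** Componentwise limits; the value is meaningful under [summable], which bounds the partial sums of
    the moduli by an explicit constant. *)
Definition csum u : C :=
  limn (series (fun n => complex.Re (u n))) +i*
  limn (series (fun n => complex.Im (u n))).

Definition summable u (B : R) := forall M, \sum_(n < M) cm (u n) <= B.

Lemma bounded_series_cvgn (a b : nat -> R) (B : R) :
  (forall n, `|a n| <= b n) -> (forall M, \sum_(n < M) b n <= B) ->
  cvgn (series a).
Proof.
move=> ab bB; apply: normed_cvg.
apply: (@series_le_cvg _ _ b) => [n|n|n|]; rewrite /= ?normr_ge0 //.
  exact: le_trans (ab n).
apply: nondecreasing_is_cvgn.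
  apply/nondecreasing_seqP => n; rewrite /series /= big_nat_recr //= lerDl.
  exact: le_trans (ab n).
exists B => _ [M _ <-]; rewrite /series /= big_mkord; exact: bB.
Qed.

Lemma csum_cvg u B : summable u B -> forall e, 0 < e ->
  exists N : nat, forall M, (N <= M)%N -> cm (csum u - \sum_(n < M) u n) < e.
Proof.
move=> uB e e0.
have c1 : cvgn (series (fun n => complex.Re (u n))).
  by apply: (bounded_series_cvgn _ _ _ (fun n => cm_Re (u n)) uB).
have c2 : cvgn (series (fun n => complex.Im (u n))).
  by apply: (bounded_series_cvgn _ _ _ (fun n => cm_Im (u n)) uB).
have e20 : 0 < e / 2 by rewrite divr_gt0.
have /cvgrPdist_lt /(_ _ e20) [N1 _ h1] := c1.
have /cvgrPdist_lt /(_ _ e20) [N2 _ h2] := c2.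
exists (maxn N1 N2) => M; rewrite geq_max => /andP[/h1 /= H1 /h2 /= H2].
apply: le_lt_trans (cm_le_ReIm _) _; rewrite [ltRHS]splitr ltrD //.
  by move: H1; rewrite /csum /series /= big_mkord raddfB /= Re_sum.
by move: H2; rewrite /csum /series /= big_mkord raddfB /= Im_sum.
Qed.

Lemma real_le_eps (x y : R) : (forall e, 0 < e -> x <= y + e) -> x <= y.
Proof. by move=> h; apply/ler_addgt0Pr. Qed.

Lemma cm_eps0 z : (forall e, 0 < e -> cm z <= e) -> z = 0.
Proof.
move=> h; apply/eqP; rewrite -cm_eq0 eq_le cm_ge0 andbT.
by apply: real_le_eps => e e0; rewrite add0r h.
Qed.

Lemma csum_tail u B N b : summable u B ->
  (forall M, (N <= M)%N -> cm (\sum_(n < M) u n - \sum_(n < N) u n) <= b) ->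
  cm (csum u - \sum_(n < N) u n) <= b.
Proof.
move=> uB h; apply: real_le_eps => e e0.
have [N' hN'] := csum_cvg _ _ uB _ e0.
have {}hN' := hN' _ (leq_maxl N' N); have {}h := h _ (leq_maxr N' N).
rewrite -[csum u - _](subrKA (\sum_(n < maxn N' N) u n)) addrC.
by rewrite (le_trans (cmD _ _)) // lerD // ltW.
Qed.

Lemma csum_le u B : summable u B -> cm (csum u) <= B.
Proof.
move=> uB; suff: cm (csum u - \sum_(n < 0) u n) <= B by rewrite big_ord0 subr0.
apply: (csum_tail _ B) => // M _; rewrite big_ord0 subr0.
exact: le_trans (cm_sum _ _ _ _) _.
Qed.

Lemma csum_unique u B z : summable u B ->
  (forall e, 0 < e -> exists N : nat, forall M, (N <= M)%N ->
     cm (z - \sum_(n < M) u n) <= e) -> csum u = z.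
Proof.
move=> uB h; apply/eqP; rewrite -subr_eq0; apply/eqP/cm_eps0 => e e0.
have e20 : 0 < e / 2 by rewrite divr_gt0.
have [N hN] := h _ e20; have [N' hN'] := csum_cvg _ _ uB _ e20.
have {}hN' := hN' _ (leq_maxl N' N); have {}hN := hN _ (leq_maxr N' N).
rewrite -[csum u - _](subrKA (\sum_(n < maxn N' N) u n)).
rewrite (le_trans (cmD _ _)) // [e]splitr lerD // ?(ltW hN') //.
by rewrite -cmN opprB.
Qed.

Lemma summableS u B : summable u B -> summable (fun n => u n.+1) B.
Proof.
move=> uB M; apply: le_trans (uB M.+1).
by rewrite big_ord_recl /= lerDr cm_ge0.
Qed.

Lemma csumS u B : summable u B -> csum u = u 0%N + csum (fun n => u n.+1).
Proof.
move=> uB; apply: (csum_unique _ _ _ uB) => e e0.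
have [N hN] := csum_cvg _ _ (summableS _ _ uB) _ e0.
exists N.+1 => -[//|M] NM; rewrite big_ord_recl /=.
by rewrite opprD addrACA subrr add0r ltW // hN.
Qed.

Lemma summableZ u B z : summable u B -> summable (fun n => z * u n) (cm z * B).
Proof.
move=> uB M; under eq_bigr do rewrite cmM.
by rewrite -mulr_sumr ler_wpM2l // cm_ge0.
Qed.

Lemma csumZ u B z : summable u B -> csum (fun n => z * u n) = z * csum u.
Proof.
move=> uB; apply: (csum_unique _ _ _ (summableZ _ _ z uB)) => e e0.
have e'0 : 0 < e / (cm z + 1) by rewrite divr_gt0 // ltr_wpDl // cm_ge0.
have [N hN] := csum_cvg _ _ uB _ e'0; exists N => M /hN H.
rewrite -mulr_sumr -mulrBr cmM.
apply: (@le_trans _ _ ((cm z + 1) * (e / (cm z + 1)))).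
  by apply: ler_pM; rewrite ?cm_ge0 ?ltW // ltrDl.
by rewrite mulrC divfK // gt_eqF // ltr_wpDl // cm_ge0.
Qed.

Lemma summableD u v B B' : summable u B -> summable v B' ->
  summable (fun n => u n + v n) (B + B').
Proof.
move=> uB vB M; apply: le_trans (lerD (uB M) (vB M)).
by rewrite -big_split /=; apply: ler_sum => i _; exact: cmD.
Qed.

Lemma csumD u v B B' : summable u B -> summable v B' ->
  csum (fun n => u n + v n) = csum u + csum v.
Proof.
move=> uB vB; apply: (csum_unique _ _ _ (summableD _ _ _ _ uB vB)) => e e0.
have e20 : 0 < e / 2 by rewrite divr_gt0.
have [N hN] := csum_cvg _ _ uB _ e20; have [N' hN'] := csum_cvg _ _ vB _ e20.
exists (maxn N N') => M; rewrite geq_max => /andP[/hN H /hN' H'].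
rewrite big_split /= opprD addrACA (le_trans (cmD _ _)) // [e]splitr lerD //; exact: ltW.
Qed.

Lemma geom_sum_le (r : R) M : 0 <= r < 1 -> \sum_(n < M) r ^+ n <= (1 - r)^-1.
Proof.
move=> /andP[r0 r1]; have r'0 : 0 < 1 - r by rewrite subr_gt0.
rewrite -[leRHS]mul1r ler_pdivlMr // mulrC -opprB mulNr -subrX1 opprB.
by rewrite gerBl exprn_ge0.
Qed.

Lemma geom_summable u K r : 0 <= r < 1 -> (forall n, cm (u n) <= K * r ^+ n) ->
  summable u (K / (1 - r)).
Proof.
move=> r01 h M; apply: (@le_trans _ _ (\sum_(n < M) K * r ^+ n)).
  by apply: ler_sum => i _.
have K0 : 0 <= K by have := h 0%N; rewrite expr0 mulr1; apply: le_trans (cm_ge0 _).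
by rewrite -mulr_sumr ler_wpM2l // geom_sum_le.
Qed.

Lemma geom_csum_tail u K r N : 0 <= r < 1 -> (forall n, cm (u n) <= K * r ^+ n) ->
  cm (csum u - \sum_(n < N) u n) <= K * r ^+ N / (1 - r).
Proof.
move=> r01 h; apply: (csum_tail _ _ _ _ (geom_summable _ _ _ r01 h)) => M NM.
rewrite -(subnKC NM) big_split_ord /= addrAC subrr add0r.
apply: le_trans (cm_sum _ _ _ _) _.
apply: (@le_trans _ _ (\sum_(i < M - N) K * r ^+ (N + i))).
  by apply: ler_sum => i _; exact: h.
have K0 : 0 <= K by have := h 0%N; rewrite expr0 mulr1; apply: le_trans (cm_ge0 _).
under eq_bigr do rewrite exprD mulrA.
rewrite -mulr_sumr ler_wpM2l ?geom_sum_le // mulr_ge0 // exprn_ge0 //.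
by case/andP: r01.
Qed.

Lemma exprn_lt_eps (r e : R) : 0 <= r < 1 -> 0 < e -> exists N : nat, forall n, (N <= n)%N -> r ^+ n < e.
Proof.
move=> /andP[r0 r1] e0.
have /cvgrPdist_lt /(_ _ e0) [N _ h] : (fun n => r ^+ n) @ \oo --> (0 : R).
  by apply: cvg_expr; rewrite ger0_norm.
by exists N => n /h /=; rewrite sub0r normrN ger0_norm // exprn_ge0.
Qed.

End Modulus.

(** * Power series of holomorphic functions *)

Section ComplexCalculus.
Context {R : realType}.
Notation C := (complex R).
Implicit Types (z w c : C) (f g : C -> C).

Lemma is_derive_epsP (f : R -> R) (x df : R) : is_derive x (1 : R) f df <->
  forall e, 0 < e -> exists2 d, 0 < d & forall y, `|y - x| < d ->
    `|f y - f x - df * (y - x)| <= e * `|y - x|.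
Proof.
split=> [[fx <-] e e0|h].
- have /cvgrPdist_le /(_ _ e0) := fx.
  rewrite -/(derive f x 1) => /nbhs_ballP[d /= d0 hd]; exists d => // y yd.
  have [->|yx] := eqVneq y x; first by rewrite !subrr !mulr0 subr0 normr0 mulr0.
  have yx0 : y - x != 0 by rewrite subr_eq0.
  have := hd (y - x); rewrite /ball /= sub0r normrN => /(_ yd yx0).
  rewrite -[(y - x) *: 1]/((y - x) * 1) mulr1 subrK => H.
  rewrite -ler_pdivrMr ?normr_gt0 // -normfV -normrM.
  apply: le_trans H; rewrite -normrN le_eqVlt; apply/orP; left; apply/eqP; congr (`| _ |).
  by rewrite -[(y - x)^-1 *: _]/((y - x)^-1 * _); field.
- have cv : h^-1 *: (f (h *: 1 + x) - f x) @[h --> 0^'] --> df.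
    apply/cvgrPdist_le => e e0; have [d d0 hd] := h _ e0.
    apply/nbhs_ballP; exists d => //= s; rewrite /ball /= sub0r normrN => sd s0.
    have := hd (s + x); rewrite addrK => /(_ sd); rewrite -ler_pdivrMr ?normr_gt0 // => H.
    rewrite -[s *: 1]/(s * 1) mulr1 distrC; apply: le_trans H.
    rewrite -normfV -normrM le_eqVlt; apply/orP; left; apply/eqP; congr (`| _ |).
    by rewrite -[s^-1 *: _]/(s^-1 * _); field.
  by split; [apply/cvg_ex; exists df | exact/cvg_lim].
Qed.

Definition cderiv (V : R -> C) (t : R) (v : C) : Prop :=
  is_derive t (1 : R) (@complex.Re R \o V) (complex.Re v) /\
  is_derive t (1 : R) (@complex.Im R \o V) (complex.Im v).

Lemma cderivE (V : R -> C) t v : cderiv V t v <->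
  forall e, 0 < e -> exists2 d, 0 < d & forall y, `|y - t| < d ->
    cm (V y - V t - v * (y - t)%:C) <= e * `|y - t|.
Proof.
have ReE y : complex.Re (V y - V t - v * (y - t)%:C) =
    (@complex.Re R \o V) y - (@complex.Re R \o V) t - complex.Re v * (y - t).
  by rewrite /=; case: (V y) (V t) (v) => [a b] [a' b'] [p q] /=; ring.
have ImE y : complex.Im (V y - V t - v * (y - t)%:C) =
    (@complex.Im R \o V) y - (@complex.Im R \o V) t - complex.Im v * (y - t).
  by rewrite /=; case: (V y) (V t) (v) => [a b] [a' b'] [p q] /=; ring.
split=> [[/is_derive_epsP h1 /is_derive_epsP h2] e e0|h].
- have e20 : 0 < e / 2 by rewrite divr_gt0.
  have [d1 d10 {}h1] := h1 _ e20; have [d2 d20 {}h2] := h2 _ e20.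
  exists (Num.min d1 d2); first by rewrite lt_min d10.
  move=> y; rewrite lt_min => /andP[/h1 H1 /h2 H2].
  apply: le_trans (cm_le_ReIm _) _; rewrite ReE ImE [e]splitr mulrDl.
  exact: lerD.
- split; apply/is_derive_epsP => e /h[d d0 hd]; exists d => // y /hd; apply: le_trans.
    by rewrite -ReE cm_Re.
  by rewrite -ImE cm_Im.
Qed.

Definition ccont (u : R -> C) : Prop :=
  continuous (@complex.Re R \o u) /\ continuous (@complex.Im R \o u).

Lemma ccontP (u : R -> C) : ccont u <->
  forall t e, 0 < e -> exists2 d, 0 < d & forall y, `|y - t| < d -> cm (u y - u t) <= e.
Proof.
split=> [[h1 h2] t e e0|h].
- have e20 : 0 < e / 2 by rewrite divr_gt0.
  have /cvgrPdist_le /(_ _ e20) /nbhs_ballP[d1 /= d10 {}h1] := h1 t.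
  have /cvgrPdist_le /(_ _ e20) /nbhs_ballP[d2 /= d20 {}h2] := h2 t.
  exists (Num.min d1 d2); first by rewrite lt_min d10.
  move=> y; rewrite lt_min distrC => /andP[/h1 /= H1 /h2 /= H2].
  apply: le_trans (cm_le_ReIm _) _; rewrite [e]splitr -normrN -[X in _ + X]normrN.
  by rewrite -!raddfN opprB !raddfB; exact: lerD.
- split=> t; apply/cvgrPdist_le => e /(h t)[d d0 hd]; apply/nbhs_ballP;
    exists d => // y; rewrite /ball /= => yd; rewrite -raddfB.
    by apply: le_trans (cm_Re _) _; rewrite cmBC hd // distrC.
  by apply: le_trans (cm_Im _) _; rewrite cmBC hd // distrC.
Qed.

(** The mean value theorem for [U - V]. *)
Lemma is_derive_le (U V u v : R -> R) (a b e : R) : a <= b ->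
  (forall t, a <= t <= b -> is_derive t 1 U (u t)) ->
  (forall t, a <= t <= b -> is_derive t 1 V (v t)) ->
  (forall t, a <= t <= b -> `|u t - v t| <= e) ->
  `|(U b - U a) - (V b - V a)| <= e * (b - a).
Proof.
move=> ab dU dV uv.
have dUV t : a <= t <= b -> is_derive t 1 (U - V) (u t - v t).
  by move=> tab; apply: is_deriveB; [exact: dU | exact: dV].
have [||c cab] := @MVT_segment R (U - V) (fun t => u t - v t) a b ab.
- by move=> t; rewrite in_itv /= => /andP[/ltW at_ /ltW tb]; apply: dUV; rewrite at_.
- apply: derivable_within_continuous => t; rewrite in_itv /= => /dUV h; by case: h.
rewrite !fctE => E.
rewrite (_ : U b - U a - (V b - V a) = (U b - V b) - (U a - V a)); last by ring.
rewrite E.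
rewrite normrM [`|b - a|]ger0_norm ?subr_ge0 // ler_wpM2r ?subr_ge0 //.
by apply: uv; move: cab; rewrite in_itv.
Qed.

(** The factor 2 is the price of applying the real mean value theorem to the real and imaginary
    parts separately. *)
Lemma cderiv_le (U V u v : R -> C) (a b e : R) : a <= b ->
  (forall t, a <= t <= b -> cderiv U t (u t)) ->
  (forall t, a <= t <= b -> cderiv V t (v t)) ->
  (forall t, a <= t <= b -> cm (u t - v t) <= e) ->
  cm ((U b - U a) - (V b - V a)) <= 2 * e * (b - a).
Proof.
move=> ab dU dV uv.
apply: le_trans (cm_le_ReIm _) _.
rewrite (_ : 2 * e * _ = e * (b - a) + e * (b - a)); last by ring.
apply: lerD; rewrite !(ReB, ImB).
- apply: (@is_derive_le (@complex.Re R \o U) (@complex.Re R \o V)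
           (@complex.Re R \o u) (@complex.Re R \o v)) => // t tab.
  + by case: (dU t tab).
  + by case: (dV t tab).
  + by apply: le_trans (uv t tab); rewrite /= -ReB cm_Re.
- apply: (@is_derive_le (@complex.Im R \o U) (@complex.Im R \o V)
           (@complex.Im R \o u) (@complex.Im R \o v)) => // t tab.
  + by case: (dU t tab).
  + by case: (dV t tab).
  + by apply: le_trans (uv t tab); rewrite /= -ImB cm_Im.
Qed.

(* The window ]-8, 8[ contains the unit disk and [0, 2 pi]. *)
Lemma ex_antiderivative (u : R -> R) : continuous u ->
  exists U : R -> R, forall t : R, -8 < t < 8 -> is_derive t 1 U (u t).
Proof.
move=> cu.
exists (fun x => Rintegral (@lebesgue_measure R) `[-8, x] u) => t /andP[t1 t2].
have [|||d1 d2] := @continuous_FTC1_closed R u (-8) t 8 t2.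
- apply: continuous_compact_integrable; first exact: segment_compact.
  exact: continuous_subspaceT.
- exact: t1.
- exact: cu.
by apply: DeriveDef; [exact: d1 | rewrite -derive1E; exact: d2].
Qed.

(** Continuity is assumed inside the existential, so that a primitive [cprim u] can be chosen for
    every [u]. *)
Lemma ex_cantiderivative (u : R -> C) : exists U : R -> C,
  ccont u -> forall t : R, -8 < t < 8 -> cderiv U t (u t).
Proof.
have [[h1 h2]|nc] := pselect (ccont u); last by exists u.
have [U1 hU1] := ex_antiderivative _ h1; have [U2 hU2] := ex_antiderivative _ h2.
by exists (fun t => U1 t +i* U2 t) => _ t t8; split; [exact: hU1|exact: hU2].
Qed.

Definition cprim (u : R -> C) : R -> C := projT1 (cid (ex_cantiderivative u)).
(** As an increment of a chosen primitive, the integral is additive over intervals and changes sign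
    with orientation by mere ring identities. *)
Definition cint (u : R -> C) (a b : R) : C := cprim u b - cprim u a.

Lemma cprimP (u : R -> C) t : ccont u -> -8 < t < 8 -> cderiv (cprim u) t (u t).
Proof. by move=> cu; rewrite /cprim; case: cid => U /= /(_ cu t). Qed.

(** The basic estimate for line integrals: replacing the integrand by one with a known primitive
    costs the uniform distance times the length. The fundamental theorem, the norm bound and
    Goursat's local estimate are instances. *)
Lemma cint_approx (u V v : R -> C) (a b e : R) : ccont u ->
  -8 < a -> a <= b -> b < 8 ->
  (forall t, a <= t <= b -> cderiv V t (v t)) ->
  (forall t, a <= t <= b -> cm (u t - v t) <= e) ->
  cm (cint u a b - (V b - V a)) <= 2 * e * (b - a).
Proof.
move=> cu a8 ab b8 dV uv; apply: (cderiv_le _ _ u v) => // t /andP[at_ tb].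
by apply: cprimP => //; rewrite (lt_le_trans a8) // (le_lt_trans tb).
Qed.

Lemma cint_FTC (u V : R -> C) (a b : R) : ccont u -> -8 < a -> a <= b -> b < 8 ->
  (forall t, a <= t <= b -> cderiv V t (u t)) -> cint u a b = V b - V a.
Proof.
move=> cu a8 ab b8 dV; apply/eqP; rewrite -subr_eq0 -cm_eq0 eq_le cm_ge0 andbT.
apply: le_trans (cint_approx u V u a b 0 cu a8 ab b8 dV _) _; last by rewrite mulr0 mul0r.
by move=> t _; rewrite subrr cm0.
Qed.

Lemma cderiv_lin c (V : R -> C) (t : R) w : 
  cderiv V t w -> cderiv (fun t => c * V t) t (c * w).
Proof.
move=> /cderivE h; apply/cderivE => e e0.
have c0 : 0 < cm c + 1 by rewrite ltr_wpDl // cm_ge0.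
have [d d0 hd] := h _ (divr_gt0 e0 c0); exists d => // y /hd H.
rewrite (_ : _ - _ = c * (V y - V t - w * (y - t)%:C)); last by ring.
rewrite cmM; apply: (@le_trans _ _ ((cm c + 1) * (e / (cm c + 1) * `|y - t|))).
  by apply: ler_pM; rewrite ?cm_ge0 // lerDl.
by rewrite mulrA [_ * (e / _)]mulrC divfK // gt_eqF.
Qed.

Lemma cderivD (V W : R -> C) (t : R) v w :
  cderiv V t v -> cderiv W t w -> cderiv (fun t => V t + W t) t (v + w).
Proof.
move=> [h1 h2] [h3 h4]; split; rewrite raddfD.
  rewrite (_ : _ \o _ = (@complex.Re R \o V) + (@complex.Re R \o W)); first exact: is_deriveD.
  by apply/funext => s; rewrite fctE /= raddfD.
rewrite (_ : _ \o _ = (@complex.Im R \o V) + (@complex.Im R \o W)); first exact: is_deriveD.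
by apply/funext => s; rewrite fctE /= raddfD.
Qed.

Lemma ccontD (u v : R -> C) : ccont u -> ccont v -> ccont (fun t => u t + v t).
Proof.
move=> /ccontP h1 /ccontP h2; apply/ccontP => t e e0.
have e20 : 0 < e / 2 by rewrite divr_gt0.
have [d1 d10 {}h1] := h1 t _ e20; have [d2 d20 {}h2] := h2 t _ e20.
exists (Num.min d1 d2); first by rewrite lt_min d10.
move=> y; rewrite lt_min => /andP[/h1 H1 /h2 H2].
rewrite opprD addrACA [e]splitr; apply: le_trans (cmD _ _) _; exact: lerD.
Qed.

Lemma ccontM (u v : R -> C) : ccont u -> ccont v -> ccont (fun t => u t * v t).
Proof.
move=> /ccontP h1 /ccontP h2; apply/ccontP => t e e0.
set K := cm (u t) + cm (v t) + 1.
have K0 : 0 < K by rewrite ltr_wpDl // addr_ge0 ?cm_ge0.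
have e'0 : 0 < Num.min 1 (e / K / 2) by rewrite lt_min ltr01 !divr_gt0.
have [d1 d10 {}h1] := h1 t _ e'0; have [d2 d20 {}h2] := h2 t _ e'0.
exists (Num.min d1 d2); first by rewrite lt_min d10.
move=> y; rewrite lt_min => /andP[/h1 H1 /h2 H2].
have {H1} [H1 H1'] : cm (u y - u t) <= 1 /\ cm (u y - u t) <= e / K / 2.
  by move: H1; rewrite le_min => /andP[].
have {H2} [H2 H2'] : cm (v y - v t) <= 1 /\ cm (v y - v t) <= e / K / 2.
  by move: H2; rewrite le_min => /andP[].
have uy : cm (u y) <= K.
  rewrite -[u y](subrK (u t)) (le_trans (cmD _ _)) // /K addrC -addrA lerD2l.
  by rewrite (le_trans H1) // lerDr cm_ge0.
rewrite (_ : _ - _ = u y * (v y - v t) + (u y - u t) * v t); last by ring.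
apply: le_trans (cmD _ _) _; rewrite !cmM.
rewrite (_ : e = K * (e / K / 2) + (e / K / 2) * K); last first.
  by field; rewrite gt_eqF.
apply: lerD; apply: ler_pM; rewrite ?cm_ge0 //.
by rewrite /K addrAC lerDr addr_ge0 // cm_ge0.
Qed.

Lemma ccont_cst c : ccont (fun=> c).
Proof. by apply/ccontP => t e e0; exists 1 => // y _; rewrite subrr cm0 ltW. Qed.

Lemma ccontX (u : R -> C) n : ccont u -> ccont (fun t => u t ^+ n).
Proof.
move=> cu; elim: n => [|n IH]; first exact: ccont_cst.
by under [X in ccont X]eq_fun do rewrite exprS; exact: ccontM.
Qed.

Lemma cintD (u v : R -> C) (a b : R) : ccont u -> ccont v -> -8 < a -> a <= b -> b < 8 ->
  cint (fun t => u t + v t) a b = cint u a b + cint v a b.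
Proof.
move=> cu cv a8 ab b8.
rewrite (cint_FTC _ (fun t => cprim u t + cprim v t)) //; first 1 last.
- exact: ccontD.
- move=> t /andP[at_ tb]; apply: cderivD; apply: cprimP => //;
    by rewrite (lt_le_trans a8) // (le_lt_trans tb).
by rewrite /cint opprD addrACA.
Qed.

Lemma cintZ c (u : R -> C) (a b : R) : ccont u -> -8 < a -> a <= b -> b < 8 ->
  cint (fun t => c * u t) a b = c * cint u a b.
Proof.
move=> cu a8 ab b8.
rewrite (cint_FTC _ (fun t => c * cprim u t)) //; first 1 last.
- by apply: ccontM => //; exact: ccont_cst.
- move=> t /andP[at_ tb]; apply: cderiv_lin => //; apply: cprimP => //;
    by rewrite (lt_le_trans a8) // (le_lt_trans tb).
by rewrite /cint mulrBr.
Qed.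

Lemma cint_le (u : R -> C) (a b e : R) : ccont u -> -8 < a -> a <= b -> b < 8 ->
  (forall t, a <= t <= b -> cm (u t) <= e) -> cm (cint u a b) <= 2 * e * (b - a).
Proof.
move=> cu a8 ab b8 ue.
have -> : cint u a b = cint u a b - ((fun=> 0 : C) b - (fun=> 0 : C) a).
  by rewrite !subr0.
apply: (cint_approx _ _ (fun=> 0)) => // t; last by rewrite subr0; exact: ue.
by move=> _; split; exact: is_derive_cst.
Qed.

Lemma cint_sum (F : nat -> R -> C) M (a b : R) : (forall n, ccont (F n)) ->
  -8 < a -> a <= b -> b < 8 ->
  ccont (fun t => \sum_(n < M) F n t) /\
  cint (fun t => \sum_(n < M) F n t) a b = \sum_(n < M) cint (F n) a b.
Proof.
move=> cF a8 ab b8; elim: M => [|M [IH1 IH2]].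
  rewrite big_ord0; under [X in ccont X]eq_fun do rewrite big_ord0.
  under [X in cint X]eq_fun do rewrite big_ord0.
  split; first exact: ccont_cst.
  have /= E := cintZ 0 (fun=> 0) a b (ccont_cst 0) a8 ab b8.
  by move: E; rewrite !mul0r.
under [X in ccont X]eq_fun do rewrite big_ord_recr /=.
under [X in cint X]eq_fun do rewrite big_ord_recr /=.
by split; [exact: ccontD | rewrite cintD // IH2 big_ord_recr].
Qed.

End ComplexCalculus.

(** * Goursat's theorem for rectangles, with one exceptional point *)

Section Goursat.
Context {R : realType}.
Notation C := (complex R).
Implicit Types (z w c : C) (f g : C -> C).

(** Continuity on the whole plane makes the integrals along all segments legitimate; functions on
    the disk are extended by the retraction [ret] below. *)
Definition gcont g : Prop :=
  forall z e, 0 < e -> exists2 d, 0 < d & forall w, cm (w - z) < d -> cm (g w - g z) <= e.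

Definition cdiff g z c : Prop :=
  forall e, 0 < e -> exists2 d, 0 < d & forall w, cm (w - z) < d ->
    cm (g w - g z - c * (w - z)) <= e * cm (w - z).

Lemma gcont_hor g y : gcont g -> ccont (fun t => g (t +i* y)).
Proof.
move=> h; apply/ccontP => t e /(h (t +i* y))[d d0 hd]; exists d => // s st.
apply: hd; rewrite (_ : _ - _ = (s - t)%:C) ?cm_real //.
by apply/eqP; rewrite eq_complex /= subrr !eqxx.
Qed.

Lemma gcont_ver g x : gcont g -> ccont (fun s => g (x +i* s)).
Proof.
move=> h; apply/ccontP => t e /(h (x +i* t))[d d0 hd]; exists d => // s st.
apply: hd; apply: le_lt_trans (cm_le_ReIm _) _.
by rewrite /= subrr normr0 add0r.
Qed.

Definition Hint g y a b : C := cint (fun t => g (t +i* y)) a b.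
Definition Vint g x a b : C := cint (fun s => g (x +i* s)) a b.
(** The contour integral of [g] along the boundary of the rectangle, counterclockwise. *)
Definition Rint g x1 x2 y1 y2 : C :=
  Hint g y1 x1 x2 + 'i * Vint g x2 y1 y2 - Hint g y2 x1 x2 - 'i * Vint g x1 y1 y2.

Lemma Rint_splitx g x1 x2 x3 y1 y2 :
  Rint g x1 x3 y1 y2 = Rint g x1 x2 y1 y2 + Rint g x2 x3 y1 y2.
Proof. by rewrite /Rint /Hint /Vint /cint; ring. Qed.

Lemma Rint_splity g x1 x2 y1 y2 y3 :
  Rint g x1 x2 y1 y3 = Rint g x1 x2 y1 y2 + Rint g x1 x2 y2 y3.
Proof. by rewrite /Rint /Hint /Vint /cint; ring. Qed.

Lemma cm_i : cm ('i : C) = 1.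
Proof. by rewrite cm_sqrt /= expr0n /= add0r expr1n sqrtr1. Qed.

Lemma cderiv_affine A B y : 
  (forall t, cderiv (fun t : R => A * t%:C + B * ((t ^+ 2 / 2)%:C + 'i * (y * t)%:C)) t
    (A + B * (t +i* y))).
Proof.
move=> t; apply/cderivE => e e0.
have cB : 0 < cm B + 1 by rewrite ltr_wpDl // cm_ge0.
exists (e / (cm B + 1)) => [|s st]; first exact: divr_gt0.
rewrite (_ : _ - _ = B * (((s - t) ^+ 2) / 2)%:C); last first.
  case: A => a a'; case: B {cB st} => b b'.
  by apply/eqP; rewrite eq_complex /=; apply/andP; split; apply/eqP; field.
rewrite cmM cm_real ger0_norm ?divr_ge0 ?sqr_ge0 //.
rewrite -[(s - t) ^+ 2]real_normK ?num_real //.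
rewrite expr2 !mulrA mulrAC; apply: ler_wpM2r => //.
apply: (@le_trans _ _ ((cm B + 1) * (e / (cm B + 1)))); last first.
  by rewrite mulrC divfK // gt_eqF.
rewrite mulrAC; apply: (@le_trans _ _ (cm B * `|s - t|)).
  by rewrite ler_wpM2r // ler_pdivrMr // ler_peMr ?cm_ge0 // ler1n.
by apply: ler_pM; rewrite ?cm_ge0 ?lerDl ?ler01 // ltW.
Qed.

Lemma cderiv_affine_v A B x : 
  (forall t, cderiv (fun t : R => A * t%:C + B * ((x * t)%:C + 'i * (t ^+ 2 / 2)%:C)) t
    (A + B * (x +i* t))).
Proof.
move=> t; apply/cderivE => e e0.
have cB : 0 < cm B + 1 by rewrite ltr_wpDl // cm_ge0.
exists (e / (cm B + 1)) => [|s st]; first exact: divr_gt0.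
rewrite (_ : _ - _ = B * 'i * (((s - t) ^+ 2) / 2)%:C); last first.
  case: A => a a'; case: B {cB st} => b b'.
  by apply/eqP; rewrite eq_complex /=; apply/andP; split; apply/eqP; field.
rewrite !cmM cm_i mulr1 cm_real ger0_norm ?divr_ge0 ?sqr_ge0 //.
rewrite -[(s - t) ^+ 2]real_normK ?num_real //.
rewrite expr2 !mulrA mulrAC; apply: ler_wpM2r => //.
apply: (@le_trans _ _ ((cm B + 1) * (e / (cm B + 1)))); last first.
  by rewrite mulrC divfK // gt_eqF.
rewrite mulrAC; apply: (@le_trans _ _ (cm B * `|s - t|)).
  by rewrite ler_wpM2r // ler_pdivrMr // ler_peMr ?cm_ge0 // ler1n.
by apply: ler_pM; rewrite ?cm_ge0 ?lerDl ?ler01 // ltW.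
Qed.

(** An affine function has boundary integral 0 by its explicit primitives, so only the deviation
    counts: at most [2 * e] times the perimeter. *)
Lemma Rint_affine_le g A B e x1 x2 y1 y2 : gcont g ->
  -8 < x1 -> x1 <= x2 -> x2 < 8 -> -8 < y1 -> y1 <= y2 -> y2 < 8 ->
  (forall x y, x1 <= x <= x2 -> y1 <= y <= y2 ->
     cm (g (x +i* y) - (A + B * (x +i* y))) <= e) ->
  cm (Rint g x1 x2 y1 y2) <= 4 * e * ((x2 - x1) + (y2 - y1)).
Proof.
move=> cg h1 h2 h3 h4 h5 h6 H.
have y11 : y1 <= y1 <= y2 by rewrite lexx.
have y22 : y1 <= y2 <= y2 by rewrite lexx h5.
have x11 : x1 <= x1 <= x2 by rewrite lexx.
have x22 : x1 <= x2 <= x2 by rewrite lexx h2.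
have E1 := cint_approx _ _ _ _ _ _ (gcont_hor g y1 cg) h1 h2 h3
  (fun t _ => cderiv_affine A B y1 t) (fun t ht => H t y1 ht y11).
have E2 := cint_approx _ _ _ _ _ _ (gcont_hor g y2 cg) h1 h2 h3
  (fun t _ => cderiv_affine A B y2 t) (fun t ht => H t y2 ht y22).
have E3 := cint_approx _ _ _ _ _ _ (gcont_ver g x1 cg) h4 h5 h6
  (fun t _ => cderiv_affine_v A B x1 t) (fun t ht => H x1 t x11 ht).
have E4 := cint_approx _ _ _ _ _ _ (gcont_ver g x2 cg) h4 h5 h6
  (fun t _ => cderiv_affine_v A B x2 t) (fun t ht => H x2 t x22 ht).
move: E1 E2 E3 E4; rewrite -/(Hint g y1 x1 x2) -/(Hint g y2 x1 x2).
rewrite -/(Vint g x1 y1 y2) -/(Vint g x2 y1 y2).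
set X1 := (X in cm (_ - X) <= _); set X2 := (X in _ -> cm (_ - X) <= _ -> _).
set X3 := (X in _ -> _ -> cm (_ - X) <= _ -> _).
set X4 := (X in _ -> _ -> _ -> cm (_ - X) <= _ -> _) => E1 E2 E3 E4.
have -> : Rint g x1 x2 y1 y2 = (Hint g y1 x1 x2 - X1) + 'i * (Vint g x2 y1 y2 - X4)
   - (Hint g y2 x1 x2 - X2) - 'i * (Vint g x1 y1 y2 - X3).
  rewrite /Rint.
  suff : X1 + 'i * X4 - X2 - 'i * X3 = 0 by move=> E; rewrite -[LHS]subr0 -E; ring.
  rewrite /X1 /X2 /X3 /X4; case: (A) => a a'; case: (B) => b b'.
  by apply/eqP; rewrite eq_complex /=; apply/andP; split; apply/eqP; field.
apply: le_trans (cmB _ _) _; rewrite cmM cm_i mul1r.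
apply: le_trans (lerD (cmB _ _) (lexx _)) _.
apply: le_trans (lerD (lerD (cmD _ _) (lexx _)) (lexx _)) _; rewrite cmM cm_i mul1r.
by move: E1 E2 E3 E4; lra.
Qed.

(** Goursat's bisection as an induction principle; [s] is the scale of a rectangle with sides
    [w * s] and [h * s]. If [P] fails, it fails on some quarter, and the nested failing rectangles
    shrink to a point [(p, q)] where the local hypothesis is violated. *)
Lemma quad_induction (P : R -> R -> R -> Prop) (w h x0 y0 : R) : 0 <= w -> 0 <= h ->
  (forall x y s, 0 < s -> P x y (s / 2) -> P (x + w * (s / 2)) y (s / 2) ->
     P x (y + h * (s / 2)) (s / 2) ->
     P (x + w * (s / 2)) (y + h * (s / 2)) (s / 2) -> P x y s) ->
  (forall p q, x0 <= p <= x0 + w -> y0 <= q <= y0 + h ->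
     exists2 d, 0 < d & forall x y s, 0 < s < d ->
       x <= p <= x + w * s -> y <= q <= y + h * s -> P x y s) ->
  P x0 y0 1.
Proof.
move=> w0 h0 sub loc; apply: contrapT => nP.
pose T := (R * R * R)%type.
pose good (t : T) := 0 < t.2 /\ ~ P t.1.1 t.1.2 t.2.
pose next (t t' : T) := good t' /\ [/\ t'.2 = t.2 / 2, 
  t.1.1 <= t'.1.1 /\ t'.1.1 + w * t'.2 <= t.1.1 + w * t.2 &
  t.1.2 <= t'.1.2 /\ t'.1.2 + h * t'.2 <= t.1.2 + h * t.2].
have step t : good t -> exists t', next t t'.
  move: t => [[x y] s] [/= s0 nPt]; apply: contrapT => H; apply: nPt.
  have nx x' y' : x <= x' -> x' + w * (s / 2) <= x + w * s ->
      y <= y' -> y' + h * (s / 2) <= y + h * s -> P x' y' (s / 2).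
    move=> *; apply: contrapT => nP'; apply: H; exists (x', y', s / 2).
    by split; split=> //=; rewrite divr_gt0.
  have ws : 0 <= w * (s / 2) by rewrite mulr_ge0 // divr_ge0 // ltW.
  have hs : 0 <= h * (s / 2) by rewrite mulr_ge0 // divr_ge0 // ltW.
  have wE : w * s = w * (s / 2) + w * (s / 2) by field.
  have hE : h * s = h * (s / 2) + h * (s / 2) by field.
  by apply: sub => //; apply: nx; lra.
have g0 : good (x0, y0, 1) by split.
have [F [F0 FS]] : exists F : nat -> T, F 0%N = (x0, y0, 1) /\
    forall n, good (F n) /\ next (F n) (F n.+1).
  pose nx t := if pselect (good t) is left gt then projT1 (cid (step t gt)) else t.
  have nxP t : good t -> next t (nx t).
    by rewrite /nx => gt; case: pselect => // gt'; case: cid.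
  exists (fun n => iter n nx (x0, y0, 1)); split=> // n.
  have gn : good (iter n nx (x0, y0, 1)) by elim: n => //= n /nxP[].
  by split=> //; rewrite iterS; exact: nxP.
have sE n : (F n).2 = (2^-1) ^+ n.
  elim: n => [|n IH]; first by rewrite F0.
  by have [_ [_ [-> _ _]]] := FS n; rewrite IH exprS mulrC.
have mono n m : (n <= m)%N ->
    ((F n).1.1 <= (F m).1.1 /\ (F m).1.1 + w * (F m).2 <= (F n).1.1 + w * (F n).2) /\
    ((F n).1.2 <= (F m).1.2 /\ (F m).1.2 + h * (F m).2 <= (F n).1.2 + h * (F n).2).
  move=> /subnKC <-; elim: (m - n)%N => [|k IH]; first by rewrite addn0 !lexx.
  rewrite addnS; have [_ [_ [_ [a1 a2] [b1 b2]]]] := FS (n + k)%N.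
  move: IH => [[c1 c2] [d1 d2]]; split; split.
  - exact: le_trans a1.
  - exact: le_trans c2.
  - exact: le_trans b1.
  - exact: le_trans d2.
have s0 n : 0 < (F n).2 by rewrite sE exprn_gt0.
have ex_lim (u l : nat -> R) : (forall n m, (n <= m)%N -> u n <= u m /\ u m + l m <= u n + l n) ->
    (forall n, 0 <= l n) -> exists p, forall n, u n <= p <= u n + l n.
  move=> H l0; exists (sup (range u)) => n.
  have hs : has_sup (range u).
    split; first by exists (u 0%N), 0%N.
    exists (u 0%N + l 0%N) => _ [m _ <-]; have [_ +] := H 0%N m isT.
    by apply: le_trans; rewrite lerDl.
  apply/andP; split; first by apply: sup_ubound; [case: hs | exists n].
  apply: sup_le_ub; first by case: hs.
  move=> _ [m _ <-]; have [nm|/ltnW mn] := leqP n m.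
    by have [_] := H _ _ nm; apply: le_trans; rewrite lerDl.
  by have [+ _] := H _ _ mn; move/le_trans; apply; rewrite lerDl.
have [p hp] := ex_lim (fun n => (F n).1.1) (fun n => w * (F n).2)
  (fun n m nm => (mono n m nm).1) (fun n => mulr_ge0 w0 (ltW (s0 n))).
have [q hq] := ex_lim (fun n => (F n).1.2) (fun n => h * (F n).2)
  (fun n m nm => (mono n m nm).2) (fun n => mulr_ge0 h0 (ltW (s0 n))).
have [||d d0 hd] := loc p q.
- by have := hp 0%N; rewrite F0 /= mulr1.
- by have := hq 0%N; rewrite F0 /= mulr1.
have [|N /(_ _ (leqnn N)) hN] := exprn_lt_eps (2^-1) d _ d0; first by lra.
have [[_ nPN] _] := FS N; apply: nPN; apply: hd => //.
by rewrite s0 sE hN.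
Qed.

Lemma Rint_eq0 g x1 x2 y1 y2 : gcont g ->
  -8 < x1 -> x1 <= x2 -> x2 < 8 -> -8 < y1 -> y1 <= y2 -> y2 < 8 ->
  (forall x y, x1 <= x <= x2 -> y1 <= y <= y2 -> exists c, cdiff g (x +i* y) c) ->
  Rint g x1 x2 y1 y2 = 0.
Proof.
move=> cg h1 h2 h3 h4 h5 h6 H; apply: cm_eps0 => e e0.
pose w := x2 - x1; pose h := y2 - y1.
have w0 : 0 <= w by rewrite subr_ge0.
have h0 : 0 <= h by rewrite subr_ge0.
(* The bound is proportional to the area, hence additive over the four quarters. *)
pose P x y s := x1 <= x -> x + w * s <= x2 -> y1 <= y -> y + h * s <= y2 ->
  cm (Rint g x (x + w * s) y (y + h * s)) <= e * s ^+ 2.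
suff : P x1 y1 1.
  by rewrite /P !mulr1 expr1n mulr1 /w /h ![_ + (_ - _)]addrC !subrK; exact.
apply: (quad_induction P w h) => //.
- move=> x y s s0; rewrite /P => P1 P2 P3 P4 a1 a2 a3 a4.
  have ws : 0 <= w * (s / 2) by rewrite mulr_ge0 // divr_ge0 // ltW.
  have hs : 0 <= h * (s / 2) by rewrite mulr_ge0 // divr_ge0 // ltW.
  have wE : w * s = w * (s / 2) + w * (s / 2) by field.
  have hE : h * s = h * (s / 2) + h * (s / 2) by field.
  rewrite (Rint_splitx g _ (x + w * (s / 2))) (Rint_splity g _ _ _ (y + h * (s / 2))).
  rewrite (Rint_splity g (x + w * (s / 2)) _ _ (y + h * (s / 2))).
  rewrite wE hE (addrA x) (addrA y).
  have F1 : x + w * (s / 2) <= x2 by clear -a2 ws wE; lra.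
  have F2 : x1 <= x + w * (s / 2) by clear -a1 ws; lra.
  have F3 : x + w * (s / 2) + w * (s / 2) <= x2 by clear -a2 wE; lra.
  have G1 : y + h * (s / 2) <= y2 by clear -a4 hs hE; lra.
  have G2 : y1 <= y + h * (s / 2) by clear -a3 hs; lra.
  have G3 : y + h * (s / 2) + h * (s / 2) <= y2 by clear -a4 hE; lra.
  have {}P1 := P1 a1 F1 a3 G1; have {}P2 := P2 F2 F3 a3 G1.
  have {}P3 := P3 a1 F1 G2 G3; have {}P4 := P4 F2 F3 G2 G3.
  set R1 := Rint _ _ _ _ _ in P1 *; set R2 := Rint _ _ _ _ _ in P2 *.
  set R3 := Rint _ _ _ _ _ in P3 *; set R4 := Rint _ _ _ _ _ in P4 *.
  apply: le_trans (cmD _ _) _.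
  apply: le_trans (lerD (cmD _ _) (cmD _ _)) _.
  have -> : e * s ^+ 2 = e * (s / 2) ^+ 2 + e * (s / 2) ^+ 2 + e * (s / 2) ^+ 2 +
    e * (s / 2) ^+ 2 by field.
  by clear -P1 P2 P3 P4; lra.
- move=> p q hp hq.
  have {}hp : x1 <= p <= x2 by move: hp; rewrite /w addrC subrK.
  have {}hq : y1 <= q <= y2 by move: hq; rewrite /h addrC subrK.
  have [c hc] := H p q hp hq.
  pose D := w + h + 1.
  have D0 : 0 < D by rewrite ltr_wpDl // addr_ge0.
  (* One factor [D] pays for the diameter [D * s], the other for the side lengths [(w + h) * s]; the
     4 is the constant of [Rint_affine_le]. *)
  have [d d0 hd] := hc (e / 4 / D / D) ltac:(by rewrite !divr_gt0).
  exists (d / D) => [|x y s /andP[s0 sd] hx hy]; first by rewrite divr_gt0.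
  rewrite /P => a1 a2 a3 a4.
  have ws : 0 <= w * s by rewrite mulr_ge0 // ltW.
  have hs : 0 <= h * s by rewrite mulr_ge0 // ltW.
  have sD : D * s < d by rewrite mulrC -ltr_pdivlMr.
  have DE : D * s = w * s + h * s + s by rewrite /D; ring.
  apply: (@le_trans _ _ (4 * (e / 4 / D / D * (D * s)) * ((x + w * s - x) + (y + h * s - y)))).
    apply: (Rint_affine_le _ (g (p +i* q) - c * (p +i* q)) c) => //; try (clear -h1 h3 h4 h6 a1 a2 a3 a4 ws hs; lra).
    move=> x' y' hx' hy'.
    rewrite (_ : _ - _ = g (x' +i* y') - g (p +i* q) - c * ((x' +i* y') - (p +i* q))); last by ring.
    have dist : cm ((x' +i* y') - (p +i* q)) <= D * s.
      apply: le_trans (cm_le_ReIm _) _; rewrite /=.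
      have B1 : `|x' - p| <= w * s by clear -hx hx'; rewrite ler_norml; lra.
      have B2 : `|y' - q| <= h * s by clear -hy hy'; rewrite ler_norml; lra.
      by clear -B1 B2 DE s0; lra.
    apply: le_trans (hd _ (le_lt_trans dist sD)) _.
    by apply: ler_wpM2l => //; rewrite !divr_ge0 // ltW.
  rewrite (_ : _ * (_ + _) = e * s * ((w * s + h * s) / D)); last by field; rewrite gt_eqF.
  rewrite [s ^+ 2]expr2 [leRHS]mulrA; apply: ler_wpM2l; first by rewrite mulr_ge0 ?ltW.
  by rewrite ler_pdivrMr // [leRHS]mulrC DE; clear -s0; lra.
Qed.

(** The part of [[x1, x2]] within [d] of [p], degenerate if there is none. The two remaining pieces
    are each either degenerate or miss [p] strictly. *)
Lemma clamp_window (x1 x2 p d : R) : x1 <= x2 -> 0 < d -> exists a b,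
  [/\ x1 <= a, a <= b, b <= x2, a = x1 \/ a < p &
      (b = x2 \/ p < b) /\ (a = b \/ (p - d <= a /\ b <= p + d))].
Proof.
move=> x12 d0.
have [h1|h1] := ltP x2 (p - d).
  by exists x2, x2; split; lra.
have [h2|h2] := ltP (p + d) x1.
  by exists x1, x1; split; lra.
exists (Num.max x1 (p - d)), (Num.min x2 (p + d)).
rewrite le_max lexx; case: (leP x1 (p - d)) => h3; case: (leP x2 (p + d)) => h4; split; lra.
Qed.

(* The exceptional point, where [g] is merely continuous, is enclosed in a small square. *)
Lemma Rint_eq0_except g p q x1 x2 y1 y2 : gcont g ->
  -8 < x1 -> x1 <= x2 -> x2 < 8 -> -8 < y1 -> y1 <= y2 -> y2 < 8 ->
  (forall x y, x1 <= x <= x2 -> y1 <= y <= y2 -> x +i* y != p +i* q ->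
     exists c, cdiff g (x +i* y) c) ->
  Rint g x1 x2 y1 y2 = 0.
Proof.
move=> cg h1 h2 h3 h4 h5 h6 H; apply: cm_eps0 => e e0.
pose M := cm (g (p +i* q)) + 1.
have M0 : 0 < M by rewrite ltr_wpDl // cm_ge0.
have [d0 d00 hd0] := cg (p +i* q) 1 ltr01.
(* On the small square around the exceptional point [cm g <= M], so its boundary contributes at most
   [4 * M * (4 * d) <= e]. *)
pose d := Num.min (d0 / 4) (e / (16 * M)).
have dp : 0 < d by rewrite lt_min !divr_gt0 // mulr_gt0.
have dd0 : d <= d0 / 4 by rewrite /d ge_min lexx.
have de : d <= e / (16 * M) by rewrite /d ge_min lexx orbT.
have miss a b a' b' : x1 <= a -> a <= b -> b <= x2 -> y1 <= a' -> a' <= b' -> b' <= y2 ->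
    [\/ a = b, a' = b', b < p | [\/ p < a, b' < q | q < a']] -> Rint g a b a' b' = 0.
  move=> A1 A2 A3 A4 A5 A6 [->|->|D|D].
  - by rewrite /Rint /Hint /cint; ring.
  - by rewrite /Rint /Vint /cint; ring.
  - apply: Rint_eq0 => //; rewrite ?(lt_le_trans h1 A1) ?(lt_le_trans h4 A4) ?(le_lt_trans A3 h3) ?(le_lt_trans A6 h6) //.
    move=> x y /andP[hx1 hx2] /andP[hy1 hy2]; apply: H.
    + by rewrite (le_trans A1) // (le_trans hx2).
    + by rewrite (le_trans A4) // (le_trans hy2).
    by apply/eqP => -[E _]; move: D; rewrite -E ltNge hx2.
  - apply: Rint_eq0 => //; rewrite ?(lt_le_trans h1 A1) ?(lt_le_trans h4 A4) ?(le_lt_trans A3 h3) ?(le_lt_trans A6 h6) //.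
    move=> x y /andP[hx1 hx2] /andP[hy1 hy2]; apply: H.
    + by rewrite (le_trans A1) // (le_trans hx2).
    + by rewrite (le_trans A4) // (le_trans hy2).
    apply/eqP => -[E1 E2]; case: D; rewrite -?E1 -?E2 ltNge; [by rewrite hx1 | by rewrite hy2 | by rewrite hy1].
have [a [b [a1 ab b2 ap [bp nab]]]] := clamp_window _ _ p _ h2 dp.
have [a' [b' [a1' ab' b2' aq [bq nab']]]] := clamp_window _ _ q _ h5 dp.
have ax := le_trans a1 ab; have bx := le_trans ab b2.
have ay := le_trans a1' ab'; have by_ := le_trans ab' b2'.
rewrite (Rint_splitx g _ a) (Rint_splitx g a b).
rewrite (Rint_splity g a b _ a') (Rint_splity g a b a' b').
have -> : Rint g x1 a y1 y2 = 0.
  by apply: miss => //; case: ap => ?; [apply: Or41 | apply: Or43].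
have -> : Rint g b x2 y1 y2 = 0.
  by apply: miss => //; case: bp => ?; [apply: Or41 | apply: Or44; apply: Or31].
have -> : Rint g a b y1 a' = 0.
  by apply: miss => //; case: aq => ?; [apply: Or42 | apply: Or44; apply: Or32].
have -> : Rint g a b b' y2 = 0.
  by apply: miss => //; case: bq => ?; [apply: Or42 | apply: Or44; apply: Or33].
rewrite !(add0r, addr0).
case: nab => [abE|[pa pb]].
  have -> : Rint g a b a' b' = 0 by apply: miss => //; apply: Or41.
  by rewrite cm0 ltW.
case: nab' => [abE'|[qa qb]].
  have -> : Rint g a b a' b' = 0 by apply: miss => //; apply: Or42.
  by rewrite cm0 ltW.
apply: (@le_trans _ _ (4 * M * ((b - a) + (b' - a')))).
  apply: (Rint_affine_le _ 0 0) => //.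
  - exact: lt_le_trans a1.
  - exact: le_lt_trans h3.
  - exact: lt_le_trans a1'.
  - exact: le_lt_trans h6.
  move=> x y hx hy; rewrite mul0r addr0 subr0 /M.
  rewrite -[g (x +i* y)](subrK (g (p +i* q))) addrC.
  apply: le_trans (cmD _ _) _; rewrite lerD2l; apply: hd0.
  apply: le_lt_trans (cm_le_ReIm _) _; rewrite /=.
  have A1 : `|x - p| <= d by clear -hx pa pb; rewrite ler_norml; lra.
  have A2 : `|y - q| <= d by clear -hy qa qb; rewrite ler_norml; lra.
  by clear -A1 A2 dd0 d00; lra.
apply: (@le_trans _ _ (4 * M * (4 * d))).
  by apply: ler_wpM2l; [rewrite mulr_ge0 // ltW | clear -pa pb qa qb; lra].
by clear -de M0; move: de; rewrite ler_pdivlMr ?mulr_gt0 //; lra.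
Qed.

End Goursat.

(** * Cauchy's theorem on circles and the Taylor expansion *)

Section CauchyCircle.
Context {R : realType}.
Notation C := (complex R).
Implicit Types (z w c : C) (f g : C -> C).

Lemma cdiff_cont g z c : cdiff g z c -> forall e, 0 < e ->
  exists2 d, 0 < d & forall w, cm (w - z) < d -> cm (g w - g z) <= e.
Proof.
move=> /(_ 1 ltr01)[d d0 hd] e e0.
have c0 : 0 < 1 + cm c by rewrite ltr_pwDl // cm_ge0.
exists (Num.min d (e / (1 + cm c))); first by rewrite lt_min d0 divr_gt0.
move=> w; rewrite lt_min => /andP[/hd H1]; rewrite ltr_pdivlMr // => /ltW H2.
rewrite -[g w - g z](subrK (c * (w - z))); apply: le_trans (cmD _ _) _.
by apply: le_trans (lerD H1 (lexx _)) _; rewrite cmM; lra.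
Qed.

Definition dcont f : Prop := forall z, cm z < 1 -> forall e, 0 < e ->
  exists2 d, 0 < d & forall w, cm (w - z) < d -> cm (f w - f z) <= e.

(** Dividing by [shrink r z] gives [ret r], the radial retraction of the plane onto the closed disk
    of radius [r]. Composition with it turns a function on the disk into a globally continuous one
    without changing it on the smaller disk. *)
Definition shrink (r : R) z : R := Num.max 1 (cm z / r).
Definition ret (r : R) z : C := z * ((shrink r z)^-1)%:C.

Lemma shrink_ge1 r z : 1 <= shrink r z.
Proof. by rewrite /shrink le_max lexx. Qed.

Lemma ret_id r z : 0 < r -> cm z <= r -> ret r z = z.
Proof.
move=> r0 zr; rewrite /ret /shrink (max_idPl _) ?invr1 ?mulr1 //.
by rewrite ler_pdivrMr // mul1r.
Qed.

Lemma cm_ret r z : 0 < r -> cm (ret r z) <= r.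
Proof.
move=> r0; have s1 := shrink_ge1 r z; have s0 := lt_le_trans ltr01 s1.
rewrite /ret cmM cm_real ger0_norm ?invr_ge0 ?(ltW s0) // ler_pdivrMr //.
by rewrite -ler_pdivrMl // mulrC /shrink le_max lexx orbT.
Qed.

(** One [cm (w - z)] comes from scaling the difference, the other from the change of the scaling
    factor. *)
Lemma ret_lip r z w : 0 < r -> cm (ret r w - ret r z) <= 2 * cm (w - z).
Proof.
move=> r0; have sw1 := shrink_ge1 r w; have sz1 := shrink_ge1 r z.
have sw0 := lt_le_trans ltr01 sw1; have sz0 := lt_le_trans ltr01 sz1.
have -> : ret r w - ret r z = (w - z) * ((shrink r w)^-1)%:C +
    ret r z * (((shrink r z - shrink r w) / shrink r w))%:C.
  have -> : (shrink r z - shrink r w) / shrink r w = shrink r z / shrink r w - 1.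
    by rewrite mulrBl divff // gt_eqF.
  rewrite /ret rmorphB rmorphM /= mulrBr mulr1 mulrA.
  have -> : z * (shrink r z)^-1%:C * (shrink r z)%:C = z.
    by rewrite -mulrA -rmorphM /= mulVf ?gt_eqF // mulr1.
  by ring.
apply: le_trans (cmD _ _) _; rewrite [cm ((w - z) * _)]cmM [cm (ret r z * _)]cmM !cm_real.
have B1 : `|(shrink r w)^-1| <= 1 by rewrite ger0_norm ?invr_ge0 ?(ltW sw0) // invf_le1.
have B2 : `|shrink r z - shrink r w| <= cm (w - z) / r.
  have : `|cm z / r - cm w / r| <= cm (w - z) / r.
    rewrite -mulrBl normrM [`|r^-1|]ger0_norm ?invr_ge0 ?(ltW r0) //.
    rewrite ler_pM2r ?invr_gt0 // ler_norml -[w - z]opprB cmN cmB_ge andbT.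
    by rewrite -opprB cmN lerNl opprB cmB_ge.
  rewrite /shrink; move: (_ / r) (cm w / r) => a b.
  by case: (leP 1 a); case: (leP 1 b) => h1 h2; rewrite !ler_norml; lra.
rewrite (_ : 2 * _ = cm (w - z) + cm (w - z)); last by ring.
apply: lerD.
  by rewrite -[leRHS]mulr1 ler_wpM2l ?cm_ge0.
apply: (@le_trans _ _ (r * (cm (w - z) / r))); last by rewrite mulrC divfK // gt_eqF.
apply: ler_pM; rewrite ?cm_ge0 ?cm_ret // normrM.
by rewrite -[leRHS]mulr1 ler_pM.
Qed.

Lemma gcont_ret f r : 0 < r < 1 -> dcont f -> gcont (fun z => f (ret r z)).
Proof.
move=> /andP[r0 r1] cf z e e0.
have [d d0 hd] := cf _ (le_lt_trans (cm_ret r z r0) r1) e e0.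
exists (d / 2) => [|w]; first by rewrite divr_gt0.
rewrite ltr_pdivlMr // => wd; apply: hd; apply: le_lt_trans (ret_lip _ _ _ r0) _.
by rewrite mulrC.
Qed.

Lemma cdiff_ret f r z c : 0 < r -> cm z < r -> cdiff f z c ->
  cdiff (fun z => f (ret r z)) z c.
Proof.
move=> r0 zr h e /h[d d0 hd]; exists (Num.min d (r - cm z)).
  by rewrite lt_min d0 subr_gt0.
move=> w; rewrite lt_min => /andP[/hd + wr].
rewrite !ret_id // ?(ltW zr) //.
by rewrite -[w](subrK z) (le_trans (cmD _ _)) // -lerBrDr ltW.
Qed.

Lemma cint_approx_cst (u : R -> C) c (a b e : R) : ccont u -> -8 < a < 8 -> -8 < b < 8 ->
  (forall t, Num.min a b <= t <= Num.max a b -> cm (u t - c) <= e) ->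
  cm (cint u a b - c * (b - a)%:C) <= 2 * e * `|b - a|.
Proof.
move=> cu /andP[a8 a8'] /andP[b8 b8'].
have dV t : cderiv (fun t : R => c * t%:C) t c.
  apply/cderivE => e' e'0; exists 1 => // y _.
  rewrite (_ : c * y%:C - c * t%:C - c * (y - t)%:C = 0) ?cm0 ?mulr_ge0 ?(ltW e'0) //.
  by rewrite rmorphB /=; ring.
have [ab|/ltW ba] := leP a b => H.
  rewrite rmorphB mulrBr ger0_norm ?subr_ge0 //.
  exact: (cint_approx u (fun t => c * t%:C) (fun=> c) a b e cu a8 ab b8' (fun t _ => dV t) H).
rewrite (_ : cint u a b - c * (b - a)%:C = - (cint u b a - (c * a%:C - c * b%:C))); last first.
  by rewrite /cint rmorphB /=; ring.
rewrite cmN ler0_norm ?subr_le0 // [- (b - a)]opprB.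
exact: (cint_approx u (fun t => c * t%:C) (fun=> c) b a e cu b8 ba a8' (fun t _ => dV t) H).
Qed.

(** The primitive integrates along the real axis and then vertically. As the rectangle over
    [[x, x']] down to the axis contributes 0, the increment equals a vertical segment at [x]
    followed by a horizontal one at height [y'], both close to the point. *)
Lemma primitive_of_Rint0 g r : gcont g -> 0 < r < 1 ->
  (forall x1 x2 y1 y2, x1 <= x2 -> y1 <= y2 ->
    (forall x y, x1 <= x <= x2 -> y1 <= y <= y2 -> cm (x +i* y) < r) ->
    Rint g x1 x2 y1 y2 = 0) ->
  forall z, cm z < r ->
    cdiff (fun z => Hint g 0 0 (complex.Re z) + 'i * Vint g (complex.Re z) 0 (complex.Im z))
      z (g z).
Proof.
move=> cg /andP[r0 r1] H z zr e e0.
have H' x1 x2 y1 y2 : (forall x y, Num.min x1 x2 <= x <= Num.max x1 x2 ->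
    Num.min y1 y2 <= y <= Num.max y1 y2 -> cm (x +i* y) < r) -> Rint g x1 x2 y1 y2 = 0.
  have sx (a b p q : R) : Rint g b a p q = - Rint g a b p q.
    by rewrite /Rint /Hint /Vint /cint; ring.
  have sy (a b p q : R) : Rint g a b q p = - Rint g a b p q.
    by rewrite /Rint /Hint /Vint /cint; ring.
  case: (leP x1 x2) => X; case: (leP y1 y2) => Y h.
  - exact: H.
  - by rewrite sy H ?oppr0 // ltW.
  - by rewrite sx H ?oppr0 // ltW.
  - by rewrite sx sy H ?oppr0 // ltW.
have e40 : 0 < e / 4 by rewrite divr_gt0.
have [d1 d10 hd1] := cg z _ e40.
pose d := Num.min (d1 / 2) ((r - cm z) / 2).
have d0 : 0 < d by rewrite lt_min !divr_gt0 // subr_gt0.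
exists d => // w; rewrite lt_min => /andP[wd1 wdr].
case: z => x y in zr hd1 d d0 wd1 wdr *; case: w => x' y' in wd1 wdr *.
have xx' : `|x' - x| <= cm ((x' +i* y') - (x +i* y)) by have := cm_Re ((x' +i* y') - (x +i* y)).
have yy' : `|y' - y| <= cm ((x' +i* y') - (x +i* y)) by have := cm_Im ((x' +i* y') - (x +i* y)).
set D := cm _ in xx' yy' wd1 wdr.
have near t s : `|t - x| <= D -> `|s - y| <= D -> cm ((t +i* s) - (x +i* y)) <= 2 * D.
  by move=> h1 h2; apply: le_trans (cm_le_ReIm _) _; rewrite /=; lra.
have betw (a b t : R) : Num.min a b <= t <= Num.max a b -> `|t - a| <= `|b - a|.
  case: (leP a b) => ab h; first by rewrite !ger0_norm; lra.
  by rewrite !ler0_norm; lra.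
have inr t s : `|t - x| <= D -> `|s - y| <= D -> cm (t +i* s) < r.
  move=> h1 h2; rewrite -[t +i* s](subrK (x +i* y)); apply: le_lt_trans (cmD _ _) _.
  by have := near t s h1 h2; clear -wdr; lra.
have xr8 t s : cm (t +i* s) < r -> -8 < t < 8 /\ -8 < s < 8.
  move=> h; have := cm_Re (t +i* s); have := cm_Im (t +i* s); rewrite /= => h1 h2.
  have {}h1 := le_lt_trans h1 h; have {}h2 := le_lt_trans h2 h.
  by clear -h1 h2 r1; move: h1 h2; rewrite !ltr_norml; lra.
have R0 : Rint g x x' 0 y' = 0.
  apply: H' => t s /betw tx /betw; rewrite !subr0 => sy.
  have := inr t y' (le_trans tx xx') yy'; apply: le_lt_trans.
  rewrite !cm_sqrt /= ler_wsqrtr // lerD2l -real_normK ?num_real // -[y' ^+ 2]real_normK ?num_real //.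
  by rewrite ler_pXn2r // nnegrE.
have D0 : 0 <= D by exact: cm_ge0.
have [x8 y8] := xr8 x y zr.
have [x8' y8'] := xr8 _ _ (inr x' y' xx' yy').
have -> : Hint g 0 0 (complex.Re (x' +i* y')) + 'i * Vint g (complex.Re (x' +i* y')) 0 (complex.Im (x' +i* y'))
   - (Hint g 0 0 (complex.Re (x +i* y)) + 'i * Vint g (complex.Re (x +i* y)) 0 (complex.Im (x +i* y)))
   - g (x +i* y) * ((x' +i* y') - (x +i* y)) =
   (Hint g y' x x' - g (x +i* y) * (x' - x)%:C) + 'i * (Vint g x y y' - g (x +i* y) * (y' - y)%:C).
  rewrite -[RHS]addr0 -R0 /Rint /Hint /Vint /cint /=.
  have -> : (x' +i* y') - (x +i* y) = (x' - x)%:C + 'i * (y' - y)%:C.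
    by apply/eqP; rewrite eq_complex /=; apply/andP; split; apply/eqP; ring.
  by ring.
apply: le_trans (cmD _ _) _; rewrite cmM cm_i mul1r.
have E1 : cm (Hint g y' x x' - g (x +i* y) * (x' - x)%:C) <= 2 * (e / 4) * `|x' - x|.
  apply: cint_approx_cst => //; first exact: gcont_hor.
  move=> t /betw tx; apply: hd1; apply: le_lt_trans (near _ _ (le_trans tx xx') yy') _.
  by clear -wd1; lra.
have E2 : cm (Vint g x y y' - g (x +i* y) * (y' - y)%:C) <= 2 * (e / 4) * `|y' - y|.
  apply: cint_approx_cst => //; first exact: gcont_ver.
  move=> t /betw tx; apply: hd1; apply: le_lt_trans (near _ _ _ (le_trans tx yy')) _.
    by rewrite subrr normr0.
  by clear -wd1; lra.
apply: le_trans (lerD E1 E2) _.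
have -> : e * D = 2 * (e / 4) * D + 2 * (e / 4) * D by field.
by apply: lerD; apply: ler_wpM2l => //; rewrite mulr_ge0 // ltW.
Qed.

Definition expi (t : R) : C := cos t +i* sin t.

Lemma expiD a b : expi (a + b) = expi a * expi b.
Proof. by rewrite /expi cosD sinD; apply/eqP; rewrite eq_complex /= eqxx addrC eqxx. Qed.

Lemma cm_expi t : cm (expi t) = 1.
Proof. by rewrite cm_sqrt /= cos2Dsin2 sqrtr1. Qed.

Lemma expi_neq0 t : expi t != 0.
Proof. by rewrite -cm_eq0 cm_expi oner_eq0. Qed.

Lemma expi0 : expi 0 = 1.
Proof. by rewrite /expi cos0 sin0. Qed.

Lemma expiX t n : expi t ^+ n = expi (n%:R * t).
Proof.
elim: n => [|n IH]; first by rewrite mul0r expi0.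
by rewrite exprSr IH -expiD -natr1 mulrDl mul1r.
Qed.

Lemma expi_2pi : expi (2 * pi) = 1.
Proof. by rewrite mulrC -[pi * 2]/(pi * 2%:R) mulr_natr /expi cos2pi sin2pi. Qed.

Lemma expiN t : expi (- t) = (expi t)^-1.
Proof.
apply: (mulfI (expi_neq0 t)); rewrite -expiD subrr expi0 divff //; exact: expi_neq0.
Qed.

Lemma cderiv_expi (a t : R) : cderiv (fun t => expi (a * t)) t ((0 +i* a) * expi (a * t)).
Proof.
have da : is_derive t (1 : R) (fun t => a * t) a.
  rewrite (_ : (fun t => a * t) = a \*: id) //.
  by apply: is_derive_eq; rewrite -[a *: 1]/(a * 1) mulr1.
split.
- have h : is_derive t (1 : R) (@cos R \o (fun t => a * t)) (- sin (a * t) * a).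
    exact: is_derive1_comp.
  by rewrite (_ : complex.Re _ = - sin (a * t) * a) //=; ring.
- have h : is_derive t (1 : R) (@sin R \o (fun t => a * t)) (cos (a * t) * a).
    exact: is_derive1_comp.
  by rewrite (_ : complex.Im _ = cos (a * t) * a) //=; ring.
Qed.

Lemma cderiv_cont (V : R -> C) (v : R -> C) : (forall t, cderiv V t (v t)) -> ccont V.
Proof.
move=> h; split=> t; apply/differentiable_continuous/derivable1_diffP.
  by have [[]] := h t.
by have [_ []] := h t.
Qed.

Lemma ccont_expi a : ccont (fun t => expi (a * t)).
Proof. by apply: cderiv_cont => t; exact: cderiv_expi. Qed.

Lemma pi2_lt8 : 2 * pi < 8 :> R.
Proof. by have := @pihalf_lt2 R; lra. Qed.

Lemma cint_expi n : cint (fun t => (expi t)^-1 ^+ n) 0 (2 * pi) =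
  if n == 0%N then (2 * pi)%:C else 0.
Proof.
have p0 : 0 <= 2 * pi :> R by rewrite mulr_ge0 // pi_ge0.
have p8 := pi2_lt8; have n8 : -8 < 0 :> R by lra.
have E t : (expi t)^-1 ^+ n = expi (- n%:R * t).
  by rewrite exprVn expiX -expiN mulNr.
under [X in cint X]eq_fun do rewrite E.
case: eqP => [->|/eqP n0].
  rewrite (cint_FTC _ (fun t => t%:C)) //; first by rewrite subr0.
    exact: ccont_expi.
  move=> t _; apply/cderivE => e e0; exists 1 => // y _.
  rewrite oppr0 mul0r expi0 mul1r rmorphB subrr cm0.
  by apply: mulr_ge0 => //; exact: ltW.
have ni : (0 +i* (- n%:R)) != 0 :> C.
  by rewrite eq_complex /= eqxx /= oppr_eq0 pnatr_eq0.
rewrite (cint_FTC _ (fun t => (0 +i* (- n%:R))^-1 * expi (- n%:R * t))) //.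
- rewrite mulr0 expi0 -mulrBr mulNr expiN -expiX expi_2pi expr1n invr1 subrr mulr0.
  by [].
- exact: ccont_expi.
- move=> t _; have := cderiv_lin (0 +i* (- n%:R))^-1 _ t _ (cderiv_expi (- n%:R) t).
  by rewrite mulrA mulVf // mul1r.
Qed.

Lemma cderiv_comp f (V : R -> C) t c v : cdiff f (V t) c -> cderiv V t v ->
  cderiv (f \o V) t (c * v).
Proof.
move=> hf /cderivE hV; apply/cderivE => e e0.
have v0 : 0 < cm v + 1 by rewrite ltr_wpDl // cm_ge0.
have c0 : 0 < cm c + 1 by rewrite ltr_wpDl // cm_ge0.
have [d1 d10 hd1] := hf (e / 2 / (cm v + 1)) ltac:(by rewrite !divr_gt0).
have [d2 d20 hd2] := hV (e / 2 / (cm c + 1)) ltac:(by rewrite !divr_gt0).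
have [d3 d30 hd3] := hV 1 ltr01.
exists (Num.min (Num.min d2 d3) (d1 / (cm v + 1))).
  by rewrite !lt_min d20 d30 divr_gt0.
move=> y; rewrite !lt_min => /andP[/andP[/hd2 H2 /hd3 H3]].
rewrite ltr_pdivlMr // => yd.
have L : cm (V y - V t) <= (cm v + 1) * `|y - t|.
  rewrite -[V y - V t](subrK (v * (y - t)%:C)); apply: le_trans (cmD _ _) _.
  by rewrite cmM cm_real; lra.
have H1 : cm (f (V y) - f (V t) - c * (V y - V t)) <= e / 2 / (cm v + 1) * cm (V y - V t).
  by apply: hd1; apply: le_lt_trans L _; rewrite mulrC.
rewrite (_ : _ - _ = (f (V y) - f (V t) - c * (V y - V t)) +
  c * (V y - V t - v * (y - t)%:C)); last by rewrite /=; ring.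
apply: le_trans (cmD _ _) _; rewrite cmM.
have -> : e * `|y - t| = e / 2 / (cm v + 1) * ((cm v + 1) * `|y - t|) +
   (cm c + 1) * (e / 2 / (cm c + 1) * `|y - t|).
  by field; rewrite !gt_eqF.
apply: lerD.
  by apply: le_trans H1 _; rewrite ler_pM2l ?divr_gt0.
by apply: ler_pM; rewrite ?cm_ge0 // lerDl.
Qed.

Lemma ccont_comp g (V : R -> C) : gcont g -> ccont V -> ccont (g \o V).
Proof.
move=> cg /ccontP cV; apply/ccontP => t e /(cg (V t))[d d0 hd].
have [d' d'0 hd'] := cV t (d / 2) ltac:(by rewrite divr_gt0).
exists d' => // y /hd' h; apply: hd; lra.
Qed.

Definition circ (rho t : R) : C := rho%:C * expi t.

Lemma ccont_circ rho : ccont (circ rho).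
Proof.
apply: ccontM; first exact: ccont_cst.
by have := ccont_expi 1; under eq_fun do rewrite mul1r.
Qed.

Lemma cderiv_circ rho t : cderiv (circ rho) t ('i * circ rho t).
Proof.
have h : cderiv expi t ('i * expi t).
  by have := cderiv_expi 1 t; under eq_fun do rewrite mul1r; rewrite mul1r.
by have := cderiv_lin rho%:C expi t _ h; rewrite mulrCA.
Qed.

Lemma cm_circ rho t : 0 <= rho -> cm (circ rho t) = rho.
Proof. by move=> r0; rewrite /circ cmM cm_expi mulr1 cm_real ger0_norm. Qed.

(** Up to the factor ['i] the integrand is the derivative of the primitive along the circle, and the
    circle is closed. *)
Lemma circ_int0 g (r rho : R) : gcont g -> 0 < r < 1 -> 0 < rho < r ->
  (forall x1 x2 y1 y2, x1 <= x2 -> y1 <= y2 ->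
    (forall x y, x1 <= x <= x2 -> y1 <= y <= y2 -> cm (x +i* y) < r) ->
    Rint g x1 x2 y1 y2 = 0) ->
  cint (fun t => g (circ rho t) * circ rho t) 0 (2 * pi) = 0.
Proof.
move=> cg r01 /andP[rho0 rhor] H.
have p0 : 0 <= 2 * pi :> R by rewrite mulr_ge0 // pi_ge0.
have p8 := pi2_lt8; have n8 : -8 < 0 :> R by lra.
have G := primitive_of_Rint0 g r cg r01 H.
set Ga := (fun z => _) in G.
have cc : ccont (fun t => g (circ rho t) * circ rho t).
  apply: ccontM; last exact: ccont_circ.
  exact: (ccont_comp _ _ cg (ccont_circ rho)).
have i0 : ('i : C) != 0 by rewrite -cm_eq0 cm_i oner_eq0.
apply: (mulfI i0); rewrite mulr0 -cintZ //.
rewrite (cint_FTC _ (Ga \o circ rho)) //.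
- by rewrite /= /circ expi_2pi expi0 subrr.
- by apply: ccontM => //; exact: ccont_cst.
- move=> t _; rewrite mulrCA; apply: cderiv_comp; last exact: cderiv_circ.
  by apply: G; rewrite cm_circ // ltW.
Qed.

Lemma cdiffM f g z a b : cdiff f z a -> cdiff g z b ->
  cdiff (fun w => f w * g w) z (a * g z + f z * b).
Proof.
move=> hf hg e e0.
pose K := cm (g z) + cm (f z) + cm b + 1.
have K0 : 0 < K by rewrite ltr_wpDl // !addr_ge0 ?cm_ge0.
have K1 : 1 <= K by rewrite /K lerDr !addr_ge0 ?cm_ge0.
pose e1 := Num.min 1 (e / (3 * K)).
have e10 : 0 < e1 by rewrite lt_min ltr01 divr_gt0 // mulr_gt0.
have e11 : e1 <= 1 by rewrite /e1 ge_min lexx.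
have e1e : e1 <= e / (3 * K) by rewrite /e1 ge_min lexx orbT.
have [d1 d10 h1] := hf _ e10; have [d2 d20 h2] := hg _ e10.
have [d3 d30 h3] := cdiff_cont _ _ _ hf _ e10.
exists (Num.min (Num.min d1 d2) d3); first by rewrite !lt_min d10 d20.
move=> w; rewrite !lt_min => /andP[/andP[/h1 H1 /h2 H2] /h3 H3].
rewrite (_ : _ - _ = (f w - f z - a * (w - z)) * g z + f w * (g w - g z - b * (w - z))
  + (f w - f z) * (b * (w - z))); last by ring.
apply: le_trans (cmD _ _) _; apply: le_trans (lerD (cmD _ _) (lexx _)) _; rewrite !cmM.
have fw : cm (f w) <= K.
  rewrite -[f w](subrK (f z)) (le_trans (cmD _ _)) //.
  have := cm_ge0 (g z); have := cm_ge0 b; rewrite /K; clear -H3 e11; lra.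
have X0 := cm_ge0 (w - z).
have T1 : cm (f w - f z - a * (w - z)) * cm (g z) <= e1 * cm (w - z) * K.
  apply: ler_pM; rewrite ?cm_ge0 // /K.
  by have := cm_ge0 (f z); have := cm_ge0 b; clear; lra.
have T2 : cm (f w) * cm (g w - g z - b * (w - z)) <= K * (e1 * cm (w - z)).
  by apply: ler_pM; rewrite ?cm_ge0.
have T3 : cm (f w - f z) * (cm b * cm (w - z)) <= e1 * (K * cm (w - z)).
  apply: ler_pM; rewrite ?mulr_ge0 ?cm_ge0 //; apply: ler_wpM2r => //.
  rewrite /K; have := cm_ge0 (f z); have := cm_ge0 (g z); clear; lra.
have T4 : e1 * K * 3 <= e.
  by move: e1e; rewrite ler_pdivlMr ?mulr_gt0 //; clear; lra.
have T5 := ler_wpM2r X0 T4.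
by clear -T1 T2 T3 T5; lra.
Qed.

Lemma cdiffB_cst f z a c : cdiff f z a -> cdiff (fun w => f w - c) z a.
Proof.
move=> h e /h[d d0 hd]; exists d => // w /hd.
by rewrite [_ - c - _](_ : _ = f w - f z) //; ring.
Qed.

Lemma cdiff_inv z0 z : z != z0 -> cdiff (fun w => (w - z0)^-1) z (- (z - z0)^-1 ^+ 2).
Proof.
move=> zz0 e e0; have z00 : z - z0 != 0 by rewrite subr_eq0.
pose m := cm (z - z0); have m0 : 0 < m by rewrite cm_gt0.
exists (Num.min (m / 2) (e * m ^+ 3 / 2)).
  by rewrite lt_min !divr_gt0 // mulr_gt0 // exprn_gt0.
move=> w; rewrite lt_min => /andP[h1 h2].
have w0 : m / 2 <= cm (w - z0).
  have -> : w - z0 = (z - z0) - (z - w) by ring.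
  by apply: le_trans (cmB_ge _ _); rewrite [cm (z - w)]cmBC -/m; clear -h1; lra.
have w00 : w - z0 != 0 by rewrite -cm_gt0 (lt_le_trans _ w0) // divr_gt0.
rewrite (_ : _ - _ = (w - z) ^+ 2 * ((w - z0)^-1 * (z - z0)^-1 ^+ 2)); last first.
  by field; rewrite z00 w00.
rewrite !(cmX, cmM, cmV) -/m [cm (w - z) ^+ 2]expr2 -mulrA mulrC; apply: ler_wpM2r; first exact: cm_ge0.
apply: (@le_trans _ _ (e * m ^+ 3 / 2 * ((m / 2)^-1 * m^-1 ^+ 2))); last first.
  by rewrite le_eqVlt; apply/orP; left; apply/eqP; field; rewrite gt_eqF.
apply: ler_pM; rewrite ?cm_ge0 ?mulr_ge0 ?invr_ge0 ?exprn_ge0 ?cm_ge0 ?invr_ge0 ?(ltW m0) //.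
  exact: ltW.
apply: ler_wpM2r; first by rewrite exprn_ge0 // invr_ge0 ltW.
by rewrite lef_pV2 // posrE ?divr_gt0 // (lt_le_trans _ w0) // divr_gt0.
Qed.

Lemma holoP f : holomorphic_on_disk f -> forall z, cm z < 1 -> exists c, cdiff f z c.
Proof.
move=> h z z1; have zD : z \in @unit_disk R by rewrite inE /unit_disk /= cm_lt1.
have [c hc] := h z zD; exists c => e e0; have [d d0 hd] := hc e e0.
exists d => // w wd; have [->|wz] := eqVneq w z.
  by rewrite !subrr mulr0 subr0 cm0 mulr0.
have wz0 : w - z != 0 by rewrite subr_eq0.
have := hd w; rewrite cmE -[0]/((0:R)%:C) !ltcR cm_gt0 wz0 wd => /(_ isT).
move=> /ltW H.
rewrite (_ : _ - _ = ((f w - f z) / (w - z) - c) * (w - z)); last by field.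
by rewrite cmM ler_wpM2r ?cm_ge0.
Qed.

(** Cauchy's formula in quotient form. The difference quotient of [f] at [z], completed by the
    derivative, is continuous on the disk and differentiable off [z], so Goursat with one
    exceptional point applies. *)
Lemma holo_circ_int0 f z (r rho : R) : holomorphic_on_disk f ->
  0 < rho -> rho < r -> r < 1 -> cm z < rho ->
  let F w := f (ret r w) in
  cint (fun t => (F (circ rho t) - f z) * (circ rho t - z)^-1 * circ rho t) 0 (2 * pi) = 0.
Proof.
move=> /holoP hf rho0 rhor r1 zrho F; have r0 := lt_trans rho0 rhor.
have zr := lt_trans zrho rhor; have z1 := lt_trans zr r1.
have [c hc] := hf z z1.
pose G w := if w == z then c else (f w - f z) * (w - z)^-1.
have Gd w : cm w < 1 -> w != z -> exists b, cdiff G w b.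
  move=> w1 wz; have [a ha] := hf w w1.
  have := cdiffM _ _ _ _ _ (cdiffB_cst _ _ _ (f z) ha) (cdiff_inv z w wz).
  set b := (X in cdiff _ _ X) => hb; exists b => e /hb[d d0 hd].
  exists (Num.min d (cm (w - z))); first by rewrite lt_min d0 cm_gt0 subr_eq0.
  move=> v; rewrite lt_min => /andP[/hd + vz]; rewrite /G (negbTE wz).
  by case: eqP vz => [->|//]; rewrite cmBC ltxx.
have cG : dcont G.
  move=> w w1 e e0; have [->|wz] := eqVneq w z.
    have [d d0 hd] := hc e e0; exists d => // v /hd.
    rewrite /G eqxx; case: eqVneq => [_ _|vz]; first by rewrite subrr cm0 ltW.
    have vz0 : v - z != 0 by rewrite subr_eq0.
    rewrite (_ : f v - f z - _ = ((f v - f z) / (v - z) - c) * (v - z)); last by field.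
    by rewrite cmM ler_pM2r // cm_gt0.
  by have [b hb] := Gd w w1 wz; exact: cdiff_cont hb e e0.
have r01 : 0 < r < 1 by rewrite r0.
have := circ_int0 (fun w => G (ret r w)) r rho (gcont_ret _ _ r01 cG) r01.
rewrite rho0 rhor => /(_ isT).
have -> : (fun t => G (ret r (circ rho t)) * circ rho t) =
  (fun t => (F (circ rho t) - f z) * (circ rho t - z)^-1 * circ rho t).
  apply/funext => t; rewrite /F ret_id // ?cm_circ ?(ltW rho0) ?(ltW rhor) //.
  rewrite /G; case: eqP => // E.
  by move: zrho; rewrite -E cm_circ ?ltxx // ltW.
apply=> x1 x2 y1 y2 x12 y12 H.
have [[X1 X2] [Y1 Y2]] : (-8 < x1 /\ x2 < 8) /\ (-8 < y1 /\ y2 < 8).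
  have h1 := H x1 y1 ltac:(by rewrite lexx) ltac:(by rewrite lexx).
  have h2 := H x2 y2 ltac:(by rewrite lexx x12) ltac:(by rewrite lexx y12).
  have := le_lt_trans (cm_Re _) h1; have := le_lt_trans (cm_Im _) h1.
  have := le_lt_trans (cm_Re _) h2; have := le_lt_trans (cm_Im _) h2.
  by clear -r1; rewrite /= !ltr_norml; lra.
apply: (Rint_eq0_except _ (complex.Re z) (complex.Im z)) => //.
  exact: gcont_ret.
move=> x y hx hy nz; have {}nz : x +i* y != z by case: z {zrho F zr z1 c hc G Gd cG H} nz.
have xyr := H x y hx hy; have [b hb] := Gd _ (lt_trans xyr r1) nz.
by exists b; exact: cdiff_ret.
Qed.

(** The coefficients are Cauchy integrals. Instead of exchanging sum and integral, the integral of a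
    truncated geometric expansion is compared with the vanishing integral of [holo_circ_int0]; the
    integrands differ by at most [K * q ^+ M]. *)
Theorem holo_pseries f (rho : R) : holomorphic_on_disk f -> 0 < rho < 1 ->
  exists (a : nat -> C) (K : R), (forall n, cm (a n) * rho ^+ n <= K) /\
    forall z, cm z < rho -> f z = csum (fun n => a n * z ^+ n).
Proof.
move=> hf /andP[rho0 rho1].
pose r := (1 + rho) / 2; have rhor : rho < r by rewrite /r; lra.
have r1 : r < 1 by rewrite /r; lra.
have r0 := lt_trans rho0 rhor; have r01 : 0 < r < 1 by rewrite r0.
pose F w := f (ret r w).
have cF : gcont F.
  apply: gcont_ret => // z z1 e e0; have [c hc] := holoP f hf z z1.
  exact: cdiff_cont hc e e0.
have p0 : 0 <= 2 * pi :> R by rewrite mulr_ge0 // pi_ge0.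
have p00 : 0 < 2 * pi :> R by rewrite mulr_gt0 // pi_gt0.
have p8 := pi2_lt8; have n8 : -8 < 0 :> R by lra.
have pn0 : (2 * pi)%:C != 0 :> C by rewrite -cm_eq0 cm_real normr_eq0 gt_eqF.
pose u n t := F (circ rho t) * (circ rho t)^-1 ^+ n.
have circ0 t : circ rho t != 0 by rewrite -cm_gt0 cm_circ // ltW.
have circV t : (circ rho t)^-1 = rho^-1%:C * (expi t)^-1.
  by rewrite /circ invfM -fmorphV.
have cV n : ccont (fun t => (expi t)^-1 ^+ n).
  by have := ccont_expi (- n%:R); under eq_fun do rewrite mulNr expiN -expiX -exprVn.
have cVr n : ccont (fun t => (circ rho t)^-1 ^+ n).
  have := ccontM _ _ (ccont_cst (rho^-1%:C ^+ n)) (cV n).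
  by under eq_fun do rewrite -exprMn -circV.
have cFc : ccont (F \o circ rho) by exact: ccont_comp _ _ cF (ccont_circ rho).
have cu n : ccont (u n) by apply: ccontM.
have [B hB] : exists B, forall t, 0 <= t <= 2 * pi -> cm (F (circ rho t)) <= B.
  have cc : {within `[0, 2 * pi], continuous (fun t => cm (F (circ rho t)))}.
    apply: continuous_subspaceT => t; apply/cvgrPdist_le => e e0.
    have [d d0 hd] := (ccontP _).1 cFc t e e0.
    apply/nbhs_ballP; exists d => //= y; rewrite /ball /= distrC => /hd /= H.
    rewrite ler_norml -[X in - e <= X]opprB lerN2 !(le_trans _ H) //.
      by rewrite -[cm (_ - _)]cmN opprB cmB_ge.
    exact: cmB_ge.
  have [c _ hc] := EVT_max p0 cc.
  by exists (cm (F (circ rho c))) => t ht; apply: hc; rewrite in_itv.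
have B0 : 0 <= B by apply: le_trans (cm_ge0 _) (hB 0 _); rewrite lexx.
exists (fun n => (2 * pi)%:C^-1 * cint (u n) 0 (2 * pi)), (2 * B).
have aB n : cm ((2 * pi)%:C^-1 * cint (u n) 0 (2 * pi)) * rho ^+ n <= 2 * B.
  rewrite cmM cmV cm_real ger0_norm // -mulrA ler_pdivrMl //.
  have : cm (cint (u n) 0 (2 * pi)) <= 2 * (B * rho^-1 ^+ n) * (2 * pi - 0).
    apply: cint_le => // t ht; rewrite /u cmM cmX cmV cm_circ ?(ltW rho0) //.
    by rewrite ler_wpM2r ?exprn_ge0 ?invr_ge0 ?(ltW rho0) // hB.
  rewrite -(ler_pM2r (exprn_gt0 n rho0)); move/le_trans; apply.
  rewrite exprVn le_eqVlt; apply/orP; left; apply/eqP; field.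
  by rewrite expf_neq0 // gt_eqF.
split=> // z zrho.
have q1 : 0 <= cm z / rho < 1 by rewrite divr_ge0 ?cm_ge0 ?(ltW rho0) // ltr_pdivrMr ?mul1r.
set q := cm z / rho in q1.
have qE n : q ^+ n = cm z ^+ n / rho ^+ n by rewrite /q expr_div_n.
symmetry; apply: (csum_unique _ (2 * B / (1 - q))).
  apply: geom_summable => // n; rewrite cmM cmX qE mulrA ler_pdivlMr ?exprn_gt0 //.
  by rewrite mulrAC ler_wpM2r ?exprn_ge0 ?cm_ge0.
have rz : 0 < rho - cm z by rewrite subr_gt0.
pose K := (B + cm (f z)) * (rho / (rho - cm z)).
have K0 : 0 <= K by rewrite mulr_ge0 ?addr_ge0 ?cm_ge0 // divr_ge0 // ltW.
move=> e e0.
have [N hN] := exprn_lt_eps q (e / (2 * K + 1)) q1 ltac:(by rewrite divr_gt0 // ltr_wpDl // mulr_ge0).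
(* [M] must be positive: the term [n = 0] of the second sum in [uM] supplies the [2 * pi]. *)
exists N.+1 => M NM.
(* The expansion of [v] below in powers of [z / circ rho t], cut after [M] terms. *)
pose uM t := (\sum_(n < M) z ^+ n * u n t) + (- f z) * \sum_(n < M) z ^+ n * (circ rho t)^-1 ^+ n.
pose v t := (F (circ rho t) - f z) * (circ rho t - z)^-1 * circ rho t.
have cn0 t : circ rho t - z != 0.
  by rewrite subr_eq0; apply: contraTneq zrho => <-; rewrite cm_circ ?ltxx // ltW.
have cint_v : cint v 0 (2 * pi) = 0.
  exact: (holo_circ_int0 f z r rho).
have c1 n : ccont (fun t => z ^+ n * u n t) by apply: ccontM => //; exact: ccont_cst.
have c2 n : ccont (fun t => z ^+ n * (circ rho t)^-1 ^+ n) by apply: ccontM => //; exact: ccont_cst.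
have [s1 s1E] := cint_sum (fun n t => z ^+ n * u n t) M 0 (2 * pi) c1 n8 p0 p8.
have [s2 s2E] := cint_sum (fun n t => z ^+ n * (circ rho t)^-1 ^+ n) M 0 (2 * pi) c2 n8 p0 p8.
have cuM : ccont uM by apply: ccontD => //; apply: ccontM => //; exact: ccont_cst.
have cv : ccont v.
  have [c hc] := holoP f hf z (lt_trans zrho rho1).
  apply: ccontM; last exact: ccont_circ.
  apply: ccontM; first by apply: ccontD => //; exact: ccont_cst.
  apply/ccontP => t e' e'0.
  have nz : circ rho t != z by rewrite -subr_eq0.
  have [d d0 hd] := cdiff_cont _ _ _ (cdiff_inv z _ nz) e' e'0.
  have [d' d'0 hd'] := (ccontP _).1 (ccont_circ rho) t (d / 2) ltac:(by rewrite divr_gt0).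
  by exists d' => // y /hd' h; apply: hd; clear -h d0; lra.
have cint_uM : cint uM 0 (2 * pi) =
   (2 * pi)%:C * ((\sum_(n < M) (2 * pi)%:C^-1 * cint (u n) 0 (2 * pi) * z ^+ n) - f z).
  rewrite cintD //; last by apply: ccontM => //; exact: ccont_cst.
  rewrite cintZ // s1E s2E mulrBr; congr (_ + _).
    rewrite mulr_sumr.
    by apply: eq_bigr => n _; rewrite cintZ // !mulrA divff // mul1r mulrC.
  case: M NM {uM s1 s1E s2 s2E cuM} => // M _; rewrite big_ord_recl big1 ?addr0 => [|n _].
    rewrite expr0; under [X in cint X]eq_fun do rewrite mul1r.
    rewrite (_ : (fun _ => _) = (fun t => (expi t)^-1 ^+ 0)); last first.
      by apply/funext => t; rewrite !expr0.
    by rewrite cint_expi eqxx mulNr mulrC.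
  have -> : (fun t => z ^+ lift ord0 n * (circ rho t)^-1 ^+ lift ord0 n) =
     (fun t => (z ^+ lift ord0 n * rho^-1%:C ^+ lift ord0 n) * (expi t)^-1 ^+ lift ord0 n).
    by apply/funext => t; rewrite circV exprMn mulrA.
  by rewrite cintZ // cint_expi /= mulr0.
have key : cm (cint uM 0 (2 * pi) - cint v 0 (2 * pi)) <= 2 * (K * q ^+ M) * (2 * pi - 0).
  apply: (cint_approx _ _ v) => // t ht.
    by apply: cprimP => //; move: ht; clear -p8 n8; lra.
  have geo : \sum_(n < M) z ^+ n * (circ rho t)^-1 ^+ n =
     (1 - (z / circ rho t) ^+ M) * (circ rho t / (circ rho t - z)).
    have zc : 1 - z / circ rho t != 0.
      by rewrite -{1}(divff (circ0 t)) -mulrBl mulf_neq0 // invr_eq0.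
    apply: (mulfI zc); rewrite -[X in X * _ = _]opprB mulNr.
    under eq_bigr do rewrite -exprMn.
    rewrite -subrX1 opprB; field; by rewrite circ0 cn0.
  have -> : uM t - v t = - ((F (circ rho t) - f z) * (z / circ rho t) ^+ M *
      (circ rho t / (circ rho t - z))).
    have -> : uM t = (F (circ rho t) - f z) * \sum_(n < M) z ^+ n * (circ rho t)^-1 ^+ n.
      rewrite /uM mulrBl mulNr; congr (_ - _); rewrite mulr_sumr.
      by apply: eq_bigr => n _; rewrite /u; ring.
    by rewrite geo /v; ring.
  have cdz : rho - cm z <= cm (circ rho t - z).
    by apply: le_trans (cmB_ge _ _); rewrite cm_circ // ltW.
  move: (hB t ht) (cm_circ rho t (ltW rho0)) cdz (cn0 t).
  move: (F (circ rho t)) (circ rho t) => Ft ct FB cmc cdz cn.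
  rewrite cmN !(cmM, cmX, cmV) cmc -/q /K.
  rewrite [leRHS](_ : _ = (B + cm (f z)) * q ^+ M * (rho / (rho - cm z))); last by ring.
  have rp := ltW rho0; case/andP: q1 => q0 _.
  apply: ler_pM; rewrite ?mulr_ge0 ?cm_ge0 ?exprn_ge0 ?invr_ge0 ?cm_ge0 //.
    apply: ler_wpM2r; first by rewrite exprn_ge0.
    by apply: le_trans (cmB _ _) _; rewrite lerD2r.
  by apply: ler_wpM2l => //; rewrite lef_pV2 ?posrE ?cm_gt0.
move: key; rewrite cint_v subr0 cint_uM cmM cm_real ger0_norm // subr0 mulrC.
rewrite ler_pM2r // -cmN opprB => key; apply: le_trans key _.
have K1 : 0 < 2 * K + 1 by clear -K0; lra.
have := hN M (ltnW NM); rewrite ltr_pdivlMr // => H.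
have qM : 0 <= q ^+ M by rewrite exprn_ge0 //; case/andP: q1.
by clear -H qM; lra.
Qed.

End CauchyCircle.

(** * Area integrals of monomials over disks *)

Section DiskIntegrals.
Context {R : realType}.
Notation C := (complex R).
Notation mu := (@lebesgue_measure R).
Notation T1 := (measurableTypeR R).
Notation T2 := (measurableTypeR R * measurableTypeR R)%type.
Notation mu2 := (mu \x mu)%E.

Definition disc (rho : R) : set T2 := [set xy : T2 | xy.1 ^+ 2 + xy.2 ^+ 2 < rho ^+ 2].

Lemma measurable_sqnorm (D : set T2) : measurable_fun D (fun xy : T2 => xy.1 ^+ 2 + xy.2 ^+ 2 : R).
Proof.
apply: measurable_funTS; apply: measurable_funD; apply: measurable_funX.
  exact: measurable_fst.
exact: measurable_snd.
Qed.

Lemma measurable_disc rho : measurable (disc rho).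
Proof.
have := @measurable_fun_ltr _ T2 R setT (fun xy => xy.1 ^+ 2 + xy.2 ^+ 2) (fun=> rho ^+ 2)
  (measurable_sqnorm _) (measurable_cst _).
have mt : measurable ([set true] : set bool) by [].
move=> /(_ measurableT _ mt); rewrite setTI.
rewrite (_ : _ @^-1` _ = disc rho) //.
Qed.

Lemma disc_fin rho : rho <= 1 -> 0 <= rho -> (mu2 (disc rho) < +oo)%E.
Proof.
move=> r1 r0.
have sub : disc rho `<=` `[-1, 1] `*` `[-1, 1].
  move=> [x y]; rewrite /disc /= !in_itv /= => h.
  have r2 : rho ^+ 2 <= 1 by rewrite expr_le1.
  have x2 := sqr_ge0 x; have y2 := sqr_ge0 y.
  have B (t : R) : t ^+ 2 <= 1 -> -1 <= t <= 1.
    by move=> ht; rewrite -ler_norml -(ler_pXn2r (n := 2)) ?nnegrE // real_normK ?num_real // expr1n.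
  by split; apply: B; lra.
apply: le_lt_trans (le_measure _ _ _ sub) _; rewrite ?inE.
- exact: measurable_disc.
- by apply: measurableX.
rewrite [X in (X < _)%E](_ : _ = (mu `[(-1)%R, 1%R] * mu `[(-1)%R, 1%R])%E); last exact: product_measure1E.
rewrite lebesgue_measure_itv /= lte_fin; case: ifP => _; rewrite ?mul0e ?ltry //.
Qed.

Definition cmeas (D : set T2) (u : T2 -> C) : Prop :=
  measurable_fun D (@complex.Re R \o u) /\ measurable_fun D (@complex.Im R \o u).

Lemma cmeasD D u v : cmeas D u -> cmeas D v -> cmeas D (fun z => u z + v z).
Proof.
move=> [h1 h2] [h3 h4]; split.
  rewrite (_ : _ \o _ = fun z => complex.Re (u z) + complex.Re (v z)); first exact: measurable_funD.
  by apply/funext => z /=; rewrite raddfD.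
rewrite (_ : _ \o _ = fun z => complex.Im (u z) + complex.Im (v z)); first exact: measurable_funD.
by apply/funext => z /=; rewrite raddfD.
Qed.

Lemma cmeasM D u v : cmeas D u -> cmeas D v -> cmeas D (fun z => u z * v z).
Proof.
move=> [h1 h2] [h3 h4]; split.
  rewrite (_ : _ \o _ = fun z => complex.Re (u z) * complex.Re (v z) - complex.Im (u z) * complex.Im (v z)).
    by apply: measurable_funB; apply: measurable_funM.
  by apply/funext => z /=; case: (u z) (v z) => [? ?] [? ?].
rewrite (_ : _ \o _ = fun z => complex.Re (u z) * complex.Im (v z) + complex.Im (u z) * complex.Re (v z)).
  by apply: measurable_funD; apply: measurable_funM.
by apply/funext => z /=; case: (u z) (v z) => [? ?] [? ?].
Qed.

Lemma cmeas_cst D c : cmeas D (fun=> c).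
Proof. by split; exact: measurable_cst. Qed.

Lemma cmeasX D u n : cmeas D u -> cmeas D (fun z => u z ^+ n).
Proof.
move=> h; elim: n => [|n IH]; first exact: cmeas_cst.
by under [X in cmeas _ X]eq_fun do rewrite exprS; exact: cmeasM.
Qed.

Lemma cmeas_conj D u : cmeas D u -> cmeas D (fun z => conjc (u z)).
Proof.
move=> [h1 h2]; split.
  by rewrite (_ : _ \o _ = @complex.Re R \o u) //; apply/funext => z /=; case: (u z).
rewrite (_ : _ \o _ = fun z => - complex.Im (u z)); first exact: measurable_funN.
by apply/funext => z /=; case: (u z).
Qed.

Lemma cmeas_toC D : cmeas D (@toC R).
Proof.
split; apply: measurable_funTS.
  by rewrite (_ : _ \o _ = fst) //; exact: measurable_fst.
by rewrite (_ : _ \o _ = snd) //; exact: measurable_snd.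
Qed.

Lemma cmeas_sum D (F : nat -> T2 -> C) M : (forall n, cmeas D (F n)) ->
  cmeas D (fun z => \sum_(n < M) F n z).
Proof.
move=> h; elim: M => [|M IH].
  by under [X in cmeas _ X]eq_fun do rewrite big_ord0; exact: cmeas_cst.
by under [X in cmeas _ X]eq_fun do rewrite big_ord_recr /=; exact: cmeasD.
Qed.

(** Bounded measurable functions are closed under the algebraic operations and integrable on sets of
    finite measure. *)
Definition nice (D : set T2) (u : T2 -> C) : Prop :=
  cmeas D u /\ exists B, forall z, D z -> cm (u z) <= B.

Lemma niceD D u v : nice D u -> nice D v -> nice D (fun z => u z + v z).
Proof.
move=> [h1 [B1 b1]] [h2 [B2 b2]]; split; first exact: cmeasD.
exists (B1 + B2) => z Dz; apply: le_trans (cmD _ _) _; apply: lerD; [exact: b1|exact: b2].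
Qed.

Lemma niceM D u v : nice D u -> nice D v -> nice D (fun z => u z * v z).
Proof.
move=> [h1 [B1 b1]] [h2 [B2 b2]]; split; first exact: cmeasM.
by exists (B1 * B2) => z Dz; rewrite cmM; apply: ler_pM; rewrite ?cm_ge0 ?b1 ?b2.
Qed.

Lemma nice_cst D c : nice D (fun=> c).
Proof. by split; [exact: cmeas_cst | exists (cm c)]. Qed.

Lemma nice_sum D (F : nat -> T2 -> C) M : (forall n, nice D (F n)) ->
  nice D (fun z => \sum_(n < M) F n z).
Proof.
move=> h; elim: M => [|M IH].
  by under [X in nice _ X]eq_fun do rewrite big_ord0; exact: nice_cst.
by under [X in nice _ X]eq_fun do rewrite big_ord_recr /=; exact: niceD.
Qed.

Lemma nice_conj D u : nice D u -> nice D (fun z => conjc (u z)).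
Proof.
move=> [h [B b]]; split; first exact: cmeas_conj.
by exists B => z Dz; rewrite cm_conj b.
Qed.

Lemma cint_integrable (D : set T2) u : measurable D -> (mu2 D < +oo)%E -> nice D u ->
  mu2.-integrable D (EFin \o (@complex.Re R \o u)) /\
  mu2.-integrable D (EFin \o (@complex.Im R \o u)).
Proof.
move=> mD fD [[h1 h2] [B b]].
split; apply: measurable_bounded_integrable => //.
  exists B; split; first exact: num_real.
  by move=> x Bx z Dz; apply: le_trans (ltW Bx); apply: le_trans (b z Dz); exact: cm_Re.
exists B; split; first exact: num_real.
by move=> x Bx z Dz; apply: le_trans (ltW Bx); apply: le_trans (b z Dz); exact: cm_Im.
Qed.

Definition cI (D : set T2) (u : T2 -> C) : C :=
  Rintegral mu2 D (@complex.Re R \o u) +i* Rintegral mu2 D (@complex.Im R \o u).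

Definition cintegrable (D : set T2) (u : T2 -> C) : Prop :=
  mu2.-integrable D (EFin \o (@complex.Re R \o u)) /\
  mu2.-integrable D (EFin \o (@complex.Im R \o u)).

Lemma cID D u v : measurable D -> cintegrable D u -> cintegrable D v ->
  cintegrable D (fun z => u z + v z) /\ cI D (fun z => u z + v z) = cI D u + cI D v.
Proof.
move=> mD [h1 h2] [h3 h4].
have E1 : @complex.Re R \o (fun z => u z + v z) = (@complex.Re R \o u) \+ (@complex.Re R \o v).
  by apply/funext => z /=; rewrite raddfD.
have E2 : @complex.Im R \o (fun z => u z + v z) = (@complex.Im R \o u) \+ (@complex.Im R \o v).
  by apply/funext => z /=; rewrite raddfD.
split.
  by rewrite /cintegrable E1 E2; split; [exact: integrableD h1 h3|exact: integrableD h2 h4].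
rewrite /cI E1 E2 !RintegralD //.
Qed.

Lemma cIZ D (c : C) u : measurable D -> cintegrable D u ->
  cintegrable D (fun z => c * u z) /\ cI D (fun z => c * u z) = c * cI D u.
Proof.
move=> mD [h1 h2]; case: c => a b.
have Z (k : R) f : mu2.-integrable D (EFin \o f) -> mu2.-integrable D (EFin \o (fun z => k * f z)).
  move=> fi; rewrite (_ : _ \o _ = (fun z => k%:E * (EFin \o f) z)%E) //.
  exact: integrableZl.
have E1 : @complex.Re R \o (fun z => (a +i* b) * u z) =
    (fun z => a * (@complex.Re R \o u) z) \- (fun z => b * (@complex.Im R \o u) z).
  by apply/funext => z /=; case: (u z).
have E2 : @complex.Im R \o (fun z => (a +i* b) * u z) =
    (fun z => a * (@complex.Im R \o u) z) \+ (fun z => b * (@complex.Re R \o u) z).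
  by apply/funext => z /=; case: (u z).
split.
  rewrite /cintegrable E1 E2; split.
    exact: (integrableB mD (Z a _ h1) (Z b _ h2)).
  exact: (integrableD mD (Z a _ h2) (Z b _ h1)).
rewrite /cI E1 E2 RintegralB ?RintegralD ?RintegralZl //; try exact: Z.
Qed.

Lemma cI_sum D (F : nat -> T2 -> C) M : measurable D -> (mu2 D < +oo)%E ->
  (forall n, nice D (F n)) ->
  cI D (fun z => \sum_(n < M) F n z) = \sum_(n < M) cI D (F n).
Proof.
move=> mD fD h; elim: M => [|M IH].
  rewrite big_ord0 (_ : (fun _ => _) = fun z => 0 * 0).
    by rewrite (cIZ D 0 (fun=> 0) mD _).2 ?mul0r //; apply: cint_integrable => //; exact: nice_cst.
  by apply/funext => z; rewrite big_ord0 mul0r.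
rewrite big_ord_recr /= -IH -(cID _ _ _ mD _ _).2.
- by congr cI; apply/funext => z; rewrite big_ord_recr.
- by apply: cint_integrable => //; exact: nice_sum.
- by apply: cint_integrable.
Qed.

Lemma cI_le D u B : measurable D -> (mu2 D < +oo)%E -> cmeas D u ->
  (forall z, D z -> cm (u z) <= B) -> cm (cI D u) <= 2 * B * fine (mu2 D).
Proof.
move=> mD fD mu_ hB.
have ni : nice D u by split => //; exists B.
have [h1 h2] := cint_integrable _ _ mD fD ni.
apply: le_trans (cm_le_ReIm _) _; rewrite /= (_ : 2 * B * _ = B * fine (mu2 D) + B * fine (mu2 D)); last by ring.
have bound (f : T2 -> R) : mu2.-integrable D (EFin \o f) -> (forall z, D z -> `|f z| <= B) ->
    `|Rintegral mu2 D f| <= B * fine (mu2 D).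
  move=> fi fB; apply: le_trans (le_normr_Rintegral mD fi) _.
  have -> : B * fine (mu2 D) = Rintegral mu2 D (fun=> B).
    by rewrite Rintegral_cst.
  apply: le_Rintegral => //.
  - exact: (integrable_norm fi).
  - apply: measurable_bounded_integrable => //; exists B; split; first exact: num_real.
    by move=> x Bx z Dz /=; rewrite ger0_norm ?(ltW Bx) //; apply: le_trans (fB z Dz).
by apply: lerD; apply: bound => // z Dz; apply: le_trans (hB z Dz); [exact: cm_Re | exact: cm_Im].
Qed.

Lemma integral_FTC0 (F g : R -> R) (b : R) : 0 < b -> continuous g ->
  (forall x, is_derive x (1 : R) F (g x)) -> F b = 0 -> F (- b) = 0 ->
  (\int[mu]_(x in `](- b)%R, b[) (g x)%:E = 0)%E.
Proof.
move=> b0 cg dF F1 F2.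
have bb : - b < b by rewrite gtrN.
rewrite -(@integral_itv_bndoo _ _ _ (EFin \o g) true false); last first.
  apply/measurable_EFinP; apply: measurable_funTS; exact: continuous_measurable_fun.
rewrite (@continuous_FTC2 _ g F) //.
- by rewrite F1 F2 subee.
- exact: continuous_subspaceT.
- have cF : continuous F.
    move=> x; apply/differentiable_continuous/derivable1_diffP; by case: (dF x).
  split; first by move=> x _; case: (dF x).
    exact/cvg_at_right_filter/cF.
  exact/cvg_at_left_filter/cF.
- by move=> x _; rewrite derive1E; case: (dF x).
Qed.

Lemma disc_slice_x rho y : 0 <= rho -> [set x : T1 | disc rho (x, y)] =
  if y ^+ 2 < rho ^+ 2 then `](- Num.sqrt (rho ^+ 2 - y ^+ 2)), Num.sqrt (rho ^+ 2 - y ^+ 2)[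
  else set0.
Proof.
move=> r0; apply/seteqP; split => x; rewrite /disc /=.
  move=> h; have x2 := sqr_ge0 x; rewrite ifT; last by lra.
  rewrite /= in_itv /= -ltr_norml -(ltr_pXn2r (n := 2)) ?nnegrE ?sqrtr_ge0 //.
  by rewrite real_normK ?num_real // sqr_sqrtr; lra.
case: ifP => // h; rewrite /= in_itv /= -ltr_norml -(ltr_pXn2r (n := 2)) ?nnegrE ?sqrtr_ge0 //.
by rewrite real_normK ?num_real // sqr_sqrtr; lra.
Qed.

(** Fubini: on every chord parallel to the first axis the integrand is the derivative of [F], which
    vanishes at both ends. *)
Lemma disc_div_x rho (F g : R -> R -> R) : 0 <= rho -> (forall y, continuous (g^~ y)) ->
  (forall x y, is_derive x (1 : R) (F^~ y) (g x y)) ->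
  (forall x y, x ^+ 2 + y ^+ 2 = rho ^+ 2 -> F x y = 0) ->
  mu2.-integrable (disc rho) (fun z => (g z.1 z.2)%:E) ->
  (\int[mu2]_(z in disc rho) (g z.1 z.2)%:E = 0)%E.
Proof.
move=> r0 cg dF F0 gi.
have mD := measurable_disc rho.
rewrite integral_mkcond.
have gi' : mu2.-integrable setT ((fun z => (g z.1 z.2)%:E) \_ (disc rho)).
  by apply/integrable_restrict => //; rewrite setTI.
rewrite -integral21_prod_meas1 //; apply: integral0_eq => y _.
transitivity (\int[mu]_(x in [set x | disc rho (x, y)]) (g x y)%:E)%E.
  rewrite [RHS]integral_mkcond; apply: eq_integral => x _.
  rewrite !patchE; congr (if _ then _ else _).
rewrite disc_slice_x //; case: ifP => h; last by rewrite integral_set0.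
have s0 : 0 < rho ^+ 2 - y ^+ 2 by rewrite subr_gt0.
apply: (integral_FTC0 (F^~ y) (g^~ y)) => //.
- by rewrite sqrtr_gt0.
- by apply: F0; rewrite sqr_sqrtr ?subrK // ltW.
- by apply: F0; rewrite sqrrN sqr_sqrtr ?subrK // ltW.
Qed.

Lemma disc_div_y rho (F g : R -> R -> R) : 0 <= rho -> (forall x, continuous (g x)) ->
  (forall x y, is_derive y (1 : R) (F x) (g x y)) ->
  (forall x y, x ^+ 2 + y ^+ 2 = rho ^+ 2 -> F x y = 0) ->
  mu2.-integrable (disc rho) (fun z => (g z.1 z.2)%:E) ->
  (\int[mu2]_(z in disc rho) (g z.1 z.2)%:E = 0)%E.
Proof.
move=> r0 cg dF F0 gi.
have mD := measurable_disc rho.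
rewrite integral_mkcond.
have gi' : mu2.-integrable setT ((fun z => (g z.1 z.2)%:E) \_ (disc rho)).
  by apply/integrable_restrict => //; rewrite setTI.
rewrite -integral12_prod_meas1 //; apply: integral0_eq => x _.
transitivity (\int[mu]_(y in [set y | disc rho (y, x)]) (g x y)%:E)%E.
  rewrite [RHS]integral_mkcond; apply: eq_integral => y _.
  rewrite !patchE; congr (if _ then _ else _).
  by apply/idP/idP; rewrite !inE /disc /= addrC.
rewrite disc_slice_x //; case: ifP => h; last by rewrite integral_set0.
have s0 : 0 < rho ^+ 2 - x ^+ 2 by rewrite subr_gt0.
apply: (integral_FTC0 (F x) (g x)) => //.
- by rewrite sqrtr_gt0.
- by apply: F0; rewrite sqr_sqrtr ?subrKC ?(ltW s0) //; ring.
- by apply: F0; rewrite sqrrN sqr_sqrtr ?(ltW s0) //; ring.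
Qed.

End DiskIntegrals.

(** * Moments of the monomials on a disk *)

Section Moments.
Context {R : realType}.
Notation C := (complex R).
Notation mu := (@lebesgue_measure R).
Notation T1 := (measurableTypeR R).
Notation T2 := (measurableTypeR R * measurableTypeR R)%type.
Notation mu2 := (mu \x mu)%E.
Local Notation ii := (@Complex R 0 1).
Implicit Types (D : set T2) (u : T2 -> C) (rho : R).

Lemma cderivM (V W : R -> C) (t : R) v w :
  cderiv V t v -> cderiv W t w -> cderiv (fun t => V t * W t) t (v * W t + V t * w).
Proof.
move=> [a1 a2] [b1 b2]; split.
  rewrite (_ : _ \o _ = (@complex.Re R \o V) * (@complex.Re R \o W) -
     (@complex.Im R \o V) * (@complex.Im R \o W)); last first.
    by apply/funext => s; rewrite !fctE /=; case: (V s) (W s) => [? ?] [? ?].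
  have h := is_deriveB (is_deriveM a1 b1) (is_deriveM a2 b2).
  refine (eq_rect _ (is_derive t (1 : R) _) h _ _); rewrite /=.
  case: (V t) (W t) (v) (w) => [p q] [p' q'] [r s] [r' s'] /=.
  by rewrite -![_ *: _]/(_ * _); ring.
rewrite (_ : _ \o _ = (@complex.Re R \o V) * (@complex.Im R \o W) +
   (@complex.Im R \o V) * (@complex.Re R \o W)); last first.
  by apply/funext => s; rewrite !fctE /=; case: (V s) (W s) => [? ?] [? ?].
have h := is_deriveD (is_deriveM a1 b2) (is_deriveM a2 b1).
refine (eq_rect _ (is_derive t (1 : R) _) h _ _); rewrite /=.
case: (V t) (W t) (v) (w) => [p q] [p' q'] [r s] [r' s'] /=.
by rewrite -![_ *: _]/(_ * _); ring.
Qed.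

Lemma cderivX (V : R -> C) (t : R) v n :
  cderiv V t v -> cderiv (fun t => V t ^+ n) t (n%:R * V t ^+ n.-1 * v).
Proof.
move=> h; elim: n => [|n IH].
  under eq_fun do rewrite expr0; rewrite mul0r mul0r.
  by split; exact: is_derive_cst.
under eq_fun do rewrite exprS.
have := cderivM _ _ _ _ _ h IH.
rewrite (_ : v * _ + _ = n.+1%:R * V t ^+ n.+1.-1 * v) //.
case: n {IH} => [|n] /=; first by rewrite expr0; ring.
by rewrite -[in RHS]natr1 exprS; ring.
Qed.

Lemma cderiv_x (y t : R) : cderiv (fun s => s +i* y) t 1 /\ cderiv (fun s => s -i* y) t 1.
Proof. by split; split; rewrite /=; (exact: is_derive_id || exact: is_derive_cst). Qed.

Lemma cderiv_y (x t : R) : cderiv (fun s => x +i* s) t ii /\ cderiv (fun s => x -i* s) t (- ii).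
Proof.
split; split; rewrite /=; rewrite ?oppr0; try exact: is_derive_id; try exact: is_derive_cst.
exact: is_deriveNid.
Qed.

Definition mon (a b : nat) (z : C) : C := z ^+ a * conjc z ^+ b.

Lemma cderiv_mon (V W : R -> C) t v w a b : (forall s, W s = (V s)^*) ->
  cderiv V t v -> cderiv W t w ->
  cderiv (fun s => mon a b (V s)) t
    (v * (a%:R * mon a.-1 b (V t)) + w * (b%:R * mon a b.-1 (V t))).
Proof.
move=> WV hV hW; rewrite /mon -!(WV t).
rewrite (_ : (fun s => _) = (fun s => V s ^+ a * W s ^+ b)); last by apply/funext => s; rewrite WV.
have := cderivM _ _ _ _ _ (cderivX _ _ _ a hV) (cderivX _ _ _ b hW).
by rewrite (_ : _ + _ = v * (a%:R * (V t ^+ a.-1 * W t ^+ b)) + w * (b%:R * (V t ^+ a * W t ^+ b.-1))) //; ring.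
Qed.

(** This is [(rho^2 - |z|^2) z^a conj(z)^b]; [dwx] and [dwy] are its two partial derivatives. *)
Definition wmon (rho : R) a b (z : C) : C := (rho ^+ 2)%:C * mon a b z - mon a.+1 b.+1 z.

Definition dwx (rho : R) a b (z : C) : C :=
  (rho ^+ 2)%:C * (a%:R * mon a.-1 b z + b%:R * mon a b.-1 z)
  - (a.+1%:R * mon a b.+1 z + b.+1%:R * mon a.+1 b z).
Definition dwy (rho : R) a b (z : C) : C :=
  (rho ^+ 2)%:C * (ii * (a%:R * mon a.-1 b z) - ii * (b%:R * mon a b.-1 z))
  - (ii * (a.+1%:R * mon a b.+1 z) - ii * (b.+1%:R * mon a.+1 b z)).

Lemma cderivB (V W : R -> C) (t : R) v w :
  cderiv V t v -> cderiv W t w -> cderiv (fun t => V t - W t) t (v - w).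
Proof.
move=> h1 h2; have := cderivD _ _ _ _ _ h1 (cderiv_lin (-1) _ _ _ h2).
by rewrite mulN1r; under eq_fun do rewrite mulN1r.
Qed.

Lemma cderiv_wmon_x rho a b y t :
  cderiv (fun s => wmon rho a b (s +i* y)) t (dwx rho a b (t +i* y)).
Proof.
have [h1 h2] := cderiv_x y t.
have E s : s -i* y = (s +i* y)^* by [].
have d1 := cderiv_mon _ _ _ _ _ a b E h1 h2.
have d2 := cderiv_mon _ _ _ _ _ a.+1 b.+1 E h1 h2.
have := cderivB _ _ _ _ _ (cderiv_lin (rho ^+ 2)%:C _ _ _ d1) d2.
by rewrite !mul1r.
Qed.

Lemma cderiv_wmon_y rho a b x t :
  cderiv (fun s => wmon rho a b (x +i* s)) t (dwy rho a b (x +i* t)).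
Proof.
have [h1 h2] := cderiv_y x t.
have E s : x -i* s = (x +i* s)^* by [].
have d1 := cderiv_mon _ _ _ _ _ a b E h1 h2.
have d2 := cderiv_mon _ _ _ _ _ a.+1 b.+1 E h1 h2.
have := cderivB _ _ _ _ _ (cderiv_lin (rho ^+ 2)%:C _ _ _ d1) d2.
by rewrite !mulNr.
Qed.

Lemma wmon0 (rho x y : R) a b : x ^+ 2 + y ^+ 2 = rho ^+ 2 -> wmon rho a b (x +i* y) = 0.
Proof.
move=> h; rewrite /wmon -h /mon (exprS _ a) (exprS _ b).
rewrite (_ : (x ^+ 2 + y ^+ 2)%:C = (x +i* y) * conjc (x +i* y)); first by ring.
by apply/eqP; rewrite eq_complex /=; apply/andP; split; apply/eqP; ring.
Qed.

Lemma ccont_mon (V : R -> C) a b : ccont V -> ccont (fun s => mon a b (V s)).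
Proof.
move=> h; apply: ccontM; first exact: ccontX.
apply: ccontX; apply/ccontP => t e /((ccontP _).1 h t)[d d0 hd].
by exists d => // s /hd; rewrite -(cm_conj (_ - _)) rmorphB.
Qed.

Lemma ccontZ c (u : R -> C) : ccont u -> ccont (fun t => c * u t).
Proof. by move=> h; apply: ccontM => //; exact: ccont_cst. Qed.

Lemma ccontB (u v : R -> C) : ccont u -> ccont v -> ccont (fun t => u t - v t).
Proof.
move=> h1 h2; have := ccontD _ _ h1 (ccontZ (-1) _ h2).
by under eq_fun do rewrite mulN1r.
Qed.

Lemma ccont_dwx rho a b (V : R -> C) : ccont V -> ccont (fun s => dwx rho a b (V s)).
Proof.
move=> h; apply: ccontB; last by apply: ccontD; apply: ccontZ; exact: ccont_mon.
by apply: ccontZ; apply: ccontD; apply: ccontZ; exact: ccont_mon.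
Qed.

Lemma ccont_dwy rho a b (V : R -> C) : ccont V -> ccont (fun s => dwy rho a b (V s)).
Proof.
move=> h; apply: ccontB; last by apply: ccontB; apply: ccontZ; apply: ccontZ; exact: ccont_mon.
by apply: ccontZ; apply: ccontB; apply: ccontZ; apply: ccontZ; exact: ccont_mon.
Qed.

Lemma disc_lt1 rho z : 0 <= rho -> disc rho z -> cm (toC z) < rho.
Proof.
move=> r0; rewrite /disc /= => h.
by rewrite -(ltr_pXn2r (n := 2)) ?nnegrE ?cm_ge0 // cm_sqr.
Qed.

Lemma nice_toC rho : 0 <= rho -> nice (disc rho) (@toC R).
Proof.
move=> r0; split; first exact: cmeas_toC.
by exists rho => z /(disc_lt1 _ _ r0)/ltW.
Qed.

Lemma niceX D u n : nice D u -> nice D (fun z => u z ^+ n) .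
Proof.
move=> h; elim: n => [|n IH]; first exact: nice_cst.
by under [X in nice _ X]eq_fun do rewrite exprS; exact: niceM.
Qed.

Lemma nice_mon rho a b : 0 <= rho -> nice (disc rho) (fun z => mon a b (toC z)).
Proof.
move=> r0; apply: niceM; apply: niceX; first exact: nice_toC.
exact/nice_conj/nice_toC.
Qed.

Definition J (rho : R) a b : C := cI (disc rho) (fun z => mon a b (toC z)).

Lemma niceZ D (c : C) u : nice D u -> nice D (fun z => c * u z).
Proof. by move=> h; apply: niceM => //; exact: nice_cst. Qed.

Lemma niceB D u (v : T2 -> C) : nice D u -> nice D v -> nice D (fun z => u z - v z).
Proof.
move=> h1 h2; have := niceD _ _ _ h1 (niceZ _ (-1) _ h2).
by under eq_fun do rewrite mulN1r.
Qed.

Lemma cI_D rho u (v : T2 -> C) : 0 <= rho <= 1 -> nice (disc rho) u -> nice (disc rho) v ->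
  cI (disc rho) (fun z => u z + v z) = cI (disc rho) u + cI (disc rho) v.
Proof.
move=> /andP[r0 r1] hu hv; have mD := measurable_disc rho; have fD := disc_fin rho r1 r0.
by apply: (cID _ _ _ mD _ _).2; exact: cint_integrable.
Qed.

Lemma cI_Z rho (c : C) u : 0 <= rho <= 1 -> nice (disc rho) u ->
  cI (disc rho) (fun z => c * u z) = c * cI (disc rho) u.
Proof.
move=> /andP[r0 r1] hu; have mD := measurable_disc rho; have fD := disc_fin rho r1 r0.
by apply: (cIZ _ _ _ mD _).2; exact: cint_integrable.
Qed.

Lemma cI_B rho u (v : T2 -> C) : 0 <= rho <= 1 -> nice (disc rho) u -> nice (disc rho) v ->
  cI (disc rho) (fun z => u z - v z) = cI (disc rho) u - cI (disc rho) v.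
Proof.
move=> r01 hu hv; have := cI_D rho u (fun z => -1 * v z) r01 hu (niceZ _ _ _ hv).
by rewrite cI_Z // mulN1r; under eq_fun do rewrite mulN1r.
Qed.

Lemma nice_dwx rho a b : 0 <= rho -> nice (disc rho) (fun z => dwx rho a b (toC z)).
Proof.
move=> r0; apply: niceB; last by apply: niceD; apply: niceZ; exact: nice_mon.
by apply: niceZ; apply: niceD; apply: niceZ; exact: nice_mon.
Qed.

Lemma nice_dwy rho a b : 0 <= rho -> nice (disc rho) (fun z => dwy rho a b (toC z)).
Proof.
move=> r0; apply: niceB; last by apply: niceB; apply: niceZ; apply: niceZ; exact: nice_mon.
by apply: niceZ; apply: niceB; apply: niceZ; apply: niceZ; exact: nice_mon.
Qed.

Lemma cI_dwx rho a b : 0 <= rho <= 1 -> cI (disc rho) (fun z => dwx rho a b (toC z)) = 0.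
Proof.
move=> /andP[r0 r1]; have mD := measurable_disc rho; have fD := disc_fin rho r1 r0.
have [i1 i2] := cint_integrable _ _ mD fD (nice_dwx rho a b r0).
rewrite /cI; apply/eqP; rewrite eq_complex /=; apply/andP; split; apply/eqP; rewrite /Rintegral.
- rewrite (_ : (\int[_]_(_ in _) _)%E = 0%E) //.
  apply: (disc_div_x rho (fun x y => complex.Re (wmon rho a b (x +i* y)))
    (fun x y => complex.Re (dwx rho a b (x +i* y)))) => //.
  + move=> y; have := ccont_dwx rho a b (fun s => s +i* y).
    by case=> //; apply: cderiv_cont => t; exact: (cderiv_x y t).1.
  + by move=> x y; case: (cderiv_wmon_x rho a b y x).
  + by move=> x y h; rewrite wmon0.
- rewrite (_ : (\int[_]_(_ in _) _)%E = 0%E) //.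
  apply: (disc_div_x rho (fun x y => complex.Im (wmon rho a b (x +i* y)))
    (fun x y => complex.Im (dwx rho a b (x +i* y)))) => //.
  + move=> y; have := ccont_dwx rho a b (fun s => s +i* y).
    by case=> //; apply: cderiv_cont => t; exact: (cderiv_x y t).1.
  + by move=> x y; case: (cderiv_wmon_x rho a b y x).
  + by move=> x y h; rewrite wmon0.
Qed.

Lemma cI_dwy rho a b : 0 <= rho <= 1 -> cI (disc rho) (fun z => dwy rho a b (toC z)) = 0.
Proof.
move=> /andP[r0 r1]; have mD := measurable_disc rho; have fD := disc_fin rho r1 r0.
have [i1 i2] := cint_integrable _ _ mD fD (nice_dwy rho a b r0).
rewrite /cI; apply/eqP; rewrite eq_complex /=; apply/andP; split; apply/eqP; rewrite /Rintegral.
- rewrite (_ : (\int[_]_(_ in _) _)%E = 0%E) //.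
  apply: (disc_div_y rho (fun x y => complex.Re (wmon rho a b (x +i* y)))
    (fun x y => complex.Re (dwy rho a b (x +i* y)))) => //.
  + move=> x; have := ccont_dwy rho a b (fun s => x +i* s).
    by case=> //; apply: cderiv_cont => t; exact: (cderiv_y x t).1.
  + by move=> x y; case: (cderiv_wmon_y rho a b x y).
  + by move=> x y h; rewrite wmon0.
- rewrite (_ : (\int[_]_(_ in _) _)%E = 0%E) //.
  apply: (disc_div_y rho (fun x y => complex.Im (wmon rho a b (x +i* y)))
    (fun x y => complex.Im (dwy rho a b (x +i* y)))) => //.
  + move=> x; have := ccont_dwy rho a b (fun s => x +i* s).
    by case=> //; apply: cderiv_cont => t; exact: (cderiv_y x t).1.
  + by move=> x y; case: (cderiv_wmon_y rho a b x y).
  + by move=> x y h; rewrite wmon0.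
Qed.

Lemma cI_dwx_J rho a b : 0 <= rho <= 1 ->
  (rho ^+ 2)%:C * (a%:R * J rho a.-1 b + b%:R * J rho a b.-1)
  - (a.+1%:R * J rho a b.+1 + b.+1%:R * J rho a.+1 b) = 0.
Proof.
move=> r01; have r0 : 0 <= rho by case/andP: r01.
have N c d e : nice (disc rho) (fun z => e * mon c d (toC z)) by apply: niceZ; exact: nice_mon.
rewrite -(cI_dwx rho a b r01) /dwx cI_B //; first last.
- by apply: niceD.
- by apply: niceZ; apply: niceD.
rewrite cI_Z ?cI_D //; last by apply: niceD.
by rewrite !cI_Z //; exact: nice_mon.
Qed.

Lemma cI_dwy_J rho a b : 0 <= rho <= 1 ->
  (rho ^+ 2)%:C * (a%:R * J rho a.-1 b - b%:R * J rho a b.-1)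
  - (a.+1%:R * J rho a b.+1 - b.+1%:R * J rho a.+1 b) = 0.
Proof.
move=> r01; have r0 : 0 <= rho by case/andP: r01.
have i0 : (ii : C) != 0 by rewrite -cm_eq0 cm_i oner_eq0.
have N0 c d : nice (disc rho) (fun z => mon c d (toC z)) by exact: nice_mon.
have N c d e : nice (disc rho) (fun z => e * mon c d (toC z)) by apply: niceZ.
have N' c d e : nice (disc rho) (fun z => ii * (e * mon c d (toC z))) by apply: niceZ.
apply: (mulfI i0); rewrite mulr0 -(cI_dwy rho a b r01) /dwy cI_B //; first last.
- by apply: niceB.
- by apply: niceZ; apply: niceB.
rewrite cI_Z ?cI_B //; last by apply: niceB.
have Z c d e : cI (disc rho) (fun z => ii * (e * mon c d (toC z))) = ii * (e * J rho c d).
  by rewrite (cI_Z rho ii (fun z => e * mon c d (toC z))) // (cI_Z rho e (fun z => mon c d (toC z))).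
by rewrite !Z; ring.
Qed.

(* The divergence theorem for the d/dz- and d/dzbar-fields with potential
   (rho^2 - |z|^2) z^a zbar^b, which vanishes on the boundary circle. *)
Lemma J_dz rho a b : 0 <= rho <= 1 ->
  (rho ^+ 2)%:C * (a%:R * J rho a.-1 b) = a.+1%:R * J rho a b.+1.
Proof.
move=> r01; have := cI_dwx_J rho a b r01; have := cI_dwy_J rho a b r01.
move: (J rho a.-1 b) (J rho a b.-1) (J rho a b.+1) (J rho a.+1 b) => j1 j2 j3 j4 e1 e2.
have t2 : (2 : C) != 0 by rewrite pnatr_eq0.
apply: (mulfI t2); apply/eqP; rewrite -subr_eq0; apply/eqP.
by rewrite -[RHS]addr0 -{1}e1 -e2; ring.
Qed.

Lemma J_dzbar rho a b : 0 <= rho <= 1 ->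
  (rho ^+ 2)%:C * (b%:R * J rho a b.-1) = b.+1%:R * J rho a.+1 b.
Proof.
move=> r01; have := cI_dwx_J rho a b r01; have := cI_dwy_J rho a b r01.
move: (J rho a.-1 b) (J rho a b.-1) (J rho a b.+1) (J rho a.+1 b) => j1 j2 j3 j4 e1 e2.
have t2 : (2 : C) != 0 by rewrite pnatr_eq0.
apply: (mulfI t2); apply/eqP; rewrite -subr_eq0; apply/eqP.
by rewrite -[RHS]subr0 -{1}e2 -e1; ring.
Qed.

Definition darea (rho : R) : R := fine (mu2 (disc rho)).

Lemma J00 rho : 0 <= rho <= 1 -> J rho 0 0 = (darea rho)%:C.
Proof.
move=> /andP[r0 r1]; rewrite /J /cI /mon.
have -> : @complex.Re R \o (fun z : T2 => toC z ^+ 0 * conjc (toC z) ^+ 0) = fun=> 1.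
  by apply/funext => z; rewrite /comp !expr0 mulr1.
have -> : @complex.Im R \o (fun z : T2 => toC z ^+ 0 * conjc (toC z) ^+ 0) = fun=> 0.
  by apply/funext => z; rewrite /comp !expr0 mulr1.
have mD := measurable_disc rho; have fD := disc_fin rho r1 r0.
by rewrite !Rintegral_cst // mul1r mul0r.
Qed.

(** [J_dz] at [(n + 1, n)] is a recursion from [J n n] to the next diagonal moment. *)
Lemma J_diag rho n : 0 <= rho <= 1 ->
  J rho n n = (rho ^+ (2 * n) / n.+1%:R * darea rho)%:C.
Proof.
move=> r01; elim: n => [|n IH]; first by rewrite J00 // muln0 expr0 divr1 mul1r.
have := J_dz rho n.+1 n r01; rewrite /= IH => E.
have n2 : (n.+2%:R : C) != 0 by rewrite pnatr_eq0.
apply: (mulfI n2); rewrite -E -!(rmorph_nat (real_complex R)) -!rmorphM /=; congr (_ %:C).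
have a0 : (n.+1%:R : R) != 0 by rewrite pnatr_eq0.
have b0 : (n.+2%:R : R) != 0 by rewrite pnatr_eq0.
rewrite mulnS exprD; move: (n.+1%:R) (n.+2%:R) a0 b0 => p q p0 q0; field.
by rewrite p0 q0.
Qed.

(** [J_dz] and [J_dzbar] both express the moment at [(a + 1, b + 1)] through [J rho a b].
    Eliminating it leaves the factor [(a + 1)(b + 2) - (b + 1)(a + 2) = a - b]. *)
Lemma J_offdiag rho a b : 0 <= rho <= 1 -> 0 < rho -> a != b -> J rho a b = 0.
Proof.
move=> r01 r0 ab; have E1 := J_dz rho a.+1 b r01; have E2 := J_dzbar rho a b.+1 r01.
rewrite /= in E1 E2.
have : ((rho ^+ 2)%:C * J rho a b) * (a.+1%:R * b.+2%:R - b.+1%:R * a.+2%:R) = 0.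
  rewrite (_ : _ * _ = b.+2%:R * ((rho ^+ 2)%:C * (a.+1%:R * J rho a b)) -
     a.+2%:R * ((rho ^+ 2)%:C * (b.+1%:R * J rho a b))); last by ring.
  by rewrite E1 E2; ring.
move/eqP; rewrite mulf_eq0 => /orP[|].
  rewrite mulf_eq0 => /orP[|/eqP //].
  by rewrite -cm_eq0 cm_real normr_eq0 expf_eq0 /= gt_eqF.
rewrite -!natrM subr_eq0 eqr_nat => /eqP H; move: ab; apply: contraNeq => _; apply/eqP; lia.
Qed.

End Moments.

(** * Bergman functions and their coefficients *)

Section PowerSeries.
Context {R : realType}.
Notation C := (complex R).
Implicit Types (a b : nat -> C) (z w : C) (r rho B : R).

Definition psum a M z : C := \sum_(n < M) a n * z ^+ n.
Definition ev a z : C := csum (fun n => a n * z ^+ n).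
(** Radius of convergence at least 1, expressed by Cauchy estimates. *)
Definition tempered a : Prop := forall r, 0 < r < 1 -> exists K, forall n, cm (a n) * r ^+ n <= K.
Definition wsum a M : R := \sum_(n < M) cm (a n) ^+ 2 / n.+1%:R.
(** The squared Bergman norm is at most [B], up to normalization of the area; bounding partial sums
    states finiteness and norm estimates at once. *)
Definition wle a B : Prop := forall M, wsum a M <= B.

(** Each of the [n + 1] powers [r ^+ i] with [i <= n] in the geometric sum is at least [r ^+ n]. *)
Lemma linear_expn_le r n : 0 <= r < 1 -> n.+1%:R * r ^+ n <= (1 - r)^-1.
Proof.
move=> r01; apply: le_trans (geom_sum_le r n.+1 r01).
rewrite -[n.+1 in X in X <= _]card_ord -sum1_card natr_sum mulr_suml.
apply: ler_sum => -[i /= ilt] _; rewrite mul1r.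
case/andP: r01 => r0 /ltW r1; exact: ler_wiXn2l.
Qed.

Lemma tempered_linear a c : (forall n, cm (a n) <= c * n.+1%:R) -> tempered a.
Proof.
move=> h r /andP[r0 r1]; exists (c * (1 - r)^-1) => n.
have c0 : 0 <= c by have := h 0%N; rewrite mulr1; apply: le_trans; exact: cm_ge0.
apply: (@le_trans _ _ (c * (n.+1%:R * r ^+ n))).
  by rewrite mulrA ler_wpM2r // exprn_ge0 // ltW.
by rewrite ler_wpM2l // linear_expn_le // ltW.
Qed.

Lemma wle_ge0 a B : wle a B -> 0 <= B.
Proof. by move=> /(_ 0%N); rewrite /wsum big_ord0. Qed.

Lemma wle_coef a B n : wle a B -> cm (a n) ^+ 2 <= B * n.+1%:R.
Proof.
move=> /(_ n.+1); rewrite /wsum big_ord_recr /= => h.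
rewrite -ler_pdivrMr ?ltr0Sn //; apply: le_trans h; rewrite lerDr.
by apply: sumr_ge0 => i _; rewrite divr_ge0 // sqr_ge0.
Qed.

Lemma wle_tempered a B : wle a B -> tempered a.
Proof.
move=> h; have B0 := wle_ge0 _ _ h; apply: (tempered_linear _ (B + 1)) => n.
rewrite -(ler_pXn2r (n := 2)) ?nnegrE ?cm_ge0 ?mulr_ge0 ?addr_ge0 //.
apply: le_trans (wle_coef _ _ n h) _; rewrite exprMn expr2 [n.+1%:R ^+ 2]expr2.
apply: ler_pM => //; last by rewrite ler_peMr // ler1n.
have : 0 <= B * B by rewrite mulr_ge0.
by move: B0; clear; lra.
Qed.

Lemma tempered_geom a r : tempered a -> 0 <= r < 1 -> exists K s, 0 <= s < 1 /\
  forall n, cm (a n) * r ^+ n <= K * s ^+ n.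
Proof.
move=> ta /andP[r0 r1]; pose r' := (1 + r) / 2.
have r'0 : 0 < r' < 1 by rewrite /r'; lra.
have [K hK] := ta _ r'0; case/andP: r'0 => r'0 r'1.
exists K, (r / r'); split.
  by rewrite divr_ge0 ?(ltW r'0) //= ltr_pdivrMr // mul1r /r'; lra.
move=> n; rewrite expr_div_n mulrA ler_pdivlMr ?exprn_gt0 // mulrAC.
by rewrite ler_wpM2r // exprn_ge0.
Qed.

Lemma tempered_ev_geom a z : tempered a -> cm z < 1 -> exists K s, 0 <= s < 1 /\
  forall n, cm (a n * z ^+ n) <= K * s ^+ n.
Proof.
move=> ta z1; have [K [s [s1 hs]]] := tempered_geom a (cm z) ta ltac:(by rewrite cm_ge0).
by exists K, s; split => // n; rewrite cmM cmX.
Qed.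

Lemma tempered_summable a z : tempered a -> cm z < 1 ->
  exists B, summable (fun n => a n * z ^+ n) B.
Proof.
move=> ta z1; have [K [s [s1 hs]]] := tempered_ev_geom a z ta z1.
by exists (K / (1 - s)); exact: geom_summable.
Qed.

Lemma psum_unif a rho : tempered a -> 0 <= rho < 1 -> exists K s, 0 <= s < 1 /\ 0 <= K /\
  forall M z, cm z <= rho -> cm (ev a z - psum a M z) <= K * s ^+ M.
Proof.
move=> ta r01; have [K [s [s1 hs]]] := tempered_geom a rho ta r01.
have K0 : 0 <= K by have := hs 0%N; rewrite !expr0 !mulr1; apply: le_trans; exact: cm_ge0.
exists (K / (1 - s)), s; split => //; case/andP: (s1) => s0 s1'.
split; first by rewrite divr_ge0 // subr_ge0 ltW.
move=> M z zr; rewrite mulrAC; apply: geom_csum_tail => // n.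
apply: le_trans (hs n); rewrite cmM cmX ler_wpM2l ?cm_ge0 // lerXn2r ?nnegrE ?cm_ge0 //.
by case/andP: r01.
Qed.

Lemma psum_bound a rho : tempered a -> 0 <= rho < 1 -> exists K,
  forall z, cm z <= rho -> cm (ev a z) <= K /\ forall M, cm (psum a M z) <= K.
Proof.
move=> ta r01; have [K [s [s1 hs]]] := tempered_geom a rho ta r01.
exists (K / (1 - s)) => z zr.
have su : summable (fun n => a n * z ^+ n) (K / (1 - s)).
  apply: geom_summable => // n.
  apply: le_trans (hs n); rewrite cmM cmX ler_wpM2l ?cm_ge0 // lerXn2r ?nnegrE ?cm_ge0 //.
  by case/andP: r01.
split; first exact: csum_le.
by move=> M; apply: le_trans (cm_sum _ _ _ _) (su M).
Qed.

(** Once the lower coefficients vanish, evaluation at a small real [t] and the geometric tail bound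
    give [cm (c n) <= 2 * K / rho ^+ n.+1 * t]; then [t] tends to 0. *)
Lemma pseries_eq0 (c : nat -> C) rho K : 0 < rho -> (forall n, cm (c n) * rho ^+ n <= K) ->
  (forall z, cm z < rho -> csum (fun n => c n * z ^+ n) = 0) -> forall n, c n = 0.
Proof.
move=> r0 hK h0; elim/ltn_ind => n IH.
have K0 : 0 <= K by have := hK 0%N; rewrite expr0 mulr1; apply: le_trans; exact: cm_ge0.
have main t : 0 < t -> t <= rho / 2 -> cm (c n) <= 2 * K / rho ^+ n.+1 * t.
  move=> t0 tr; pose z : C := t%:C.
  have cz : cm z = t by rewrite cm_real ger0_norm // ltW.
  have q01 : 0 <= t / rho < 1.
    rewrite divr_ge0 ?ltW //= ltr_pdivrMr // mul1r; lra.
  have hg m : cm (c m * z ^+ m) <= K * (t / rho) ^+ m.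
    rewrite cmM cmX cz expr_div_n mulrA ler_pdivlMr ?exprn_gt0 // mulrAC.
    by rewrite ler_wpM2r // exprn_ge0 // ltW.
  have := geom_csum_tail _ _ _ n.+1 q01 hg.
  rewrite h0 ?cz; last by lra.
  rewrite big_ord_recr /= big1 => [|i _]; last by rewrite IH // mul0r.
  rewrite !add0r cmN cmM cmX cz => H.
  have q2 : 1 / 2 <= 1 - t / rho by rewrite lerBrDr -lerBrDl ler_pdivrMr //; lra.
  have {}H := le_trans H (_ : _ <= K * (t / rho) ^+ n.+1 * 2).
  rewrite -(ler_pM2r (exprn_gt0 n t0)); apply: le_trans (H _) _.
    apply: ler_wpM2l; first by rewrite mulr_ge0 // exprn_ge0 //; case/andP: q01.
    by rewrite -[leRHS]invrK lef_pV2 ?posrE //; lra.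
  by rewrite expr_div_n exprS; rewrite le_eqVlt; apply/orP; left; apply/eqP; field; rewrite expf_neq0 // gt_eqF.
apply: cm_eps0 => e e0.
set L := 2 * K / rho ^+ n.+1 in main.
have L0 : 0 <= L by rewrite divr_ge0 ?mulr_ge0 // exprn_ge0 // ltW.
pose t := Num.min (rho / 2) (e / (L + 1)).
have t0 : 0 < t by rewrite lt_min !divr_gt0 // ltr_wpDl.
apply: le_trans (main t t0 _) _; first by rewrite /t ge_min lexx.
have : t <= e / (L + 1) by rewrite /t ge_min lexx orbT.
rewrite ler_pdivlMr ?ltr_wpDl //; lra.
Qed.

Lemma pseries_unique a b rho Ka Kb : 0 < rho ->
  (forall n, cm (a n) * rho ^+ n <= Ka) -> (forall n, cm (b n) * rho ^+ n <= Kb) ->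
  (forall z, cm z < rho -> ev a z = ev b z) -> a = b.
Proof.
move=> r0 ha hb h; apply/funext => n; apply/eqP; rewrite -subr_eq0; apply/eqP.
apply: (pseries_eq0 (fun n => a n - b n) rho (Ka + Kb)) => // [m|z zr].
  by apply: le_trans (lerD (ha m) (hb m)); rewrite -mulrDl ler_wpM2r ?cmB // exprn_ge0 // ltW.
have q01 : 0 <= cm z / rho < 1.
  by rewrite divr_ge0 ?cm_ge0 ?ltW //= ltr_pdivrMr // mul1r.
have hg (c : nat -> C) K (hc : forall n, cm (c n) * rho ^+ n <= K) m :
    cm (c m * z ^+ m) <= K * (cm z / rho) ^+ m.
  rewrite cmM cmX expr_div_n mulrA ler_pdivlMr ?exprn_gt0 // mulrAC.
  by rewrite ler_wpM2r // exprn_ge0 // cm_ge0.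
have sa := geom_summable _ _ _ q01 (hg _ _ ha).
have sb := geom_summable _ _ _ q01 (hg _ _ hb).
have := csumD _ _ _ _ sa (summableZ _ _ (-1) sb).
rewrite (csumZ _ _ (-1) sb) mulN1r -!/(ev _ z) h // subrr => <-.
by congr csum; apply/funext => m; ring.
Qed.

(** [holo_pseries] gives one expansion per radius; uniqueness on the disk of radius 1/2 identifies
    their coefficients. *)
Lemma holo_coef (f : C -> C) : holomorphic_on_disk f ->
  exists2 a, tempered a & forall z, cm z < 1 -> f z = ev a z.
Proof.
move=> hf.
have h2 : 0 < (2^-1 : R) < 1 by rewrite invr_gt0 ltr0n invf_lt1 ?ltr0n ?ltr1n.
have [a [K [aK fa]]] := holo_pseries f _ hf h2.
have ext r : 2^-1 <= r < 1 -> (exists K, forall n, cm (a n) * r ^+ n <= K) /\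
    forall z, cm z < r -> f z = ev a z.
  move=> /andP[hr r1]; have r0 : 0 < r by lra.
  have [b [K' [bK fb]]] := holo_pseries f r hf ltac:(by rewrite r0).
  suff -> : a = b by split => //; exists K'.
  apply: (pseries_unique a b 2^-1 K K') => //.
    move=> n; apply: le_trans (bK n); rewrite ler_wpM2l ?cm_ge0 // lerXn2r ?nnegrE //; lra.
  by move=> z zr; rewrite -[LHS]fa // -[RHS]fb // (lt_le_trans zr).
exists a => [r /andP[r0 r1]|z z1].
  have [h|h] := leP 2^-1 r; first by have [] := ext r ltac:(by rewrite h).
  exists K => n; apply: le_trans (aK n); rewrite ler_wpM2l ?cm_ge0 // lerXn2r ?nnegrE //; lra.
pose r := Num.max 2^-1 ((1 + cm z) / 2).
have [_] := ext r ltac:(by rewrite /r le_max lexx gt_max; lra).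
by apply; rewrite lt_max; apply/orP; right; lra.
Qed.

(** Second order Taylor remainder of a power. The factor [r ^+ 2] on the left avoids the exponent
    [n - 2]. *)
Lemma expr_taylor2 r z w n : 0 <= r -> cm z <= r -> cm w <= r ->
  r ^+ 2 * cm (w ^+ n - z ^+ n - n%:R * z ^+ n.-1 * (w - z)) <= n%:R ^+ 2 * r ^+ n * cm (w - z) ^+ 2.
Proof.
move=> r0 zr wr; elim: n => [|n IH].
  by rewrite !expr0 !mul0r subrr subr0 cm0 mulr0 expr0n !mul0r.
rewrite (_ : _ - _ = w * (w ^+ n - z ^+ n - n%:R * z ^+ n.-1 * (w - z)) +
   n%:R * z ^+ n.-1 * (w - z) ^+ 2); last first.
  by case: n {IH} => [|n] /=; rewrite -[in LHS]natr1 !exprS; ring.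
have h1 : r ^+ 2 * cm (w * (w ^+ n - z ^+ n - n%:R * z ^+ n.-1 * (w - z))) <=
   n%:R ^+ 2 * r ^+ n.+1 * cm (w - z) ^+ 2.
  rewrite cmM mulrCA (_ : n%:R ^+ 2 * r ^+ n.+1 * _ = r * (n%:R ^+ 2 * r ^+ n * cm (w - z) ^+ 2)).
    by apply: ler_pM; rewrite ?cm_ge0 ?mulr_ge0 ?sqr_ge0 ?cm_ge0.
  by rewrite [r ^+ n.+1]exprS; ring.
have h2 : r ^+ 2 * cm (n%:R * z ^+ n.-1 * (w - z) ^+ 2) <= n%:R * r ^+ n.+1 * cm (w - z) ^+ 2.
  case: n {IH h1} => [|n] /=; first by rewrite !mul0r cm0 mulr0.
  rewrite !(cmX, cmM, cm_nat) (_ : n.+1%:R * r ^+ n.+2 * _ = r ^+ 2 * (n.+1%:R * r ^+ n * cm (w - z) ^+ 2)).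
    rewrite ler_wpM2l ?sqr_ge0 // ler_wpM2r ?sqr_ge0 // ler_wpM2l ?ler0n //.
    by rewrite lerXn2r ?nnegrE ?cm_ge0.
  by rewrite !exprS; ring.
apply: (@le_trans _ _ (r ^+ 2 * (cm (w * (w ^+ n - z ^+ n - n%:R * z ^+ n.-1 * (w - z))) +
   cm (n%:R * z ^+ n.-1 * (w - z) ^+ 2)))).
  by rewrite ler_wpM2l ?sqr_ge0 ?cmD.
rewrite mulrDr; apply: le_trans (lerD h1 h2) _.
rewrite -!mulrDl -[n.+1%:R]natr1 ler_wpM2r ?sqr_ge0 // ler_wpM2r ?exprn_ge0 //.
by rewrite sqrrD1 mulr2n -addrA lerD2l -addrA lerDl addr_ge0.
Qed.

(** [s] is chosen with [r <= s ^+ 4]: of the four factors [s ^+ n], one bounds [a n], two absorb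
    [n ^ 2], and one is left as decay. *)
Lemma tempered_sqr_geom a r : tempered a -> 0 < r < 1 -> exists K s, 0 <= s < 1 /\
  forall n, cm (a n) * (n%:R ^+ 2 * r ^+ n) <= K * s ^+ n.
Proof.
move=> ta /andP[r0 r1]; pose s := 1 - (1 - r) / 4.
have s0 : 0 < s < 1 by rewrite /s; lra.
have s01 : 0 <= s < 1 by move: s0; clear; lra.
have rs : r <= s ^+ 4.
  have s2 : 1 - (1 - r) / 2 <= s ^+ 2.
    by rewrite /s; have := sqr_ge0 (1 - r); rewrite !expr2; lra.
  have t2 : r <= (1 - (1 - r) / 2) ^+ 2 by have := sqr_ge0 (1 - r); rewrite !expr2; lra.
  apply: le_trans t2 _; have -> : s ^+ 4 = (s ^+ 2) ^+ 2 by rewrite -exprM.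
  rewrite lerXn2r ?nnegrE ?sqr_ge0 //; lra.
have [K hK] := ta _ s0.
exists (K * (1 - s)^-1 ^+ 2), s; split => // n.
case/andP: s01 => s01 s11.
have A0 := cm_ge0 (a n).
apply: (@le_trans _ _ ((cm (a n) * s ^+ n) * (n.+1%:R * s ^+ n) ^+ 2 * s ^+ n)); last first.
  apply: ler_wpM2r; first exact: exprn_ge0.
  have i0 : 0 <= (1 - s)^-1 by rewrite invr_ge0 subr_ge0 ltW.
  apply: ler_pM => //; rewrite ?mulr_ge0 ?exprn_ge0 // lerXn2r ?nnegrE ?mulr_ge0 ?exprn_ge0 //.
  by apply: linear_expn_le; rewrite s01.
rewrite (_ : _ * _ * _ ^+ 2 * _ = cm (a n) * (n.+1%:R ^+ 2 * (s ^+ 4) ^+ n)); last first.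
  by rewrite exprMn -!exprM -[(4 * n)%N]/((2 * 2) * n)%N [(n * 2)%N]mulnC; rewrite (_ : (2 * 2 * n = n + 2 * n + n)%N) ?exprD; [ring | lia].
apply: ler_wpM2l => //; apply: ler_pM; rewrite ?sqr_ge0 ?exprn_ge0 ?(ltW r0) //.
  by rewrite lerXn2r ?nnegrE // ler_nat.
by rewrite lerXn2r ?nnegrE ?exprn_ge0 // ltW.
Qed.

(** Zero off the disk, to match the normalization in [Bergman], where elements are genuine functions
    on [C]. *)
Definition Bf a : C -> C := fun z => if cm z < 1 then ev a z else 0.

Lemma BfE a z : cm z < 1 -> Bf a z = ev a z.
Proof. by rewrite /Bf => ->. Qed.

(** Termwise differentiation: summing [expr_taylor2] bounds the remainder by
    [L * cm (w - z) ^+ 2]. *)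
Lemma holo_Bf a : tempered a -> holomorphic_on_disk (Bf a).
Proof.
move=> ta z; rewrite inE /unit_disk /= cm_lt1 => z1.
pose r := (1 + cm z) / 2; have z0 := cm_ge0 z.
have r0 : 0 < r by rewrite /r; lra.
have r1 : r < 1 by rewrite /r; lra.
have zr : cm z < r by rewrite /r; lra.
have [K [s [s1 hs]]] := tempered_sqr_geom a r ta ltac:(by rewrite r0).
have K0 : 0 <= K / (1 - s).
  case/andP: s1 => s0 s1; rewrite divr_ge0 ?subr_ge0 ?(ltW s1) //.
  by have := hs 0%N; rewrite expr0n mul0r mulr0 expr0 mulr1.
have gd n : cm (a n * (n%:R * z ^+ n.-1)) <= r^-1 * K * s ^+ n.
  apply: (@le_trans _ _ (r^-1 * (cm (a n) * (n%:R ^+ 2 * r ^+ n)))); last first.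
    by rewrite -mulrA ler_wpM2l ?invr_ge0 ?(ltW r0).
  case: n => [|n]; first by rewrite mul0r mulr0 cm0 mulr_ge0 ?invr_ge0 ?(ltW r0) // mulr_ge0 ?cm_ge0 // mulr_ge0 ?sqr_ge0 ?exprn_ge0 ?(ltW r0).
  rewrite !(cmM, cmX, cm_nat) [leRHS]mulrCA ler_wpM2l ?cm_ge0 //= [r ^+ n.+1]exprS.
  rewrite (_ : r^-1 * _ = n.+1%:R * (n.+1%:R * r ^+ n)); last by field; rewrite gt_eqF.
  apply: (@le_trans _ _ (1 * (n.+1%:R * r ^+ n))).
    by rewrite mul1r ler_wpM2l ?ler0n // lerXn2r ?nnegrE ?cm_ge0 ?(ltW r0) ?(ltW zr).
  by rewrite ler_wpM2r ?mulr_ge0 ?exprn_ge0 ?(ltW r0) // ler1n.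
exists (csum (fun n => a n * (n%:R * z ^+ n.-1))) => eps e0.
pose L := K / (1 - s) / r ^+ 2.
have L0 : 0 <= L by rewrite divr_ge0 // sqr_ge0.
exists (Num.min (r - cm z) (eps / (L + 1))).
  by rewrite lt_min subr_gt0 zr divr_gt0 // ltr_wpDl.
move=> w; rewrite !cmE -[0]/((0 : R)%:C) !ltcR cm_gt0 subr_eq0 lt_min => /and3P[wz wr we].
have {}wr : cm w <= r.
  rewrite -[w](subrK z); apply: le_trans (cmD _ _) _; move: wr; clear; lra.
have w1 := le_lt_trans wr r1.
rewrite !BfE //.
have [Bz sz] := tempered_summable a z ta z1; have [Bw sw] := tempered_summable a w ta w1.
have sd := geom_summable _ _ _ s1 gd.
have wz0 : w - z != 0 by rewrite subr_eq0.
have key : cm (ev a w - ev a z - csum (fun n => a n * (n%:R * z ^+ n.-1)) * (w - z)) <= L * cm (w - z) ^+ 2.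
  have -> : ev a w - ev a z - csum (fun n => a n * (n%:R * z ^+ n.-1)) * (w - z) =
     csum (fun n => a n * w ^+ n + (-1) * (a n * z ^+ n) + (- (w - z)) * (a n * (n%:R * z ^+ n.-1))).
    rewrite (csumD _ _ _ _ (summableD _ _ _ _ sw (summableZ _ _ (-1) sz)) (summableZ _ _ (- (w - z)) sd)).
    rewrite (csumD _ _ _ _ sw (summableZ _ _ (-1) sz)) (csumZ _ _ _ sz) (csumZ _ _ _ sd).
    by rewrite /ev; move: (csum _) (csum _) (csum _) => x y t; ring.
  apply: csum_le.
  have -> : L * cm (w - z) ^+ 2 = K * (cm (w - z) ^+ 2 / r ^+ 2) / (1 - s).
    have rn : r != 0 by rewrite gt_eqF.
    have sn : 1 - s != 0 by rewrite gt_eqF // subr_gt0; case/andP: s1.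
    by rewrite /L; field; rewrite rn sn.
  apply: geom_summable => // n.
  rewrite (_ : _ + _ = a n * (w ^+ n - z ^+ n - n%:R * z ^+ n.-1 * (w - z))); last by ring.
  rewrite cmM [leRHS](_ : _ = (K * s ^+ n) * (cm (w - z) ^+ 2 / r ^+ 2)); last by ring.
  apply: (@le_trans _ _ (cm (a n) * (n%:R ^+ 2 * r ^+ n) * (cm (w - z) ^+ 2 / r ^+ 2))); last first.
    by rewrite ler_wpM2r // divr_ge0 ?sqr_ge0.
  rewrite -[leRHS]mulrA ler_wpM2l ?cm_ge0 // mulrA ler_pdivlMr ?exprn_gt0 // mulrC.
  by apply: expr_taylor2; rewrite ?(ltW r0) ?(ltW zr).
have -> : (ev a w - ev a z) / (w - z) - csum (fun n => a n * (n%:R * z ^+ n.-1)) =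
   (ev a w - ev a z - csum (fun n => a n * (n%:R * z ^+ n.-1)) * (w - z)) / (w - z) by rewrite [RHS]mulrBl mulfK.
have wzp : 0 < cm (w - z) by rewrite cm_gt0.
rewrite cmM cmV ltr_pdivrMr //; apply: le_lt_trans key _.
rewrite expr2 mulrA ltr_pM2r //.
move: we; rewrite ltr_pdivlMr ?ltr_wpDl //; move: wzp; clear; lra.
Qed.

End PowerSeries.

(** * Square integrability in terms of coefficients *)

Section BergmanCoefficients.
Context {R : realType}.
Notation C := (complex R).
Notation mu := (@lebesgue_measure R).
Notation T1 := (measurableTypeR R).
Notation T2 := (measurableTypeR R * measurableTypeR R)%type.
Notation mu2 := (mu \x mu)%E.
Implicit Types (a b : nat -> C) (z w : C) (r rho B : R).

Lemma cmeas_cvg (D : set T2) (h : nat -> T2 -> C) (u : T2 -> C) :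
  (forall n, cmeas D (h n)) ->
  (forall xy, D xy -> forall e, 0 < e -> exists N : nat, forall n, (N <= n)%N -> cm (u xy - h n xy) < e) ->
  cmeas D u.
Proof.
move=> mh hu; split.
- apply: (@measurable_fun_cvg _ T2 R D (fun n => @complex.Re R \o h n)) => [n|xy Dxy].
    by case: (mh n).
  apply/cvgrPdist_lt => e e0; have [N hN] := hu xy Dxy e e0; exists N => // n /= /hN.
  by apply: le_lt_trans; rewrite -ReB cm_Re.
- apply: (@measurable_fun_cvg _ T2 R D (fun n => @complex.Im R \o h n)) => [n|xy Dxy].
    by case: (mh n).
  apply/cvgrPdist_lt => e e0; have [N hN] := hu xy Dxy e e0; exists N => // n /= /hN.
  by apply: le_lt_trans; rewrite -ImB cm_Im.
Qed.

Lemma cmeas_psum a M (D : set T2) : cmeas D (fun xy => psum a M (toC xy)).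
Proof.
apply: (cmeas_sum D (fun n xy => a n * toC xy ^+ n)) => n.
by apply: cmeasM; [exact: cmeas_cst | apply: cmeasX; exact: cmeas_toC].
Qed.

Lemma cmeas_Bf a rho : tempered a -> 0 <= rho <= 1 -> cmeas (disc rho) (fun xy => Bf a (toC xy)).
Proof.
move=> ta /andP[r0 r1]; apply: (cmeas_cvg _ (fun M xy => psum a M (toC xy))).
  by move=> M; exact: cmeas_psum.
move=> xy /(disc_lt1 _ _ r0) xyr; have xy1 := lt_le_trans xyr r1.
have [B sB] := tempered_summable a _ ta xy1; rewrite BfE //.
exact: csum_cvg sB.
Qed.

Lemma cI_lim (D : set T2) (u : nat -> T2 -> C) (v : T2 -> C) :
  measurable D -> (mu2 D < +oo)%E -> (forall n, nice D (u n)) -> nice D v ->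
  (forall e, 0 < e -> exists N : nat, forall n, (N <= n)%N -> forall xy, D xy -> cm (v xy - u n xy) <= e) ->
  forall e, 0 < e -> exists N : nat, forall n, (N <= n)%N -> cm (cI D v - cI D (u n)) <= e.
Proof.
move=> mD fD nu nv h e e0.
have A0 : 0 <= fine (mu2 D) by apply: fine_ge0.
have c0 : 0 < 2 * fine (mu2 D) + 1 by rewrite ltr_wpDl // mulr_ge0.
have [N hN] := h (e / (2 * fine (mu2 D) + 1)) ltac:(by rewrite divr_gt0).
exists N => n Nn; have {}hN := hN n Nn.
have iv := cint_integrable _ _ mD fD nv; have iu := cint_integrable _ _ mD fD (nu n).
have iu' : cintegrable D (fun xy => -1 * u n xy) by apply: (cIZ _ (-1) _ mD iu).1.
have -> : cI D v - cI D (u n) = cI D (fun xy => v xy + -1 * u n xy).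
  by rewrite (cID _ _ _ mD iv iu').2 (cIZ _ (-1) _ mD iu).2 mulN1r.
apply: le_trans (cI_le D _ (e / (2 * fine (mu2 D) + 1)) mD fD _ _) _.
- apply: cmeasD; first by case: nv.
  by apply: cmeasM; [exact: cmeas_cst|case: (nu n)].
- by move=> z Dz; rewrite mulN1r; exact: hN.
- rewrite mulrAC mulrA ler_pdivrMr // [leRHS]mulrC.
  by apply: ler_wpM2r; rewrite ?(ltW e0) // lerDl.
Qed.

Lemma nice_psum a M rho : 0 <= rho -> nice (disc rho) (fun xy => psum a M (toC xy)).
Proof.
move=> r0; apply: (nice_sum _ (fun n xy => a n * toC xy ^+ n)) => n.
by apply: niceZ; apply: niceX; exact: nice_toC.
Qed.

Lemma nice_Bf a rho : tempered a -> 0 <= rho < 1 -> nice (disc rho) (fun xy => Bf a (toC xy)).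
Proof.
move=> ta /andP[r0 r1]; split; first by apply: cmeas_Bf; rewrite // r0 ltW.
have [K hK] := psum_bound a rho ta ltac:(by rewrite r0).
exists K => xy /(disc_lt1 _ _ r0) xyr; rewrite BfE ?(lt_trans xyr) //.
by case: (hK _ (ltW xyr)).
Qed.

(** The two truncation orders are independent because [cI_Tbar] truncates the two factors
    differently. *)
Lemma prod_approx a b rho : tempered a -> tempered b -> 0 <= rho < 1 ->
  forall e, 0 < e -> exists N : nat, forall M M', (N <= M)%N -> (N <= M')%N ->
  forall xy, disc rho xy ->
    cm (Bf a (toC xy) * conjc (Bf b (toC xy)) -
        psum a M (toC xy) * conjc (psum b M' (toC xy))) <= e.
Proof.
move=> ta tb r01 e e0; case/andP: (r01) => r0 r1.
have [Ka [sa [sa1 [Ka0 ha]]]] := psum_unif a rho ta r01.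
have [Kb [sb [sb1 [Kb0 hb]]]] := psum_unif b rho tb r01.
have [La hLa] := psum_bound a rho ta r01; have [Lb hLb] := psum_bound b rho tb r01.
have La0 : 0 <= La by apply: le_trans (hLa 0 _).1; rewrite ?cm_ge0 ?cm0.
have Lb0 : 0 <= Lb by apply: le_trans (hLb 0 _).1; rewrite ?cm_ge0 ?cm0.
pose ea := e / 2 / (Ka * Lb + 1); pose eb := e / 2 / (Kb * La + 1).
have pa : 0 < Ka * Lb + 1 by rewrite ltr_wpDl // mulr_ge0.
have pb : 0 < Kb * La + 1 by rewrite ltr_wpDl // mulr_ge0.
have [Na hNa] := exprn_lt_eps sa ea sa1 ltac:(by rewrite !divr_gt0).
have [Nb hNb] := exprn_lt_eps sb eb sb1 ltac:(by rewrite !divr_gt0).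
exists (maxn Na Nb) => M M'; rewrite !geq_max => /andP[/hNa Ha _] /andP[_ /hNb Hb].
move=> xy /(disc_lt1 _ _ r0) xyr; rewrite !BfE ?(lt_trans xyr) //.
have {}xyr := ltW xyr; set z := toC xy in xyr *.
have -> : ev a z * conjc (ev b z) - psum a M z * conjc (psum b M' z) =
  (ev a z - psum a M z) * conjc (ev b z) + psum a M z * conjc (ev b z - psum b M' z).
  by rewrite rmorphB /=; ring.
apply: le_trans (cmD _ _) _; rewrite !cmM !cm_conj [e]splitr; apply: lerD.
  apply: (@le_trans _ _ (Ka * sa ^+ M * Lb)).
    by apply: ler_pM; rewrite ?cm_ge0 ?ha //; case: (hLb z xyr).
  rewrite mulrAC; apply: (@le_trans _ _ ((Ka * Lb) * ea)).
    by apply: ler_wpM2l; [rewrite mulr_ge0|exact: ltW].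
  rewrite /ea mulrCA ler_piMr ?divr_ge0 ?(ltW e0) // ler_pdivrMr // mul1r lerDl //.
apply: (@le_trans _ _ (La * (Kb * sb ^+ M'))).
  by apply: ler_pM; rewrite ?cm_ge0 ?hb //; case: (hLa z xyr).
rewrite mulrCA mulrA; apply: (@le_trans _ _ ((Kb * La) * eb)).
  by apply: ler_wpM2l; [rewrite mulr_ge0|exact: ltW].
by rewrite /eb mulrCA ler_piMr ?divr_ge0 ?(ltW e0) // ler_pdivrMr // mul1r lerDl.
Qed.

(** Used with [c = 1] for multiplication by conj(z) and with [c = 0] for inner products. *)
Lemma cI_psum_prod a b M M' rho (c : nat) : 0 <= rho <= 1 ->
  cI (disc rho) (fun xy => conjc (toC xy) ^+ c * (psum a M (toC xy) * conjc (psum b M' (toC xy)))) =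
  \sum_(n < M) \sum_(m < M') a n * conjc (b m) * J rho n (m + c).
Proof.
move=> r01; case/andP: (r01) => r0 r1; have mD := measurable_disc rho; have fD := disc_fin rho r1 r0.
rewrite (_ : (fun xy => _) = fun xy => \sum_(n < M) \sum_(m < M') a n * conjc (b m) * mon n (m + c) (toC xy)).
  have nm n m : nice (disc rho) (fun xy => a n * conjc (b m) * mon n (m + c) (toC xy)).
    by apply: niceZ; exact: nice_mon.
  rewrite (cI_sum _ (fun n xy => \sum_(m < M') a n * conjc (b m) * mon n (m + c) (toC xy))) //.
    apply: eq_bigr => n _.
    rewrite (cI_sum _ (fun m xy => a n * conjc (b m) * mon n (m + c) (toC xy))) //.
    by apply: eq_bigr => m _; rewrite cI_Z //; exact: nice_mon.
  by move=> n; apply: (nice_sum _ (fun m xy => a n * conjc (b m) * mon n (m + c) (toC xy))).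
apply/funext => xy; rewrite /psum rmorph_sum /= mulr_suml mulr_sumr.
apply: eq_bigr => n _; rewrite mulr_sumr mulr_sumr; apply: eq_bigr => m _.
by rewrite /mon exprD rmorphM rmorphXn /=; ring.
Qed.

Lemma eq_of_close (x y : C) : (forall e, 0 < e -> cm (x - y) <= e) -> x = y.
Proof. by move=> h; apply/eqP; rewrite -subr_eq0; apply/eqP/cm_eps0. Qed.

(* Coefficients of T_zbar f when f = \sum a_n z^n. *)
Definition Tbar a : nat -> C := fun n => n.+1%:R / n.+2%:R * a n.+1.

Lemma cm_ratio n : cm (n.+1%:R / n.+2%:R : C) <= 1.
Proof. by rewrite cmM cmV !cm_nat ler_pdivrMr ?ltr0Sn // mul1r ler_nat. Qed.

Lemma tempered_Tbar a : tempered a -> tempered (Tbar a).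
Proof.
move=> ta r /andP[r0 r1]; have [K hK] := ta r ltac:(by rewrite r0); exists (K / r) => n.
rewrite ler_pdivlMr // -mulrA -exprSr; apply: le_trans (hK n.+1).
apply: ler_wpM2r; first by rewrite exprn_ge0 // ltW.
by rewrite /Tbar cmM -[leRHS]mul1r ler_wpM2r ?cm_ge0 // cm_ratio.
Qed.

(* J_dz, summed over the monomials of f and h. *)
Lemma cI_Tbar a b rho : tempered a -> tempered b -> 0 <= rho < 1 ->
  cI (disc rho) (fun xy => conjc (toC xy) * (Bf a (toC xy) * conjc (Bf b (toC xy)))) =
  (rho ^+ 2)%:C * cI (disc rho) (fun xy => Bf (Tbar a) (toC xy) * conjc (Bf b (toC xy))).
Proof.
move=> ta tb r01; case/andP: (r01) => r0 r1; have r01' : 0 <= rho <= 1 by rewrite r0 ltW.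
have mD := measurable_disc rho; have fD := disc_fin rho (ltW r1) r0.
have tT := tempered_Tbar a ta.
have nB c (tc : tempered c) := nice_Bf c rho tc r01.
(* [a] is cut one index later than [b], since [Tbar a] at [n] involves [a] at [n + 1]. *)
pose u M xy := conjc (toC xy) * (psum a M.+1 (toC xy) * conjc (psum b M (toC xy))).
pose v M xy := psum (Tbar a) M (toC xy) * conjc (psum b M (toC xy)).
have nu M : nice (disc rho) (u M).
  apply: niceM; first by apply: nice_conj; exact: nice_toC.
  by apply: niceM; [exact: nice_psum | apply: nice_conj; exact: nice_psum].
have nv M : nice (disc rho) (v M).
  by apply: niceM; [exact: nice_psum | apply: nice_conj; exact: nice_psum].
have uv M : cI (disc rho) (u M) = (rho ^+ 2)%:C * cI (disc rho) (v M).
  have := cI_psum_prod a b M.+1 M rho 1 r01'.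
  under [X in cI _ X]eq_fun do rewrite expr1; rewrite -/(u M) => ->.
  have := cI_psum_prod (Tbar a) b M M rho 0 r01'.
  under [X in cI _ X]eq_fun do rewrite expr0 mul1r; rewrite -/(v M) => ->.
  (* The constant term of [a] drops out: [J_dz] with exponent 0 says that [J rho 0 m.+1]
     vanishes. *)
  rewrite big_ord_recl /= big1 ?add0r => [|m _]; last first.
    have := J_dz rho 0 m r01'; rewrite mul0r mulr0 mul1r addn1 => <-.
    by rewrite mulr0.
  rewrite mulr_sumr; apply: eq_bigr => n _; rewrite mulr_sumr; apply: eq_bigr => m _.
  rewrite addn0 addn1 /= /Tbar /bump /= add1n.
  have := J_dz rho n.+1 m r01'; rewrite /= => E.
  have n2 : (n.+2%:R : C) != 0 by rewrite pnatr_eq0.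
  apply: (mulfI n2); rewrite mulrCA -E; move: (n.+2%:R) n2 => q q0; field.
  by rewrite q0.
pose U xy := conjc (toC xy) * (Bf a (toC xy) * conjc (Bf b (toC xy))).
pose V xy := Bf (Tbar a) (toC xy) * conjc (Bf b (toC xy)).
have nU : nice (disc rho) U.
  apply: niceM; first by apply: nice_conj; exact: nice_toC.
  by apply: niceM; [exact: nB | apply: nice_conj; exact: nB].
have nV : nice (disc rho) V.
  by apply: niceM; [exact: nB | apply: nice_conj; exact: nB].
have lu := cI_lim _ u U mD fD nu nU; have lv := cI_lim _ v V mD fD nv nV.
apply: eq_of_close => e e0; have e20 : 0 < e / 2 by rewrite divr_gt0.
have [|N1 h1] := lu _ _ e20.
  move=> d d0; have [N hN] := prod_approx a b rho ta tb r01 d d0.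
  exists N => n Nn xy Dxy; rewrite /U /u -mulrBr cmM cm_conj -[leRHS]mul1r.
  apply: ler_pM; rewrite ?cm_ge0 ?hN // ?(leqW Nn) //.
  by apply: ltW; rewrite (lt_trans (disc_lt1 _ _ r0 Dxy)).
have [|N2 h2] := lv _ _ e20.
  move=> d d0; have [N hN] := prod_approx (Tbar a) b rho tT tb r01 d d0.
  by exists N => n Nn xy Dxy; rewrite /V /v hN.
have {}h1 := h1 _ (leq_maxl N1 N2); have {}h2 := h2 _ (leq_maxr N1 N2).
rewrite -/U -/V (_ : _ - _ = (cI (disc rho) U - cI (disc rho) (u (maxn N1 N2))) -
  (rho ^+ 2)%:C * (cI (disc rho) V - cI (disc rho) (v (maxn N1 N2)))); last by rewrite uv; ring.
apply: le_trans (cmB _ _) _; rewrite [e]splitr; apply: lerD => //.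
rewrite cmM -[leRHS]mul1r; apply: ler_pM; rewrite ?cm_ge0 // cm_real ger0_norm ?sqr_ge0 //.
by rewrite expr_le1 // ltW.
Qed.

Definition sqint a rho : R := Rintegral mu2 (disc rho) (sqmod (Bf a)).

Lemma sqmodE (f : C -> C) xy : sqmod f xy = cm (f (toC xy)) ^+ 2.
Proof. by rewrite /sqmod cmE -rmorphXn. Qed.

Lemma mulJ (x : C) : x * conjc x = (cm x ^+ 2)%:C.
Proof. by case: x => p q; rewrite cm_sqr; apply/eqP; rewrite eq_complex /=; apply/andP; split; apply/eqP; ring. Qed.

Lemma cI_sq a rho : cI (disc rho) (fun xy => Bf a (toC xy) * conjc (Bf a (toC xy))) =
  sqint a rho +i* Rintegral mu2 (disc rho) (fun=> 0).
Proof.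
rewrite /cI /sqint.
rewrite (_ : @complex.Re R \o _ = sqmod (Bf a)); last first.
  by apply/funext => xy; rewrite sqmodE /= mulJ.
by rewrite (_ : @complex.Im R \o _ = fun=> 0) //; apply/funext => xy; rewrite /= mulJ.
Qed.

Lemma sqint_psum a M rho : 0 < rho <= 1 ->
  cI (disc rho) (fun xy => psum a M (toC xy) * conjc (psum a M (toC xy))) =
  (\sum_(n < M) cm (a n) ^+ 2 / n.+1%:R * rho ^+ (2 * n) * darea rho)%:C.
Proof.
move=> /andP[r0 r1]; have r01 : 0 <= rho <= 1 by rewrite ltW.
have := cI_psum_prod a a M M rho 0 r01.
under [X in cI _ X]eq_fun do rewrite expr0 mul1r; move=> ->.
rewrite rmorph_sum; apply: eq_bigr => n _ /=.
rewrite (bigD1 n) //= big1 ?addr0 => [|m mn].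
  rewrite addn0 J_diag // mulJ -!rmorphM /=; congr (_ %:C).
  by move: (n.+1%:R^-1) => t; ring.
by rewrite addn0 J_offdiag ?mulr0 // eq_sym.
Qed.

Lemma sqint_lim a rho : tempered a -> 0 < rho < 1 -> forall e, 0 < e ->
  exists N : nat, forall M, (N <= M)%N ->
  `|sqint a rho - \sum_(n < M) cm (a n) ^+ 2 / n.+1%:R * rho ^+ (2 * n) * darea rho| <= e.
Proof.
move=> ta /andP[r0 r1] e e0; have r01 : 0 <= rho < 1 by rewrite ltW.
have mD := measurable_disc rho; have fD := disc_fin rho (ltW r1) (ltW r0).
have nB := nice_Bf a rho ta r01.
have [|||N hN] := cI_lim _ (fun M xy => psum a M (toC xy) * conjc (psum a M (toC xy)))
  (fun xy => Bf a (toC xy) * conjc (Bf a (toC xy))) mD fD _ _ _ e e0.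
- by move=> M; apply: niceM; [|apply: nice_conj]; apply: nice_psum; exact: ltW.
- by apply: niceM => //; exact: nice_conj.
- move=> d d0; have [N hN] := prod_approx a a rho ta ta r01 d d0.
  by exists N => n Nn xy; exact: hN.
have r01' : 0 < rho <= 1 by rewrite r0 ltW.
exists N => M /hN; rewrite (sqint_psum a M rho r01') cI_sq; apply: le_trans.
by have := cm_Re ((sqint a rho +i* Rintegral mu2 (disc rho) (fun=> 0)) -
  (\sum_(n < M) cm (a n) ^+ 2 / n.+1%:R * rho ^+ (2 * n) * darea rho)%:C).
Qed.

Lemma darea_ge0 rho : 0 <= darea rho.
Proof. exact: fine_ge0. Qed.

Lemma disc_sub (r1 r2 : R) : 0 <= r1 <= r2 -> disc r1 `<=` disc r2.
Proof.
move=> /andP[r0 r12] xy; rewrite /disc /= => /lt_le_trans; apply.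
by rewrite lerXn2r ?nnegrE // (le_trans r0).
Qed.

Lemma darea_le (r1 r2 : R) : 0 <= r1 <= r2 -> r2 <= 1 -> darea r1 <= darea r2.
Proof.
move=> /andP[r0 r12] r21; have r20 := le_trans r0 r12.
apply: fine_le; rewrite ?ge0_fin_numE ?measure_ge0 ?disc_fin // ?(le_trans r12) //.
apply: le_measure; rewrite ?inE; try exact: measurable_disc.
by apply: disc_sub; rewrite r0.
Qed.

Lemma darea_gt0 : 0 < darea (2^-1 : R).
Proof.
have sub : `[0, 4^-1] `*` `[0, 4^-1] `<=` disc (2^-1 : R).
  move=> [x y]; rewrite /disc /= !in_itv /= => -[/andP[x0 x1] /andP[y0 y1]].
  have hx : x ^+ 2 <= 4^-1 ^+ 2 by rewrite lerXn2r ?nnegrE ?invr_ge0.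
  have hy : y ^+ 2 <= 4^-1 ^+ 2 by rewrite lerXn2r ?nnegrE ?invr_ge0.
  by move: hx hy; rewrite !expr2; clear; lra.
have h0 : (0 : R) <= 2^-1 by rewrite invr_ge0.
have h1 : (2^-1 : R) <= 1 by rewrite invf_le1 ?ler1n.
have fD := disc_fin _ h1 h0.
have : (mu2 (`[0%R, 4^-1%R] `*` `[0%R, 4^-1%R]) <= mu2 (disc 2^-1))%E.
  have mq : (measurable : set (set T2)) (`[0%R, 4^-1%R] `*` `[0%R, 4^-1%R]).
    by apply: measurableX.
  by apply: (@le_measure _ _ T2 mu2); rewrite ?inE //; exact: measurable_disc.
rewrite [X in (X <= _)%E](_ : _ = (mu `[0%R, 4^-1%R] * mu `[0%R, 4^-1%R])%E); last exact: product_measure1E.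
have q0 : (0 : R) < 4^-1 by rewrite invr_gt0.
rewrite lebesgue_measure_itv /= lte_fin q0 -EFinD -EFinM subr0 => H.
rewrite /darea -lte_fin fineK ?ge0_fin_numE ?measure_ge0 //.
by apply: lt_le_trans H; rewrite lte_fin mulr_gt0.
Qed.

Lemma measurable_sqmod a rho : tempered a -> 0 <= rho <= 1 ->
  measurable_fun (disc rho) (sqmod (Bf a)).
Proof.
move=> ta r01; have [h1 h2] := cmeas_Bf a rho ta r01.
rewrite (_ : sqmod (Bf a) = fun xy => ((@complex.Re R \o (fun xy => Bf a (toC xy))) xy) ^+ 2 +
   ((@complex.Im R \o (fun xy => Bf a (toC xy))) xy) ^+ 2).
  by apply: measurable_funD; apply: measurable_funX.
by apply/funext => xy; rewrite sqmodE cm_sqr.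
Qed.

Lemma sqmod_integrable a rho : tempered a -> 0 <= rho < 1 ->
  mu2.-integrable (disc rho) (EFin \o sqmod (Bf a)).
Proof.
move=> ta r01; case/andP: (r01) => r0 r1.
have mD := measurable_disc rho; have fD := disc_fin rho (ltW r1) r0.
have [_ [B hB]] := nice_Bf a rho ta r01.
apply: measurable_bounded_integrable => //.
  by apply: measurable_sqmod => //; rewrite r0 ltW.
exists (B ^+ 2); split; first exact: num_real.
move=> x Bx z Dz; rewrite /= sqmodE ger0_norm ?sqr_ge0 //.
by apply: le_trans (ltW Bx); rewrite lerXn2r ?nnegrE ?cm_ge0 ?hB // (le_trans (cm_ge0 _) (hB z Dz)).
Qed.

Lemma sqint_le a rho B : wle a B -> 0 < rho < 1 -> sqint a rho <= B * darea 1.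
Proof.
move=> wB /andP[r0 r1]; have ta := wle_tempered _ _ wB.
apply: real_le_eps => e e0; have [N hN] := sqint_lim a rho ta ltac:(by rewrite r0) e e0.
have := hN N (leqnn N); rewrite ler_norml => /andP[_ H].
have B0 := wle_ge0 _ _ wB.
have : \sum_(n < N) cm (a n) ^+ 2 / n.+1%:R * rho ^+ (2 * n) * darea rho <= B * darea 1.
  apply: (@le_trans _ _ (wsum a N * darea 1)); last by rewrite ler_wpM2r ?darea_ge0.
  rewrite /wsum mulr_suml; apply: ler_sum => n _.
  have c0 : 0 <= cm (a n) ^+ 2 / n.+1%:R by rewrite divr_ge0 ?sqr_ge0.
  have q0 : 0 <= rho ^+ (2 * n) by rewrite exprn_ge0 // ltW.
  apply: ler_pM (mulr_ge0 c0 q0) (darea_ge0 _) _ _.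
    by rewrite ler_piMr // exprn_ile1 ?ltW.
  by apply: darea_le; rewrite // ?(ltW r0) ?(ltW r1).
by move: H; clear; lra.
Qed.

(** Radii in [1/2, 1[ increasing to 1. On [disc (rr n)] the functions [Bf a] are bounded, and
    integrals over the unit disk are limits of integrals over these disks. *)
Definition rr (n : nat) : R := 1 - n.+2%:R^-1.

Lemma rr_bnd n : 2^-1 <= rr n < 1.
Proof.
rewrite /rr gtrBl invr_gt0 ltr0Sn andbT lerBrDr -lerBrDl (_ : 1 - 2^-1 = 2^-1); last by lra.
by rewrite lef_pV2 ?posrE ?ltr0Sn // ler_nat.
Qed.

Lemma rr_lim (x : R) : x < 1 -> exists N : nat, forall n, (N <= n)%N -> x < rr n.
Proof.
move=> x1; have e0 : 0 < 1 - x by rewrite subr_gt0.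
have /cvgrPdist_lt /(_ _ e0)[N _ hN] := @cvg_harmonic R.
exists N => n Nn; have := hN n.+1 (leqW Nn); rewrite /= sub0r normrN ger0_norm ?invr_ge0 //.
by rewrite /rr ltrBrDr addrC -ltrBrDr.
Qed.

Lemma rr_mono n m : (n <= m)%N -> rr n <= rr m.
Proof. by move=> nm; rewrite /rr lerD2l lerN2 lef_pV2 ?posrE ?ltr0Sn // ler_nat !ltnS. Qed.

Lemma bigcup_disc : \bigcup_n disc (rr n) = disc 1.
Proof.
apply/seteqP; split => [xy [n _]|xy].
  have /andP[h1 h2] := rr_bnd n.
  by apply: disc_sub; rewrite (ltW h2) andbT (le_trans _ h1) // invr_ge0.
move=> /(disc_lt1 _ _ ler01) /rr_lim[N hN]; exists N => //.
have := hN N (leqnn N); have /andP[h1 h2] := rr_bnd N.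
rewrite /disc /= => H; have := cm_sqr (toC xy); rewrite /toC /= => <-.
by rewrite ltrXn2r // ?cm_ge0 // nnegrE (le_trans _ h1) // invr_ge0.
Qed.

Lemma disc1E : disc 1 = @disk2 R.
Proof. by rewrite /disc /disk2 expr1n. Qed.

Lemma nd_disc : nondecreasing_seq (fun n => disc (rr n)).
Proof.
move=> n m nm; apply/subsetPset; apply: disc_sub; rewrite rr_mono // andbT.
by have /andP[h1 _] := rr_bnd n; rewrite (le_trans _ h1) // invr_ge0.
Qed.

Lemma rr01 n : 0 < rr n < 1.
Proof. by have /andP[h1 ->] := rr_bnd n; rewrite (lt_le_trans _ h1) // invr_gt0. Qed.

(** Monotone convergence along [disc (rr n)], with the uniform bound [sqint_le]. *)
Lemma Bf_bergman a B : wle a B -> Bergman (Bf a) /\ Rintegral mu2 (disc 1) (sqmod (Bf a)) <= B * darea 1.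
Proof.
move=> wB; have ta := wle_tempered _ _ wB.
have r11 : (0 : R) <= (1 : R) <= 1 by apply/andP; split; [exact: ler01|exact: lexx].
have ms := measurable_sqmod a 1 ta r11.
have ms' n : measurable_fun (disc (rr n)) (sqmod (Bf a)).
  by apply: measurable_sqmod => //; have /andP[/ltW -> /ltW ->] := rr01 n.
have sq0 xy : (0 <= (sqmod (Bf a) xy)%:E)%E by rewrite lee_fin sqmodE sqr_ge0.
have lim := @ge0_nondecreasing_set_cvg_integral _ T2 R (fun n => disc (rr n))
  (fun xy => (sqmod (Bf a) xy)%:E) mu2 nd_disc (fun n => measurable_disc _)
  (fun n => (measurable_EFinP _ _).2 (ms' n)) (fun n xy _ => sq0 xy).
rewrite bigcup_disc in lim.
have le1 : (\int[mu2]_(xy in disc 1) (sqmod (Bf a) xy)%:E <= (B * darea 1)%:E)%E.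
  apply: (cvge_le _ lim); apply: nearW => n /=.
  have /andP[n0 n1] := rr01 n.
  have int := sqmod_integrable a (rr n) ta ltac:(by rewrite (ltW n0)).
  rewrite -(fineK (integrable_fin_num (measurable_disc _) int)) lee_fin.
  by apply: sqint_le => //; rewrite n0.
have ge : (0 <= \int[mu2]_(xy in disc 1) (sqmod (Bf a) xy)%:E)%E by exact: integral_ge0.
split; last first.
  rewrite /Rintegral -lee_fin fineK // ge0_fin_numE //.
  by apply: le_lt_trans le1 _; rewrite ltry.
split; first by move=> z; rewrite inE /unit_disk /= cm_lt1 /Bf; case: ifP.
split; first exact: holo_Bf.
rewrite -disc1E; apply/integrableP; split.
  by apply/measurable_EFinP.
under eq_integral do rewrite gee0_abs //.
by apply: le_lt_trans le1 _; rewrite ltry.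
Qed.

(** A common lower bound of [darea rho] for [rho >= 1/2]. Using it loses a constant factor in the
    comparison of norms, which does not affect boundedness of operators. *)
Definition kap : R := darea (2^-1).

Lemma bernoulli_pow (r : R) n : 0 <= r <= 1 -> 1 - n%:R * (1 - r) <= r ^+ n.
Proof.
move=> /andP[r0 r1]; elim: n => [|n IH]; first by rewrite mul0r subr0 expr0.
rewrite exprS; apply: (@le_trans _ _ (r * (1 - n%:R * (1 - r)))); last by rewrite ler_wpM2l.
rewrite -natr1; have : 0 <= n%:R * (1 - r) * (1 - r) by rewrite !mulr_ge0 ?ler0n ?subr_ge0.
by move: (n%:R : R); clear; move=> t; nra.
Qed.

(** Converse of [Bf_bergman] up to a constant. For a fixed number of coefficients, integration over
    a smaller disk gives [wsum a M * rho ^+ (2 * M) * kap <= S]; then [rho] tends to 1. *)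
Lemma bergman_coef (f : C -> C) : Bergman f ->
  exists a, [/\ f = Bf a, tempered a & wle a (Rintegral mu2 (disc 1) (sqmod f) / kap)].
Proof.
move=> [f0 [hf fi]]; have [a ta fa] := holo_coef f hf; exists a.
have fE : f = Bf a.
  apply/funext => z; rewrite /Bf; case: ifP => z1; first exact: fa.
  by apply: f0; rewrite inE /unit_disk /= cm_lt1 z1.
split => //; rewrite fE in fi *; rewrite -disc1E in fi; set S := Rintegral _ _ _.
have k0 : 0 < kap := darea_gt0.
have sq0 xy : (0 <= (sqmod (Bf a) xy)%:E)%E by rewrite lee_fin sqmodE sqr_ge0.
have step M (rho : R) : 2^-1 <= rho < 1 -> wsum a M * rho ^+ (2 * M) <= S / kap.
  move=> /andP[hr r1]; have r0 : 0 < rho by rewrite (lt_le_trans _ hr) // invr_gt0.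
  rewrite ler_pdivlMr //; apply: real_le_eps => e e0.
  have [N hN] := sqint_lim a rho ta ltac:(by rewrite r0) e e0.
  have := hN _ (leq_maxl N M); rewrite ler_norml => /andP[H _].
  have SS : sqint a rho <= S.
    apply: fine_le; rewrite ?integrable_fin_num //.
    - exact: measurable_disc.
    - by apply: sqmod_integrable => //; rewrite ltW.
    - exact: measurable_disc.
    apply: ge0_subset_integral => //; try exact: measurable_disc.
      by apply/measurable_EFinP; apply: measurable_sqmod; rewrite // ler01 lexx.
    by apply: disc_sub; rewrite !ltW.
  have : wsum a M * rho ^+ (2 * M) * kap <=
     \sum_(n < maxn N M) cm (a n) ^+ 2 / n.+1%:R * rho ^+ (2 * n) * darea rho.
    rewrite -(subnKC (leq_maxr N M)) big_split_ord /=; apply: (@le_trans _ _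
      (\sum_(n < M) cm (a n) ^+ 2 / n.+1%:R * rho ^+ (2 * n) * darea rho)).
      rewrite /wsum !mulr_suml; apply: ler_sum => n _.
      have c0 : 0 <= cm (a n) ^+ 2 / n.+1%:R by rewrite divr_ge0 ?sqr_ge0.
      have q0 : 0 <= rho ^+ (2 * M) by rewrite exprn_ge0 // ltW.
      apply: ler_pM (mulr_ge0 c0 q0) (ltW k0) _ _.
        apply: ler_wpM2l => //.
        by apply: ler_wiXn2l; rewrite ?(ltW r0) ?(ltW r1) // leq_mul2l /= ltnW.
      by apply: darea_le; rewrite ?invr_ge0 ?hr // ltW.
    rewrite lerDl; apply: sumr_ge0 => n _.
    by rewrite !mulr_ge0 ?divr_ge0 ?sqr_ge0 ?exprn_ge0 ?cm_ge0 ?invr_ge0 ?ler0n ?darea_ge0 ?(ltW r0).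
  by move: H SS; clear; lra.
have S0 : 0 <= S by apply: fine_ge0; apply: integral_ge0.
move=> M; apply: real_le_eps => e e0.
have W0 : 0 <= wsum a M by apply: sumr_ge0 => n _; rewrite divr_ge0 ?sqr_ge0.
pose L := wsum a M * (2 * M)%:R.
have L0 : 0 <= L by rewrite mulr_ge0.
(* By Bernoulli's inequality the loss [wsum a M * (1 - rho ^+ (2 * M))] is at most
   [(1 - rho) * L <= e]. *)
pose rho : R := 1 - Num.min 2^-1 (e / (L + 1)).
have m0 : 0 < Num.min 2^-1 (e / (L + 1)) :> R.
  by rewrite lt_min invr_gt0 ltr0n divr_gt0 // ltr_wpDl.
have m1 : Num.min 2^-1 (e / (L + 1)) <= 2^-1 :> R by rewrite ge_min lexx.
have m2 : Num.min 2^-1 (e / (L + 1)) <= e / (L + 1) :> R by rewrite ge_min lexx orbT.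
have rb : 2^-1 <= rho < 1 by rewrite /rho; move: m0 m1; clear; lra.
have H := step M rho rb.
have B := bernoulli_pow rho (2 * M) ltac:(move: rb; clear; lra).
have H2 := ler_wpM2l W0 B.
have H3 : (1 - rho) * L <= e.
  rewrite /rho opprB addrC subrK; move: m2; rewrite ler_pdivlMr ?ltr_wpDl //.
  by move: m0; clear; lra.
rewrite mulrBr mulr1 mulrA -/L in H2.
by move: H H2 H3; rewrite [L * _]mulrC; clear; lra.
Qed.

End BergmanCoefficients.

(** * Toeplitz operators on coefficients *)

Section ToeplitzCoefficients.
Context {R : realType}.
Notation C := (complex R).
Notation mu := (@lebesgue_measure R).
Notation T1 := (measurableTypeR R).
Notation T2 := (measurableTypeR R * measurableTypeR R)%type.
Notation mu2 := (mu \x mu)%E.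
Implicit Types (a b : nat -> C) (z w : C) (r rho B : R).

Lemma Rint_lim_ge0 (g : T2 -> R) : mu2.-integrable (disc 1) (EFin \o g) ->
  (forall xy, 0 <= g xy) -> forall e, 0 < e -> exists N : nat, forall n, (N <= n)%N ->
  `|Rintegral mu2 (disc 1) g - Rintegral mu2 (disc (rr n)) g| < e.
Proof.
move=> gi g0 e e0.
have sub n : disc (rr n) `<=` disc (1 : R).
  by apply: disc_sub; have /andP[/ltW -> /ltW ->] := rr01 (R := R) n.
have gin n : mu2.-integrable (disc (rr n)) (EFin \o g).
  by apply: (integrableS _ _ (sub n) gi); exact: measurable_disc.
have lim := @ge0_nondecreasing_set_cvg_integral _ T2 R (fun n => disc (rr n))
  (fun xy => (g xy)%:E) mu2 nd_disc (fun n => measurable_disc _)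
  (fun n => measurable_int _ (gin n)) (fun n xy _ => g0 xy).
rewrite bigcup_disc -(fineK (integrable_fin_num (measurable_disc _) gi)) in lim.
have L : Rintegral mu2 (disc (rr n)) g @[n --> \oo] --> (Rintegral mu2 (disc 1) g : R).
  exact: (fine_cvg lim).
by move/cvgrPdist_lt: L => /(_ _ e0)[N _ hN]; exists N => n /hN.
Qed.

(** [g] is the difference of the nonnegative functions [g + |g|] and [|g|], to which monotone
    convergence applies. *)
Lemma Rint_lim (g : T2 -> R) : mu2.-integrable (disc 1) (EFin \o g) ->
  forall e, 0 < e -> exists N : nat, forall n, (N <= n)%N ->
  `|Rintegral mu2 (disc 1) g - Rintegral mu2 (disc (rr n)) g| < e.
Proof.
move=> gi e e0.
have sub n : disc (rr n) `<=` disc (1 : R).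
  by apply: disc_sub; have /andP[/ltW -> /ltW ->] := rr01 (R := R) n.
have iS (u : T2 -> R) n : mu2.-integrable (disc 1) (EFin \o u) -> mu2.-integrable (disc (rr n)) (EFin \o u).
  by apply: (integrableS _ _ (sub n)); exact: measurable_disc.
have ni : mu2.-integrable (disc 1) (EFin \o (fun xy => `|g xy|)) by exact: (integrable_norm gi).
have pi : mu2.-integrable (disc 1) (EFin \o (g \+ (fun xy => `|g xy|))).
  exact: (integrableD (measurable_disc _) gi ni).
have e2 : 0 < e / 2 by rewrite divr_gt0.
have [N1 h1] := Rint_lim_ge0 _ ni (fun xy => normr_ge0 _) _ e2.
have [N2 h2] := Rint_lim_ge0 _ pi ltac:(by move=> xy /=; rewrite addrC -lerBlDr sub0r -normrN ler_norm) _ e2.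
exists (maxn N1 N2) => n; rewrite geq_max => /andP[/h1 + /h2].
rewrite !RintegralD //; try exact: measurable_disc; try exact: iS.
by rewrite !ltr_norml; move: (Rintegral _ _ _) (Rintegral _ _ _) (Rintegral _ _ _) (Rintegral _ _ _); clear; move=> ? ? ? ?; lra.
Qed.

Lemma cI_lim_disc (u : T2 -> C) : cintegrable (disc 1) u -> forall e, 0 < e ->
  exists N : nat, forall n, (N <= n)%N -> cm (cI (disc 1) u - cI (disc (rr n)) u) <= e.
Proof.
move=> [h1 h2] e e0; have e2 : 0 < e / 2 by rewrite divr_gt0.
have [N1 l1] := Rint_lim _ h1 _ e2; have [N2 l2] := Rint_lim _ h2 _ e2.
exists (maxn N1 N2) => n; rewrite geq_max => /andP[/l1 k1 /l2 k2].
apply: le_trans (cm_le_ReIm _) _; rewrite [e]splitr; apply: lerD; apply: ltW.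
  exact: k1.
exact: k2.
Qed.

Lemma cintegrable_dom (D : set T2) (u : T2 -> C) (G : T2 -> R) : measurable D -> cmeas D u ->
  mu2.-integrable D (EFin \o G) -> (forall xy, D xy -> cm (u xy) <= G xy) -> cintegrable D u.
Proof.
move=> mD [m1 m2] Gi h; split; apply: (le_integrable mD _ _ Gi).
- exact/measurable_EFinP.
- move=> xy Dxy; rewrite /= lee_fin; apply: le_trans (cm_Re _) _.
  by apply: le_trans (h _ Dxy) _; exact: ler_norm.
- exact/measurable_EFinP.
- move=> xy Dxy; rewrite /= lee_fin; apply: le_trans (cm_Im _) _.
  by apply: le_trans (h _ Dxy) _; exact: ler_norm.
Qed.

Lemma Bergman_integrable (f : C -> C) : Bergman f -> mu2.-integrable (disc 1) (EFin \o sqmod f).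
Proof. by move=> [_ [_]]; rewrite -disc1E. Qed.

Lemma cmeas1 a : tempered a -> cmeas (disc 1) (fun xy => Bf a (toC xy)).
Proof. by move=> ta; apply: cmeas_Bf => //; apply/andP; split; [exact: ler01|exact: lexx]. Qed.

Lemma cintegrable_prod a b B B' : wle a B -> wle b B' ->
  cintegrable (disc 1) (fun xy => Bf a (toC xy) * conjc (Bf b (toC xy))).
Proof.
move=> wa wb; have [/Bergman_integrable ia _] := Bf_bergman _ _ wa.
have [/Bergman_integrable ib _] := Bf_bergman _ _ wb.
apply: (cintegrable_dom _ _ (sqmod (Bf a) \+ sqmod (Bf b))).
- exact: measurable_disc.
- by apply: cmeasM; [|apply: cmeas_conj]; apply: cmeas1; exact: wle_tempered.
- exact: (integrableD (measurable_disc _) ia ib).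
- move=> xy _ /=; rewrite !sqmodE cmM cm_conj.
  move: (cm_ge0 (Bf a (toC xy))) (cm_ge0 (Bf b (toC xy))); move: (cm _) (cm _) => s t; clear.
  by have := sqr_ge0 (s - t); nra.
Qed.

Lemma wle_Tbar a B : wle a B -> wle (Tbar a) B.
Proof.
move=> wa M; apply: le_trans (wa M.+1); rewrite /wsum big_ord_recl /=.
rewrite -[leLHS]add0r; apply: lerD; first by rewrite divr_ge0 ?sqr_ge0.
apply: ler_sum => n _; rewrite /bump /= add1n /Tbar !cmM cmV !cm_nat !exprMn.
set t := cm _ ^+ 2; have t0 : 0 <= t by exact: sqr_ge0.
rewrite (_ : _ / n.+1%:R = t / n.+2%:R * (n.+1%:R / n.+2%:R)); last first.
  have h1 : (n.+1%:R : R) != 0 by rewrite pnatr_eq0.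
  have h2 : (n.+2%:R : R) != 0 by rewrite pnatr_eq0.
  by move: (n.+1%:R) (n.+2%:R) h1 h2 => p q p0 q0; field; rewrite p0 q0.
by rewrite ler_piMr ?divr_ge0 // ler_pdivrMr ?ltr0Sn // mul1r ler_nat.
Qed.

(** Orthogonality of conj(z) f - T_zbar f to the Bergman space: the limit of [cI_Tbar] along
    [disc (rr n)], whose factor [rho ^+ 2] tends to 1. *)
Lemma cI_Tbar1 a b B B' : wle a B -> wle b B' ->
  cintegrable (disc 1) (fun xy => (conjc (toC xy) * Bf a (toC xy) - Bf (Tbar a) (toC xy)) * conjc (Bf b (toC xy))) /\
  cI (disc 1) (fun xy => (conjc (toC xy) * Bf a (toC xy) - Bf (Tbar a) (toC xy)) * conjc (Bf b (toC xy))) = 0.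
Proof.
move=> wa wb; have wT := wle_Tbar _ _ wa.
have ta := wle_tempered _ _ wa; have tb := wle_tempered _ _ wb; have tT := wle_tempered _ _ wT.
have mD := measurable_disc (1 : R).
have i1 := cintegrable_prod a b _ _ wa wb; have i2 := cintegrable_prod _ b _ _ wT wb.
have i3 : cintegrable (disc 1) (fun xy => conjc (toC xy) * (Bf a (toC xy) * conjc (Bf b (toC xy)))).
  have [/Bergman_integrable ia _] := Bf_bergman _ _ wa.
  have [/Bergman_integrable ib _] := Bf_bergman _ _ wb.
  apply: (cintegrable_dom _ _ (sqmod (Bf a) \+ sqmod (Bf b)) mD).
  - apply: cmeasM; first by apply: cmeas_conj; exact: cmeas_toC.
    by apply: cmeasM; [|apply: cmeas_conj]; apply: cmeas1; exact: wle_tempered.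
  - exact: (integrableD (measurable_disc _) ia ib).
  - move=> xy Dxy; have -> : (sqmod (Bf a) \+ sqmod (Bf b)) xy = sqmod (Bf a) xy + sqmod (Bf b) xy by [].
    rewrite !sqmodE !cmM !cm_conj.
    have := disc_lt1 _ _ ler01 Dxy.
    move: (cm_ge0 (toC xy)) (cm_ge0 (Bf a (toC xy))) (cm_ge0 (Bf b (toC xy))).
    move: (cm (toC xy)) (cm (Bf a (toC xy))) (cm (Bf b (toC xy))) => q s t; clear => q0 s0 t0 q1.
    have st : 0 <= s * t by rewrite mulr_ge0.
    have : q * (s * t) <= s * t by rewrite ler_piMl // ltW.
    by have := sqr_ge0 (s - t); nra.
set X := fun xy => Bf (Tbar a) (toC xy) * conjc (Bf b (toC xy)) in i2.
set Y := fun xy => conjc (toC xy) * (Bf a (toC xy) * conjc (Bf b (toC xy))) in i3.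
rewrite (_ : (fun xy => (_ - _) * _) = fun xy => Y xy + -1 * X xy); last first.
  by apply/funext => xy; rewrite /X /Y; ring.
have i2' := (cIZ _ (-1) _ mD i2).1; have := cID _ _ _ mD i3 i2'; move=> [i4 e4]; split => //.
rewrite e4 (cIZ _ (-1) _ mD i2).2 mulN1r; apply/eqP; rewrite subr_eq0; apply/eqP.
apply: eq_of_close => e e0.
have e3 : 0 < e / 3 by rewrite divr_gt0.
have [N1 h1] := cI_lim_disc _ i2 _ e3; have [N2 h2] := cI_lim_disc _ i3 _ e3.
pose K := cm (cI (disc 1) X); have K0 : 0 <= K := cm_ge0 _.
(* Chosen so that [1 - rr n ^+ 2 <= 2 * (1 - rr n)] is at most [e / 3 / (K + e / 3)], while the
   integral of [X] over [disc (rr n)] is at most [K + e / 3]. *)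
have [N3 h3] := rr_lim (1 - e / 3 / (2 * (K + e / 3))) ltac:(by rewrite gtrBl !divr_gt0 // mulr_gt0 // ltr_wpDl).
pose n := (N1 + N2 + N3)%N.
have {}h1 : cm (cI (disc 1) X - cI (disc (rr n)) X) <= e / 3 by apply: h1; rewrite /n; lia.
have {}h2 : cm (cI (disc 1) Y - cI (disc (rr n)) Y) <= e / 3 by apply: h2; rewrite /n; lia.
have {}h3 : 1 - e / 3 / (2 * (K + e / 3)) < rr n by apply: h3; rewrite /n; lia.
have /andP[r0 r1] := rr01 (R := R) n.
have E := cI_Tbar a b (rr n) ta tb ltac:(by rewrite (ltW r0)).
rewrite -/X -/Y in E.
rewrite (_ : _ - _ = (cI (disc 1) Y - cI (disc (rr n)) Y) - (cI (disc 1) X - cI (disc (rr n)) X) +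
   ((rr n ^+ 2)%:C - 1) * cI (disc (rr n)) X); last first.
  by rewrite E; move: (cI _ _) (cI _ _) (cI _ _) => p q s; ring.
apply: le_trans (cmD _ _) _; have := cmB (cI (disc 1) Y - cI (disc (rr n)) Y) (cI (disc 1) X - cI (disc (rr n)) X).
have h5 : cm (((rr n ^+ 2)%:C - 1) * cI (disc (rr n)) X) <= e / 3.
  rewrite cmM -[1]/((1 : R)%:C) -rmorphB cm_real.
  have kx : cm (cI (disc (rr n)) X) <= K + e / 3.
    rewrite (_ : cI (disc (rr n)) X = cI (disc 1) X - (cI (disc 1) X - cI (disc (rr n)) X)); last by rewrite opprB addrC subrK.
    by apply: le_trans (cmB _ _) _; rewrite lerD2l.
  have kp : 0 < K + e / 3 by rewrite ltr_wpDl.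
  rewrite ler0_norm; last by rewrite subr_le0 expr_le1 ?ltW.
  apply: (@le_trans _ _ (e / 3 / (K + e / 3) * (K + e / 3))); last by rewrite divfK ?gt_eqF.
  apply: ler_pM => //; rewrite ?cm_ge0 ?oppr_ge0 ?subr_le0 ?expr_le1 ?(ltW r0) ?(ltW r1) //.
  have hh : e / 3 / (2 * (K + e / 3)) = e / 3 / (K + e / 3) / 2.
    by rewrite invfM mulrCA mulrC.
  rewrite hh in h3; move: (e / 3 / (K + e / 3)) h3 => t h3.
  by move: (rr n) r0 r1 h3; clear; move=> r r0 r1 h; nra.
move: h1 h2 h5; move: (cm _) (cm _) (cm _) (cm _); clear => p q s t; lra.
Qed.

Lemma wle_sub_le a b B : (forall n, cm (a n) <= cm (b n)) -> wle b B -> wle a B.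
Proof.
move=> h wb M; apply: le_trans (wb M); apply: ler_sum => n _.
by rewrite ler_wpM2r ?invr_ge0 // lerXn2r ?nnegrE ?cm_ge0.
Qed.

Lemma wleD a b B B' : wle a B -> wle b B' -> wle (fun n => a n + b n) (2 * (B + B')).
Proof.
move=> wa wb M; apply: (@le_trans _ _ (2 * (wsum a M + wsum b M))); last first.
  by rewrite ler_wpM2l // lerD.
rewrite -big_split mulr_sumr /=; apply: ler_sum => n _; rewrite -mulrDl mulrA.
rewrite ler_wpM2r ?invr_ge0 //; apply: (@le_trans _ _ ((cm (a n) + cm (b n)) ^+ 2)).
  by rewrite lerXn2r ?nnegrE ?addr_ge0 ?cm_ge0 ?cmD.
by have := sqr_ge0 (cm (a n) - cm (b n)); move: (cm _) (cm _); clear => s t; nra.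
Qed.

Lemma wleZ c a B : wle a B -> wle (fun n => c * a n) (cm c ^+ 2 * B).
Proof.
move=> wa M; apply: le_trans (ler_wpM2l (sqr_ge0 _) (wa M)); rewrite mulr_sumr.
rewrite le_eqVlt; apply/orP; left; apply/eqP/eq_bigr => n _.
by rewrite cmM exprMn -mulrA.
Qed.

Definition W a := exists B, wle a B.

Lemma WD a b : W a -> W b -> W (fun n => a n + b n).
Proof. by move=> [B wa] [B' wb]; exists (2 * (B + B')); exact: wleD. Qed.

Lemma WZ c a : W a -> W (fun n => c * a n).
Proof. by move=> [B wa]; eexists; exact: wleZ wa. Qed.

Lemma WB a b : W a -> W b -> W (fun n => a n - b n).
Proof.
move=> wa wb; rewrite (_ : (fun n => _) = fun n => a n + -1 * b n); last by apply/funext => n; rewrite mulN1r.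
by apply: WD => //; exact: WZ.
Qed.

Lemma W_tempered a : W a -> tempered a.
Proof. by move=> [B]; exact: wle_tempered. Qed.

Lemma W_summable a z : W a -> cm z < 1 -> exists B, summable (fun n => a n * z ^+ n) B.
Proof. by move=> /W_tempered wa z1; exact: tempered_summable. Qed.

Definition shiftr a : nat -> C := fun n => if n is m.+1 then a m else 0.

Lemma wle_shiftr a B : wle a B -> wle (shiftr a) B.
Proof.
move=> wa M; apply: le_trans (wa M).
case: M => [|M]; first by rewrite /wsum !big_ord0.
rewrite /wsum big_ord_recl big_ord_recr /= cm0 expr0n mul0r add0r.
apply: (@le_trans _ _ (\sum_(n < M) cm (a n) ^+ 2 / n.+1%:R)); last first.
  by rewrite lerDl divr_ge0 ?sqr_ge0.
apply: ler_sum => n _; rewrite /bump /= add1n ler_wpM2l ?sqr_ge0 //.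
by rewrite lef_pV2 ?posrE ?ltr0Sn // ler_nat.
Qed.

Lemma ev_shiftr a z : W a -> cm z < 1 -> ev (shiftr a) z = z * ev a z.
Proof.
move=> wa z1; have [B sB] := W_summable _ _ wa z1.
have [B' sB'] : exists B', summable (fun n => shiftr a n * z ^+ n) B'.
  by apply: W_summable => //; case: wa => K /wle_shiftr; exists K.
rewrite /ev (csumS _ _ sB') /= mul0r add0r -(csumZ _ _ z sB); congr csum.
by apply/funext => n; rewrite exprS mulrCA.
Qed.

Lemma evD a b z : W a -> W b -> cm z < 1 -> ev (fun n => a n + b n) z = ev a z + ev b z.
Proof.
move=> wa wb z1; have [B sB] := W_summable _ _ wa z1; have [B' sB'] := W_summable _ _ wb z1.
by rewrite /ev -(csumD _ _ _ _ sB sB'); congr csum; apply/funext => n; rewrite mulrDl.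
Qed.

Lemma evZ c a z : W a -> cm z < 1 -> ev (fun n => c * a n) z = c * ev a z.
Proof.
move=> wa z1; have [B sB] := W_summable _ _ wa z1.
by rewrite /ev -(csumZ _ _ c sB); congr csum; apply/funext => n; rewrite mulrA.
Qed.

Definition conv a b : nat -> C := fun n => \sum_(i < n.+1) a i * b (n - i)%N.
Definition pconv (P : {poly C}) := conv (fun i => P`_i).

Lemma pconv_cons (P : {poly C}) c a : pconv (P * 'X + c%:P) a =
  fun n => c * a n + shiftr (pconv P a) n.
Proof.
apply/funext => n; rewrite /pconv /conv big_ord_recl /= coefD coefMX coefC /= add0r subn0; congr (_ + _).
case: n => [|n]; first by rewrite big_ord0.
by apply: eq_bigr => i _; rewrite /bump /= add1n coefD coefMX coefC /= addr0 subSS.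
Qed.

Lemma pconv0 a : pconv 0 a = fun=> 0.
Proof. by apply/funext => n; rewrite /pconv /conv big1 // => i _; rewrite coef0 mul0r. Qed.

Lemma W0 : W (fun=> 0).
Proof. by exists 0 => M; rewrite /wsum big1 // => i _; rewrite cm0 expr0n mul0r. Qed.

Lemma W_shiftr a : W a -> W (shiftr a).
Proof. by move=> [B wa]; exists B; exact: wle_shiftr. Qed.

Lemma W_pconv P a : W a -> W (pconv P a).
Proof.
move=> wa; elim/poly_ind: P => [|P c IH]; first by rewrite pconv0; exact: W0.
by rewrite pconv_cons; apply: WD; [exact: WZ | exact: W_shiftr].
Qed.

Lemma ev_pconv (P : {poly C}) a z : W a -> cm z < 1 -> ev (pconv P a) z = P.[z] * ev a z.
Proof.
move=> wa z1; elim/poly_ind: P => [|P c IH].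
  rewrite pconv0 horner0 mul0r; have E := evZ 0 _ z wa z1; rewrite mul0r in E; rewrite -[RHS]E.
  by rewrite /ev; congr csum; apply/funext => n; rewrite !mul0r.
have wP := W_pconv P _ wa.
rewrite pconv_cons evD //; [|exact: WZ|exact: W_shiftr].
by rewrite evZ // ev_shiftr // IH hornerMXaddC; ring.
Qed.

Lemma Bf_inj a b : W a -> W b -> Bf a = Bf b -> a = b.
Proof.
move=> /W_tempered ta /W_tempered tb h.
have h2 : 0 < (2^-1 : R) < 1 by rewrite invr_gt0 ltr0n invf_lt1 ?ltr0n ?ltr1n.
have [Ka ha] := ta _ h2; have [Kb hb] := tb _ h2; case/andP: h2 => h20 h21.
apply: (pseries_unique a b 2^-1 Ka Kb) => // z z2; have z1 := lt_trans z2 h21.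
by have := congr1 (fun F => F z) h; rewrite !BfE.
Qed.

Lemma BfB a b z : W a -> W b -> Bf (fun n => a n - b n) z = Bf a z - Bf b z.
Proof.
move=> wa wb; rewrite /Bf; case: ifP => z1; last by rewrite subr0.
rewrite (_ : (fun n => a n - b n) = fun n => a n + -1 * b n); last by apply/funext => n; rewrite mulN1r.
by rewrite evD ?evZ ?mulN1r //; exact: WZ.
Qed.

Lemma innerE (u v : C -> C) : inner u v = (pi^-1)%:C * cI (disc 1) (fun xy => u (toC xy) * conjc (v (toC xy))).
Proof.
rewrite /inner /cintegral /cI disc1E; apply/eqP; rewrite eq_complex /=.
by rewrite !mul0r subr0 addr0; apply/andP; split; apply/eqP.
Qed.

Section Symbol.
Variable P : {poly C}.
Let phi (z : C) : C := conjc z + P.[z].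

Definition Top a : nat -> C := fun n => Tbar a n + pconv P a n.

Lemma W_Top a : W a -> W (Top a).
Proof. by move=> wa; apply: WD; [case: wa => B /wle_Tbar; exists B | exact: W_pconv]. Qed.

Lemma phi_Bf a xy : W a -> disc 1 xy ->
  phi (toC xy) * Bf a (toC xy) - Bf (Top a) (toC xy) =
  conjc (toC xy) * Bf a (toC xy) - Bf (Tbar a) (toC xy).
Proof.
move=> wa /(disc_lt1 _ _ ler01) z1; rewrite !BfE // /Top evD //.
- by rewrite ev_pconv // /phi; ring.
- by case: wa => B /wle_Tbar; exists B.
- exact: W_pconv.
Qed.

Lemma cI_eq (D : set T2) (u v : T2 -> C) : (forall xy, D xy -> u xy = v xy) -> cI D u = cI D v.
Proof.
move=> h; rewrite /cI; congr (_ +i* _); rewrite /Rintegral; congr fine; apply: eq_integral => xy;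
  by rewrite inE => /h /= ->.
Qed.

Lemma is_toeplitz_Bf a : W a -> is_toeplitz_image phi (Bf a) (Bf (Top a)).
Proof.
move=> wa; have [B wT] := W_Top _ wa; split; first by case: (Bf_bergman _ _ wT).
move=> h /bergman_coef[b [-> tb wb]]; case: (wa) => B1 wa1.
rewrite innerE (cI_eq _ _ (fun xy =>
  (conjc (toC xy) * Bf a (toC xy) - Bf (Tbar a) (toC xy)) * conjc (Bf b (toC xy)))).
  by rewrite (cI_Tbar1 a b _ _ wa1 wb).2 mulr0.
by move=> xy Dxy; rewrite -phi_Bf.
Qed.

Lemma wle0_eq0 a : wle a 0 -> a = fun=> 0.
Proof.
move=> w; apply/funext => n; apply/eqP; rewrite -cm_eq0 -sqrf_eq0 eq_le sqr_ge0 andbT.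
by have := wle_coef _ _ n w; rewrite mul0r.
Qed.

(** The difference [d] of two candidates lies in the space and is orthogonal to it; testing against
    [d] itself gives norm 0. *)
Lemma toeplitz_unique a g : W a -> is_toeplitz_image phi (Bf a) g -> g = Bf (Top a).
Proof.
move=> wa [/bergman_coef[b [-> tb wb]] hg]; have wT := W_Top _ wa.
pose d n := Top a n - b n.
have Wb : W b by eexists; exact: wb.
have wd : W d by exact: WB.
case: (wd) => Bd wd'; have [bd _] := Bf_bergman _ _ wd'.
have := hg _ bd; rewrite innerE; case: (wa) => B1 wa1.
have [i1 E] := cI_Tbar1 a d _ _ wa1 wd'.
rewrite (cI_eq _ _ (fun xy => (conjc (toC xy) * Bf a (toC xy) - Bf (Tbar a) (toC xy)) * conjc (Bf d (toC xy)) +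
    Bf d (toC xy) * conjc (Bf d (toC xy)))); last first.
  by move=> xy Dxy; rewrite -phi_Bf // {2}/d BfB //; ring.
have id2 := cintegrable_prod _ _ _ _ wd' wd'.
rewrite (cID _ _ _ (measurable_disc _) i1 id2).2 E add0r cI_sq => /eqP.
rewrite mulf_eq0 (_ : (pi^-1)%:C == 0 = false) /=; last first.
  by rewrite eq_complex /= eqxx andbT invr_eq0 gt_eqF // pi_gt0.
rewrite eq_complex /= => /andP[/eqP s0 _].
have [c [Ec tc wc]] := bergman_coef _ bd.
rewrite -/(sqint d 1) s0 mul0r in wc.
have c0 := wle0_eq0 _ wc.
have d0 : d = c by apply: Bf_inj => //; exists 0.
congr Bf; apply/funext => n; have := congr1 (fun F => F n) d0; rewrite c0 /d => /eqP.
by rewrite subr_eq0 => /eqP.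
Qed.

(** Existence and uniqueness pin down the value returned by the choice operator in [Toeplitz]. *)
Lemma Toeplitz_Bf a : W a -> Toeplitz phi (Bf a) = Bf (Top a).
Proof.
move=> wa; apply: toeplitz_unique => //.
by apply: ClassicalEpsilon.epsilon_spec; exists (Bf (Top a)); exact: is_toeplitz_Bf.
Qed.

(* The coefficient sequence of (T_phi - lam) f. *)
Definition Lop (lam : C) a : nat -> C := fun n => Top a n - lam * a n.

Lemma W_Lop lam a : W a -> W (Lop lam a).
Proof. by move=> wa; apply: WB; [exact: W_Top | exact: WZ]. Qed.

Lemma Toeplitz_shift_Bf lam a : W a -> Toeplitz_shift phi lam (Bf a) = Bf (Lop lam a).
Proof.
move=> wa; apply/funext => z; rewrite /Toeplitz_shift Toeplitz_Bf // /Lop BfB; [|exact: W_Top|exact: WZ].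
by rewrite /Bf; case: ifP => z1; rewrite ?evZ // mulr0.
Qed.

Lemma bnormE (f : C -> C) : bnorm f = Num.sqrt (pi^-1 * Rintegral mu2 (disc 1) (sqmod f)).
Proof. by rewrite /bnorm disc1E. Qed.

Lemma Rint_sqmod_ge0 (f : C -> C) : 0 <= Rintegral mu2 (disc 1) (sqmod f).
Proof. by apply: fine_ge0; apply: integral_ge0 => xy _; rewrite lee_fin sqmodE sqr_ge0. Qed.

(** [S] is transported to functions by choosing coefficient sequences. Its bound concerns squared
    norms, hence the square root; [kap] and [darea 1] come from the two-sided norm comparison. *)
Lemma invertible_coef lam (S : (nat -> C) -> nat -> C) (M : R) :
  (forall a B, wle a B -> wle (S a) (M * B)) ->
  (forall a, W a -> Lop lam (S a) = a) -> (forall a, W a -> S (Lop lam a) = a) ->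
  invertible_on_Bergman (Toeplitz_shift phi lam).
Proof.
move=> hS h1 h2.
have WS a : W a -> W (S a) by move=> [B wa]; exists (M * B); exact: hS.
pose coef (f : C -> C) : nat -> C :=
  ClassicalEpsilon.epsilon (inhabits (fun _ : nat => 0)) (fun a => W a /\ f = Bf a).
have coefP f : Bergman f -> W (coef f) /\ f = Bf (coef f).
  move=> /bergman_coef[a [fa _ wa]]; apply: (ClassicalEpsilon.epsilon_spec _ (fun a => W a /\ f = Bf a)).
  by exists a; split => //; eexists; exact: wa.
have coefB a : W a -> coef (Bf a) = a.
  move=> wa; case: (wa) => B /Bf_bergman[/coefP[w1 e1] _].
  by apply: Bf_inj => //; rewrite -e1.
exists (fun f => Bf (S (coef f))); split; [|split; [|split]].
- by move=> f /coefP[/WS[B w] _]; case: (Bf_bergman _ _ w).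
- by move=> f /coefP[w ->]; rewrite coefB // Toeplitz_shift_Bf ?h1 //; exact: WS.
- by move=> f /coefP[w ->]; rewrite Toeplitz_shift_Bf // coefB ?h2 //; exact: W_Lop.
- exists (Num.sqrt (`|M| / kap * darea 1)) => f bf; have [a [fa _ wa]] := bergman_coef _ bf.
  have Wa : W a by eexists; exact: wa.
  rewrite fa coefB // -fa !bnormE -sqrtrM; last first.
    by rewrite mulr_ge0 ?divr_ge0 ?darea_ge0.
  apply: ler_wsqrtr; rewrite [leRHS]mulrCA; apply: ler_wpM2l; first by rewrite invr_ge0 pi_ge0.
  have [_ H] := Bf_bergman _ _ (hS _ _ wa); apply: le_trans H _.
  rewrite [leRHS]mulrAC ler_wpM2r ?darea_ge0 // [M * _]mulrA -[leRHS]mulrA [_^-1 * _]mulrC mulrA.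
  by rewrite ler_wpM2r ?invr_ge0 ?darea_ge0 // ler_wpM2r ?Rint_sqmod_ge0 // ler_norm.
Qed.

(** The two consequences used against invertibility: kernel elements and roots on the circle
    contradict the lower bound, two inner roots contradict surjectivity. *)
Lemma coef_invertible lam : invertible_on_Bergman (Toeplitz_shift phi lam) ->
  (exists M : R, forall a B, W a -> wle (Lop lam a) B -> wle a (M * B)) /\
  (forall b, W b -> exists2 a, W a & Lop lam a = b).
Proof.
move=> [S [bS [h1 [h2 [M hM]]]]]; split.
  exists (M ^+ 2 * darea 1 / kap) => a B wa wB.
  case: (wa) => Ba wBa; have [ba _] := Bf_bergman _ _ wBa; have [bL HL] := Bf_bergman _ _ wB.
  have := hM _ bL; rewrite -Toeplitz_shift_Bf // h2 // Toeplitz_shift_Bf // !bnormE => H.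
  have [c [Ec tc wc]] := bergman_coef _ ba.
  have ac : a = c by apply: Bf_inj => //; eexists; exact: wc.
  rewrite -ac in wc; move=> N; apply: le_trans (wc N) _.
  have k0 : 0 < kap :> R := darea_gt0.
  rewrite mulrAC ler_wpM2r ?invr_ge0 ?(ltW k0) //.
  rewrite -(ler_pM2l (_ : 0 < pi^-1)) ?invr_gt0 ?pi_gt0 //.
  have p0 f : 0 <= pi^-1 * Rintegral mu2 (disc 1) (sqmod f) by rewrite mulr_ge0 ?invr_ge0 ?pi_ge0 ?Rint_sqmod_ge0.
  rewrite -[leLHS]sqr_sqrtr //.
  apply: (@le_trans _ _ ((M * Num.sqrt (pi^-1 * Rintegral mu2 (disc 1) (sqmod (Bf (Lop lam a))))) ^+ 2)).
    by rewrite lerXn2r ?nnegrE ?sqrtr_ge0 // (le_trans _ H) ?sqrtr_ge0.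
  rewrite exprMn sqr_sqrtr // mulrCA ler_wpM2l ?invr_ge0 ?pi_ge0 //.
  by rewrite -[leRHS]mulrA ler_wpM2l ?sqr_ge0 // [leRHS]mulrC.
move=> b [B wb]; have [bb _] := Bf_bergman _ _ wb.
have [a [Ea ta wa]] := bergman_coef _ (bS _ bb); exists a; first by eexists; exact: wa.
apply: Bf_inj; [by apply: W_Lop; eexists; exact: wa|by exists B|].
by rewrite -Toeplitz_shift_Bf -?Ea ?h1 //; eexists; exact: wa.
Qed.

End Symbol.
End ToeplitzCoefficients.

(** * Formal power series *)

(** A separate name for sequences carries the Cauchy product as ring structure, so that the
    manipulations of the differential operator become [ring] identities. *)
Definition fps (K : comNzRingType) : Type := nat -> K.

Section FormalPowerSeries.
Context {K : comNzRingType}.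
Implicit Types (a b c : fps K) (p q : {poly K}).

HB.instance Definition _ := gen_eqMixin (fps K).
HB.instance Definition _ := gen_choiceMixin (fps K).

Definition fps0 : fps K := fun=> 0.
Definition fps_add a b : fps K := fun n => a n + b n.
Definition fps_opp a : fps K := fun n => - a n.

Fact fps_addA : associative fps_add.
Proof. by move=> a b c; apply/funext => n; rewrite /fps_add addrA. Qed.
Fact fps_addC : commutative fps_add.
Proof. by move=> a b; apply/funext => n; rewrite /fps_add addrC. Qed.
Fact fps_add0 : left_id fps0 fps_add.
Proof. by move=> a; apply/funext => n; rewrite /fps_add add0r. Qed.
Fact fps_addN : left_inverse fps0 fps_opp fps_add.
Proof. by move=> a; apply/funext => n; rewrite /fps_add addNr. Qed.

HB.instance Definition _ := GRing.isZmodule.Build (fps K) fps_addA fps_addC fps_add0 fps_addN.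

Definition fp p : fps K := fun n => p`_n.
Definition fps_mul a b : fps K := fun n => \sum_(i < n.+1) a i * b (n - i)%N.

(** A coefficient of a product depends on truncations only, so the ring axioms and the Leibniz rule
    are inherited from polynomials. *)
Lemma fps_mul_poly a b p q n : (forall i, (i <= n)%N -> a i = p`_i) ->
  (forall i, (i <= n)%N -> b i = q`_i) -> fps_mul a b n = (p * q)`_n.
Proof.
move=> ha hb; rewrite coefM; apply: eq_bigr => -[i /= ilt] _.
by rewrite ha ?hb // leq_subr.
Qed.

Lemma trunc_coef a m n i : (i <= n)%N -> (n < m)%N -> a i = (\poly_(j < m) a j)`_i.
Proof. by move=> il nm; rewrite coef_poly (leq_ltn_trans il nm). Qed.

Fact fps_mulA : associative fps_mul.
Proof.
move=> a b c; apply/funext => n.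
pose T (u : fps K) := \poly_(j < n.+1) u j.
have hT u i : (i <= n)%N -> u i = (T u)`_i by move=> il; exact: trunc_coef (leqnn _).
rewrite (fps_mul_poly _ _ (T a) (T b * T c)) //; last first.
- by move=> i il; apply: fps_mul_poly => j jl; apply: hT; exact: leq_trans jl il.
- by move=> i; exact: hT.
rewrite (fps_mul_poly _ _ (T a * T b) (T c)) ?mulrA //.
- by move=> i il; apply: fps_mul_poly => j jl; apply: hT; exact: leq_trans jl il.
- by move=> i; exact: hT.
Qed.

Fact fps_mulC : commutative fps_mul.
Proof.
move=> a b; apply/funext => n; pose T (u : fps K) := \poly_(j < n.+1) u j.
have hT u i : (i <= n)%N -> u i = (T u)`_i by move=> il; exact: trunc_coef (leqnn _).
by rewrite (fps_mul_poly _ _ (T a) (T b)) ?(fps_mul_poly _ _ (T b) (T a)) 1?mulrC // => i; exact: hT.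
Qed.

Definition fps1 : fps K := fp 1.

Fact fps_mul1 : left_id fps1 fps_mul.
Proof.
move=> a; apply/funext => n; rewrite (fps_mul_poly _ _ 1 (\poly_(j < n.+1) a j)) //.
  by rewrite mul1r coef_poly ltnSn.
by move=> i il; exact: trunc_coef (leqnn _).
Qed.

Fact fps_mulD : left_distributive fps_mul fps_add.
Proof.
move=> a b c; apply/funext => n; rewrite /fps_mul /fps_add -big_split.
by apply: eq_bigr => i _; rewrite mulrDl.
Qed.

Fact fps_neq0 : fps1 != 0.
Proof. by apply/eqP => /(congr1 (fun u => u 0%N))/eqP; rewrite /fps1 /fp coef1 oner_eq0. Qed.

HB.instance Definition _ :=
  GRing.Zmodule_isComNzRing.Build (fps K) fps_mulA fps_mulC fps_mul1 fps_mulD fps_neq0.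

Lemma fpsM a b n : (a * b) n = \sum_(i < n.+1) a i * b (n - i)%N. Proof. by []. Qed.
Lemma fpsD a b n : (a + b) n = a n + b n. Proof. by []. Qed.
Lemma fpsN a n : (- a) n = - a n. Proof. by []. Qed.
Lemma fps0E n : (0 : fps K) n = 0. Proof. by []. Qed.
Lemma fps1E n : (1 : fps K) n = (n == 0%N)%:R. Proof. by rewrite -[LHS]/(1%:P`_n) coef1. Qed.
Lemma fpsM0 a b : (a * b) 0%N = a 0%N * b 0%N.
Proof. by rewrite fpsM big_ord_recl big_ord0 addr0. Qed.

Lemma fp1 : fp 1 = 1. Proof. by []. Qed.
Lemma fp0 : fp 0 = 0. Proof. by apply/funext => n; rewrite /fp coef0. Qed.
Lemma fpD p q : fp (p + q) = fp p + fp q. Proof. by apply/funext => n; rewrite /fp coefD. Qed.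
Lemma fpM p q : fp (p * q) = fp p * fp q. Proof. by apply/funext => n; rewrite /fp coefM. Qed.

Definition dfs a : fps K := fun n => n.+1%:R * a n.+1.

Lemma dfsD a b : dfs (a + b) = dfs a + dfs b.
Proof. by apply/funext => n; rewrite /dfs !fpsD mulrDr. Qed.

Lemma dfsM a b : dfs (a * b) = dfs a * b + a * dfs b.
Proof.
apply/funext => n; pose T (u : fps K) := \poly_(j < n.+2) u j.
have hT u i : (i <= n.+1)%N -> u i = (T u)`_i by move=> il; exact: trunc_coef (leqnn _).
have hD u i : (i <= n)%N -> dfs u i = (T u)^`()`_i.
  by move=> il; rewrite /dfs coef_deriv mulr_natl (hT u).
rewrite /dfs -[LHS]/(n.+1%:R * fps_mul a b n.+1) (fps_mul_poly _ _ (T a) (T b)); try exact: hT.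
rewrite mulr_natl -coef_deriv derivM coefD.
rewrite -[RHS]/(fps_mul (dfs a) b n + fps_mul a (dfs b) n); congr (_ + _); apply/esym/fps_mul_poly => i il;
  by rewrite ?hD // hT // leqW.
Qed.

End FormalPowerSeries.

(** * Series of geometric decay as multipliers of the weighted spaces *)

Section GeometricDecay.
Context {R : realType}.
Notation C := (complex R).
Implicit Types (a b : fps C) (z w : C) (r s t B : R).

Lemma dfs_eq0 a : dfs a = 0 -> a = fun n => if n is 0 then a 0%N else 0.
Proof.
move=> h; apply/funext => -[//|n]; have := congr1 (fun u => u n) h; rewrite /dfs fps0E => /eqP.
by rewrite mulf_eq0 pnatr_eq0 /= => /eqP.
Qed.

(** Coefficients of functions analytic beyond the closed unit disk. They act boundedly by
    multiplication, see [geo_W] and [geo_V]. *)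
Definition geo a := exists K s, [/\ 0 <= K, 0 < s < 1 & forall n, cm (a n) <= K * s ^+ n].

Lemma sq_mid s : 0 <= s < 1 -> let t := (1 + s) / 2 in [/\ 0 < t < 1, s < t & s <= t ^+ 2].
Proof.
move=> /andP[s0 s1] t; rewrite /t; split; [lra|lra|].
by have := sqr_ge0 (1 - s); rewrite !expr2; clear; nra.
Qed.

(** Since [s <= t ^+ 2], one factor [t ^+ n] absorbs [n.+1] and the other remains. *)
Lemma absorb s : 0 <= s < 1 -> let t := (1 + s) / 2 in forall n, n.+1%:R * s ^+ n <= (1 - t)^-1 * t ^+ n.
Proof.
move=> s01 t n; have [/andP[t0 t1] _ st] := sq_mid s s01; rewrite -/t in t0 t1 st *.
apply: (@le_trans _ _ ((n.+1%:R * t ^+ n) * t ^+ n)).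
  rewrite -mulrA ler_wpM2l // -exprMn -expr2 lerXn2r ?nnegrE ?sqr_ge0 //.
  by case/andP: s01.
by rewrite ler_wpM2r ?exprn_ge0 ?(ltW t0) // linear_expn_le // (ltW t0).
Qed.

Lemma geoM a b : geo a -> geo b -> geo (a * b).
Proof.
move=> [K [s [K0 /andP[s0 s1] ha]]] [K' [s' [K'0 /andP[s'0 s'1] hb]]].
pose m := Num.max s s'; have m0 : 0 < m by rewrite lt_max s0.
have m1 : m < 1 by rewrite gt_max s1.
have [t01 _ _] := sq_mid m ltac:(by rewrite ltW).
exists (K * K' * (1 - (1 + m) / 2)^-1), ((1 + m) / 2); split => //.
  by rewrite !mulr_ge0 // invr_ge0 subr_ge0 ltW //; case/andP: t01.
move=> n; rewrite fpsM; apply: le_trans (cm_sum _ _ _ _) _.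
apply: (@le_trans _ _ (K * K' * (n.+1%:R * m ^+ n))); last first.
  rewrite -[leRHS]mulrA; apply: ler_wpM2l; first by rewrite mulr_ge0.
  by apply: absorb; rewrite ltW.
rewrite -[n.+1 in X in _ <= X]card_ord -sum1_card natr_sum mulr_suml mulr_sumr.
apply: ler_sum => -[i /= ilt] _; rewrite mul1r cmM -[in X in _ <= X](subnKC (_ : i <= n)%N) // exprD mulrACA.
have ms : s <= m by rewrite le_max lexx.
have ms' : s' <= m by rewrite le_max lexx orbT.
apply: ler_pM; rewrite ?cm_ge0 //.
  by apply: le_trans (ha i) _; rewrite ler_wpM2l // lerXn2r ?nnegrE ?(ltW s0) ?(ltW m0).
by apply: le_trans (hb _) _; rewrite ler_wpM2l // lerXn2r ?nnegrE ?(ltW s'0) ?(ltW m0).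
Qed.

Lemma geo_fp (P : {poly C}) : geo (fp P).
Proof.
exists (\sum_(i < size P) cm P`_i * 2 ^+ i), (2^-1); split.
- by apply: sumr_ge0 => i _; rewrite mulr_ge0 ?cm_ge0 ?exprn_ge0.
- by rewrite invr_gt0 ltr0n invf_lt1 ?ltr0n ?ltr1n.
move=> n; rewrite /fp; have [nP|nP] := ltnP n (size P); last first.
  rewrite nth_default // cm0 mulr_ge0 ?exprn_ge0 ?invr_ge0 //.
  by apply: sumr_ge0 => i _; rewrite mulr_ge0 ?cm_ge0 ?exprn_ge0.
rewrite exprVn ler_pdivlMr ?exprn_gt0 // (bigD1 (Ordinal nP)) //= lerDl.
by apply: sumr_ge0 => i _; rewrite mulr_ge0 ?cm_ge0 ?exprn_ge0.
Qed.

Lemma geo1 : geo (1 : fps C).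
Proof. by rewrite -fp1; exact: geo_fp. Qed.

Lemma geo_inv_lin (x : C) : 1 < cm x -> exists2 u, geo u & fp ('X - x%:P) * u = 1.
Proof.
move=> x1; have x0 : x != 0 by rewrite -cm_gt0; apply: lt_trans x1.
have cx : 0 < cm x by rewrite cm_gt0.
exists (fun n => - (x^-1) ^+ n.+1).
  exists ((cm x)^-1), ((cm x)^-1); split; first by rewrite invr_ge0 ltW.
    by rewrite invr_gt0 cx invf_lt1.
  by move=> n; rewrite cmN cmX cmV exprS.
apply/funext => n; rewrite fps1E fpsM big_ord_recl /fp /= coefB coefX coefC /= sub0r subn0.
case: n => [|n]; first by rewrite big_ord0 addr0 expr1 mulrNN mulfV.
rewrite big_ord_recl big1 => [|i _]; last first.
  by rewrite /bump /= !add1n coefB coefX coefC subr0 mul0r.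
by rewrite /bump /= add1n coefB coefX coefC /= subr0 mul1r addr0 subSS subn0 mulrNN [x^-1 ^+ n.+2]exprS mulrA mulfV // mul1r subrr.
Qed.

Lemma geo_inv_prod (rs : seq C) : all (fun x => 1 < cm x) rs ->
  exists2 u, geo u & fp (\prod_(x <- rs) ('X - x%:P)) * u = 1.
Proof.
elim: rs => [|x rs IH] /=; first by move=> _; exists 1; [exact: geo1|rewrite big_nil fp1 mulr1].
move=> /andP[/geo_inv_lin[u gu hu] /IH[v gv hv]]; exists (u * v); first exact: geoM.
by rewrite big_cons fpM mulrACA hu hv mulr1.
Qed.

Section Exponential.
Variable s1 : fps C.

(** Course-of-values recursion for the solution of E' = s1 E with E(0) = 1: a new coefficient needs
    all previous ones, hence a list. *)
Fixpoint exp_list n : seq C :=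
  if n is m.+1 then rcons (exp_list m) (\sum_(i < m.+1) s1 i * (exp_list m)`_(m - i) / m.+1%:R)
  else [:: 1].

Definition exp_coef : fps C := fun n => (exp_list n)`_n.

Lemma size_exp_list n : size (exp_list n) = n.+1.
Proof. by elim: n => //= n IH; rewrite size_rcons IH. Qed.

Lemma nth_exp_list m n : (n <= m)%N -> (exp_list m)`_n = exp_coef n.
Proof.
elim: m => [|m IH]; first by rewrite leqn0 => /eqP ->.
rewrite leq_eqVlt ltnS => /orP[/eqP -> //|nm] /=.
by rewrite nth_rcons size_exp_list ltnS nm IH.
Qed.

Lemma exp_coefS n : n.+1%:R * exp_coef n.+1 = (s1 * exp_coef) n.
Proof.
rewrite /exp_coef /= nth_rcons size_exp_list ltnn eqxx fpsM mulr_sumr.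
apply: eq_bigr => i _; rewrite nth_exp_list ?leq_subr //.
by rewrite mulrC divfK // pnatr_eq0.
Qed.

Lemma dfs_exp : dfs exp_coef = s1 * exp_coef.
Proof. by apply/funext => n; rewrite -exp_coefS. Qed.

Lemma exp_coef0 : exp_coef 0%N = 1. Proof. by []. Qed.

(** Any rate [t] between [s] and 1 works. In the recursion the division by the index beats the
    constant [L = K / (t - s)] from [n0] on, and [Cc] covers the coefficients up to [n0]. *)
Lemma geo_exp : geo s1 -> geo exp_coef.
Proof.
move=> [K [s [K0 /andP[s0 s1'] hs]]].
have [/andP[t0 t1] st _] := sq_mid s ltac:(by rewrite ltW).
set t := (1 + s) / 2 in t0 t1 st; clearbody t.
pose L := K / (t - s); have L0 : 0 <= L by rewrite divr_ge0 // subr_ge0 ltW.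
have [n0 Ln0] : exists n0 : nat, L <= n0%:R.
  by exists (Num.trunc L).+1; apply: ltW; have /andP[] := truncn_itv L0.
pose Cc := \sum_(m < n0.+1) cm (exp_coef m) / t ^+ m.
have Cc0 : 0 <= Cc by apply: sumr_ge0 => m _; rewrite divr_ge0 ?cm_ge0 ?exprn_ge0 // ltW.
exists Cc, t; split; [by []|by rewrite t0|].
elim/ltn_ind => n IH; have [nn0|] := leqP n n0.
  rewrite -ler_pdivrMr ?exprn_gt0 // /Cc (bigD1 (Ordinal (_ : n < n0.+1)%N)) //= lerDl.
  by apply: sumr_ge0 => m _; rewrite divr_ge0 ?cm_ge0 ?exprn_ge0 // ltW.
case: n IH => // n IH n0n.
have nL : L <= n.+1%:R by apply: le_trans Ln0 _; rewrite ler_nat ltnW.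
have n1 : 0 < n.+1%:R :> R by rewrite ltr0Sn.
rewrite -(ler_pM2l n1).
have -> : n.+1%:R * cm (exp_coef n.+1) = cm ((s1 * exp_coef) n) by rewrite -exp_coefS cmM cm_nat.
rewrite fpsM; apply: le_trans (cm_sum _ _ _ _) _.
apply: (@le_trans _ _ (\sum_(i < n.+1) (K * Cc * t ^+ n) * (s / t) ^+ i)).
  apply: ler_sum => -[i /= ilt] _; rewrite cmM expr_div_n.
  rewrite (_ : _ * _ * _ * _ = (K * s ^+ i) * (Cc * t ^+ (n - i))); last first.
    rewrite -[in LHS](subnK (_ : i <= n)%N) // exprD.
    have ti : t ^+ i != 0 by rewrite expf_neq0 // gt_eqF.
    by move: (t ^+ i) (t ^+ (n - i)) (s ^+ i) ti => p q u p0; field.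
  by apply: ler_pM; rewrite ?cm_ge0 ?hs // IH // ltnS leq_subr.
rewrite -mulr_sumr.
have q01 : 0 <= s / t < 1 by rewrite divr_ge0 ?ltW //= ltr_pdivrMr // mul1r.
apply: (@le_trans _ _ (K * Cc * t ^+ n * (1 - s / t)^-1)).
  by rewrite ler_wpM2l ?mulr_ge0 ?exprn_ge0 ?(ltW t0) // geom_sum_le.
rewrite (_ : K * Cc * t ^+ n * _ = L * (Cc * t ^+ n.+1)); last first.
  rewrite /L exprS; have tn : t != 0 by rewrite gt_eqF.
  have ts : t - s != 0 by rewrite gt_eqF // subr_gt0.
  move: (t ^+ n) => u.
  have -> : 1 - s / t = (t - s) / t by field.
  by rewrite invfM invrK; field.
by rewrite ler_wpM2r // mulr_ge0 ?exprn_ge0 // ltW.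
Qed.

End Exponential.

Lemma geo_opp a : geo a -> geo (- a).
Proof. by move=> [K [s [K0 s01 h]]]; exists K, s; split => // n; rewrite fpsN cmN. Qed.

(** [E'] is the inverse of [E], not its derivative: it is the exponential of [- s1], and the product
    has derivative 0 and constant term 1. *)
Lemma geo_expP (s1 : fps C) : geo s1 -> exists E E' : fps C,
  [/\ geo E, geo E', dfs E = s1 * E, dfs E' = - s1 * E' & E * E' = 1].
Proof.
move=> gs; exists (exp_coef s1), (exp_coef (- s1)); split; try exact: dfs_exp.
- exact: geo_exp.
- by apply: geo_exp; exact: geo_opp.
have d0 : dfs (exp_coef s1 * exp_coef (- s1)) = 0 by rewrite dfsM !dfs_exp; ring.
rewrite (dfs_eq0 _ d0); apply/funext => n; rewrite fps1E fpsM0 !exp_coef0 mulr1.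
by case: n.
Qed.

(** The distance [|n - i|]; one of the two truncated differences is 0. *)
Definition dist (n i : nat) : nat := ((n - i) + (i - n))%N.

Lemma sum_dist s i N : 0 <= s < 1 -> \sum_(n < N) s ^+ dist n i <= 2 / (1 - s).
Proof.
move=> s01; case/andP: (s01) => s0 s1.
have key (M : nat) : \sum_(n < i + M) s ^+ dist n i <= 2 / (1 - s).
  rewrite big_split_ord /= mulrDl mul1r; apply: lerD.
    rewrite (reindex_inj rev_ord_inj) /=; apply: le_trans (geom_sum_le s i.+1 s01).
    rewrite [leRHS]big_ord_recl expr0 /= -[leLHS]add0r; apply: lerD => //.
    by rewrite le_eqVlt; apply/orP; left; apply/eqP/eq_bigr => -[n /= nl] _; rewrite /bump /= add1n; congr (_ ^+ _); rewrite /dist; lia.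
  apply: le_trans (geom_sum_le s M s01).
  by rewrite le_eqVlt; apply/orP; left; apply/eqP/eq_bigr => -[n /= nl] _; congr (_ ^+ _); rewrite /dist; lia.
apply: le_trans (key N); rewrite addnC big_split_ord /= lerDl.
by apply: sumr_ge0 => n _; exact: exprn_ge0.
Qed.

Lemma cauchy_schwarz_weighted (w x : nat -> R) L : (forall i, 0 <= w i) ->
  (\sum_(i < L) w i * x i) ^+ 2 <= (\sum_(i < L) w i) * (\sum_(i < L) w i * x i ^+ 2).
Proof.
move=> w0; elim: L => [|L IH]; first by rewrite !big_ord0 expr0n mul0r.
rewrite !big_ord_recr /=; have A0 : 0 <= \sum_(i < L) w i by apply: sumr_ge0.
have Q0 : 0 <= \sum_(i < L) w i * x i ^+ 2 by apply: sumr_ge0 => i _; rewrite mulr_ge0 ?sqr_ge0.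
move: (\sum_(i < L) w i * x i) (\sum_(i < L) w i) (\sum_(i < L) w i * x i ^+ 2) IH A0 Q0 (w0 L) (x L).
clear => S A Q h A0 Q0; move: (w _) => v v0 y.
(* From [S^2 <= A Q] follows [(2 S y)^2 <= 4 A Q y^2 <= (A y^2 + Q)^2]. *)
have H : 2 * (S * y) <= A * y ^+ 2 + Q.
  have P0 : 0 <= A * y ^+ 2 + Q by rewrite addr_ge0 // mulr_ge0 ?sqr_ge0.
  rewrite leNgt; apply/negP => c.
  have : 0 < (2 * (S * y) - (A * y ^+ 2 + Q)) * (2 * (S * y) + (A * y ^+ 2 + Q)).
    by apply: mulr_gt0; move: c P0; clear; lra.
  have := sqr_ge0 (A * y ^+ 2 - Q); have := ler_wpM2r (sqr_ge0 y) h; clear; nra.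
have := ler_wpM2l v0 H; nra.
Qed.

(** Convolution with the kernel [s ^ |n - i|] is bounded on weighted l2. The weight may vary by a
    factor [|n - i| + 1], absorbed in the passage from [s] to [t]; this admits both [n + 1] and
    [1 / (n + 1)]. *)
Lemma young K s : 0 <= K -> 0 < s < 1 -> exists2 M : R, 0 <= M &
  forall (om x u : nat -> R) (L N : nat), (forall n, 0 <= om n) -> (forall n, 0 <= x n) ->
  (forall n i, om n <= (dist n i).+1%:R * om i) ->
  (forall n, (n < N)%N -> 0 <= u n <= K * \sum_(i < L) s ^+ dist n i * x i) ->
  \sum_(n < N) om n * u n ^+ 2 <= M * \sum_(i < L) om i * x i ^+ 2.
Proof.
move=> K0 /andP[s0 s1]; have s01 : 0 <= s < 1 by rewrite ltW.
have [/andP[t0 t1] _ _] := sq_mid s s01; set t := (1 + s) / 2 in t0 t1.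
have t01 : 0 <= t < 1 by rewrite ltW.
have a0 : 0 <= 2 / (1 - s) by rewrite divr_ge0 // subr_ge0 ltW.
have b0 : 0 <= 2 / (1 - t) by rewrite divr_ge0 // subr_ge0 ltW.
have c0 : 0 <= (1 - t)^-1 by rewrite invr_ge0 subr_ge0 ltW.
exists (K ^+ 2 * (2 / (1 - s)) * ((1 - t)^-1 * (2 / (1 - t)))); first exact: (mulr_ge0 (mulr_ge0 (sqr_ge0 K) a0) (mulr_ge0 c0 b0)).
move=> om x u L N om0 x0 homo hu.
have c2 : 0 <= K ^+ 2 * (2 / (1 - s)) := mulr_ge0 (sqr_ge0 K) a0.
have st n i : 0 <= s ^+ dist n i by rewrite exprn_ge0 // ltW.
apply: (@le_trans _ _ (\sum_(n < N) \sum_(i < L) (K ^+ 2 * (2 / (1 - s))) * ((1 - t)^-1 * t ^+ dist n i * (om i * x i ^+ 2)))).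
  apply: ler_sum => -[n /= nN] _; have /andP[u0 un] := hu n nN.
  apply: (@le_trans _ _ (om n * (K ^+ 2 * ((2 / (1 - s)) * \sum_(i < L) s ^+ dist n i * x i ^+ 2)))).
    rewrite ler_wpM2l //; apply: (@le_trans _ _ ((K * \sum_(i < L) s ^+ dist n i * x i) ^+ 2)).
      by rewrite lerXn2r ?nnegrE // (le_trans u0).
    rewrite exprMn ler_wpM2l ?sqr_ge0 //.
    apply: le_trans (cauchy_schwarz_weighted (fun i => s ^+ dist n i) x L (st n)) _.
    rewrite ler_wpM2r //; first by apply: sumr_ge0 => i _; rewrite mulr_ge0 ?sqr_ge0.
    apply: le_trans (sum_dist s n L s01); apply: ler_sum => i _.
    by rewrite /dist addnC.
  rewrite !mulr_sumr; apply: ler_sum => i _.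
  rewrite [leLHS](_ : _ = K ^+ 2 * (2 / (1 - s)) * (om n * s ^+ dist n i * x i ^+ 2)); last by ring.
  apply: (ler_wpM2l c2); rewrite [leRHS]mulrA; apply: (ler_wpM2r (sqr_ge0 _)).
  apply: (@le_trans _ _ (((dist n i).+1%:R * s ^+ dist n i) * om i)).
    by rewrite mulrAC ler_wpM2r.
  by rewrite ler_wpM2r // absorb.
rewrite exchange_big /= mulr_sumr; apply: ler_sum => i _.
rewrite -mulr_sumr -[leRHS]mulrA; apply: (ler_wpM2l c2); rewrite -mulr_suml.
apply: ler_wpM2r; first by rewrite mulr_ge0 ?sqr_ge0.
by rewrite -mulr_sumr ler_wpM2l // sum_dist.
Qed.

Lemma dist_weight n i : (n.+1 <= (dist n i).+1 * i.+1)%N.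
Proof. by rewrite /dist; nia. Qed.

(** [up] is the map from G to (z G)', with inverse [dn]. The Bergman norm of [up G] is the norm with
    weight [n + 1], in which the transformed unknown G lives. *)
Definition up a : fps C := fun n => n.+1%:R * a n.
Definition dn a : fps C := fun n => a n / n.+1%:R.

Lemma upK a : dn (up a) = a.
Proof. by apply/funext => n; rewrite /dn /up mulrC mulKf // pnatr_eq0. Qed.

Lemma dnK a : up (dn a) = a.
Proof. by apply/funext => n; rewrite /dn /up mulrC divfK // pnatr_eq0. Qed.

Lemma geo_cmM (e a : fps C) K s n : (forall n, cm (e n) <= K * s ^+ n) ->
  cm ((e * a) n) <= K * \sum_(i < n.+1) s ^+ dist n i * cm (a i).
Proof.
move=> h; rewrite mulrC fpsM; apply: le_trans (cm_sum _ _ _ _) _.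
rewrite mulr_sumr; apply: ler_sum => -[i /= il] _; rewrite cmM mulrC [leRHS]mulrA ler_wpM2r ?cm_ge0 //.
by apply: le_trans (h _) _; rewrite /dist (_ : i - n = 0)%N ?addn0 //; lia.
Qed.

Lemma geo_ext s n N (x : nat -> R) : 0 <= s -> (forall i, 0 <= x i) -> (n < N)%N ->
  \sum_(i < n.+1) s ^+ dist n i * x i <= \sum_(i < N) s ^+ dist n i * x i :> R.
Proof.
move=> s0 x0 nN; rewrite -(subnKC nN) big_split_ord /= lerDl.
by apply: sumr_ge0 => i _; rewrite mulr_ge0 ?exprn_ge0.
Qed.

Lemma geo_W e : geo e -> exists M, forall a B, wle a B -> wle (e * a) (M * B).
Proof.
move=> [K [s [K0 s01 he]]]; have [M M0 hM] := young K s K0 s01; exists M => a B wa N.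
case/andP: (s01) => s0 s1.
have om0 n : 0 <= (n.+1%:R^-1 : R) by rewrite invr_ge0.
have := hM (fun n => n.+1%:R^-1) (fun n => cm (a n)) (fun n => cm ((e * a) n)) N N om0 (fun n => cm_ge0 _).
have -> : \sum_(n < N) n.+1%:R^-1 * cm ((e * a) n) ^+ 2 = wsum (e * a) N.
  by apply: eq_bigr => n _; rewrite mulrC.
have -> : \sum_(n < N) n.+1%:R^-1 * cm (a n) ^+ 2 = wsum a N.
  by apply: eq_bigr => n _; rewrite mulrC.
move=> H; apply: le_trans (H _ _) _; last by rewrite ler_wpM2l.
- move=> n i; rewrite ler_pdivlMr ?ltr0Sn // mulrC ler_pdivrMr ?ltr0Sn //.
  by rewrite -natrM ler_nat; have := dist_weight i n; rewrite /dist; lia.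
- move=> n nN; rewrite cm_ge0 /=; apply: le_trans (geo_cmM _ _ K s n he) _.
  by rewrite ler_wpM2l // (geo_ext s n N (fun i => cm (a i))) ?(ltW s0) // => i; exact: cm_ge0.
Qed.

Lemma wsum_up a N : wsum (up a) N = \sum_(n < N) n.+1%:R * cm (a n) ^+ 2.
Proof.
apply: eq_bigr => n _; rewrite /up cmM cm_nat exprMn; have n0 : (n.+1%:R : R) != 0 by rewrite pnatr_eq0.
by move: (n.+1%:R) n0 => p p0; field.
Qed.

Lemma geo_V e : geo e -> exists M, forall a B, wle (up a) B -> wle (up (e * a)) (M * B).
Proof.
move=> [K [s [K0 s01 he]]]; have [M M0 hM] := young K s K0 s01; exists M => a B wa N.
case/andP: (s01) => s0 s1.
have := hM (fun n => n.+1%:R) (fun n => cm (a n)) (fun n => cm ((e * a) n)) N N (fun n => ler0n _ _) (fun n => cm_ge0 _).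
rewrite -!wsum_up => H; apply: le_trans (H _ _) _; last by rewrite ler_wpM2l.
- by move=> n i; rewrite -natrM ler_nat; exact: dist_weight.
- move=> n nN; rewrite cm_ge0 /=; apply: le_trans (geo_cmM _ _ K s n he) _.
  by rewrite ler_wpM2l // (geo_ext s n N (fun i => cm (a i))) ?(ltW s0) // => i; exact: cm_ge0.
Qed.

End GeometricDecay.

(** * Invertibility in terms of the roots of the symbol *)

Section Conjugation.
Context {R : realType}.
Notation C := (complex R).
Implicit Types (a b H : fps C) (P : {poly C}) (z w x lam : C) (r s t B : R).

Definition qpoly P lam : {poly C} := 1 + 'X * (P - lam%:P).

Lemma fpXM a n : (fp 'X * a) n = if n is m.+1 then a m else 0.
Proof.
rewrite fpsM big_ord_recl /fp coefX mul0r add0r; case: n => [|n]; first by rewrite big_ord0.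
rewrite big_ord_recl big1 => [|i _]; last by rewrite /bump /= ?add1n coefX /= mul0r.
by rewrite /bump /= ?add1n coefX /= mul1r addr0 subSS subn0.
Qed.

Lemma fpCM (c : C) a n : (fp c%:P * a) n = c * a n.
Proof.
rewrite fpsM big_ord_recl /fp coefC /= subn0 big1 ?addr0 // => i _.
by rewrite coefC /bump /= add1n mul0r.
Qed.

Lemma dn_decomp a : a = dn a + fp 'X * dfs (dn a).
Proof.
apply/funext => n; rewrite fpsD fpXM /dfs /dn; case: n => [|n]; first by rewrite addr0 divr1.
have h : (n.+2%:R : C) != 0 by rewrite pnatr_eq0.
have -> : (n.+1%:R : C) = n.+2%:R - 1 by rewrite -[n.+2%:R]natr1 addrK.
by move: (n.+2%:R) h => p p0; field.
Qed.

(* [dn a] is the coefficient sequence of G = z^-1 int_0^z f. *)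
Lemma LopE P lam a : Lop P lam a = fp (qpoly P lam) * dfs (dn a) + fp (P - lam%:P) * dn a.
Proof.
have T : Tbar a = dfs (dn a) :> fps C.
  by apply/funext => n; rewrite /Tbar /dfs /dn mulrAC -mulrA.
have -> : Lop P lam a = dfs (dn a) + fp (P - lam%:P) * a :> fps C.
  rewrite -T; apply/funext => n; rewrite fpsD /Lop /Top -addrA; congr (_ + _).
  rewrite -[P in RHS]/(P) fpD mulrDl fpsD; congr (_ + _).
  by rewrite -polyCN fpCM mulNr.
have -> : fp (qpoly P lam) = 1 + fp 'X * fp (P - lam%:P) by rewrite /qpoly fpD fp1 fpM.
have alg (d X p dd : fps C) : dd + p * (d + X * dd) = (1 + X * p) * dd + p * d by ring.
by rewrite -alg -dn_decomp.
Qed.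

Definition Bop (Q s0 : {poly C}) H : fps C := fp Q * dfs H + fp s0 * H.

Definition prodX (rs : seq C) : {poly C} := \prod_(x <- rs) ('X - x%:P).

Lemma root_prodX rs x : root (prodX rs) x = (x \in rs).
Proof. by rewrite /prodX root_prod_XsubC. Qed.

Lemma coprime_prodX (rs1 rs2 : seq C) : (forall x, x \in rs1 -> x \notin rs2) ->
  coprimep (prodX rs1) (prodX rs2).
Proof.
move=> h; elim: rs1 h => [|x rs IH] h; first by rewrite /prodX big_nil coprime1p.
rewrite /prodX big_cons coprimepMl; apply/andP; split; last first.
  by apply: IH => y yr; apply: h; rewrite inE yr orbT.
by rewrite coprimep_sym coprimep_XsubC -/(prodX rs2) root_prodX h ?mem_head.
Qed.

(* Partial fractions split (p - lam) / q into s0 / Q and sm / q1, where q = Q q1 separates inner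
   and outer roots; E solves E' = (sm / q1) E and has geometrically decaying coefficients. *)
Lemma conj_form P lam (ins outs : seq C) : qpoly P lam = prodX ins * prodX outs ->
  all (fun x => cm x < 1) ins -> all (fun x => 1 < cm x) outs ->
  exists (s0 sm : {poly C}) (E E' u v : fps C),
    [/\ geo E, geo E', geo u & geo v] /\
    [/\ E * E' = 1, u * v = 1, (size s0 <= size ins)%N, P - lam%:P = s0 * prodX outs + sm * prodX ins
      & forall a, Lop P lam a = u * Bop (prodX ins) s0 (E * dn a)].
Proof.
move=> qE /allP hi /allP ho; set Q := prodX ins in qE *; set q1 := prodX outs in qE *; set pt := P - lam%:P; have ptd : pt = P - lam%:P by [].
have cop : coprimep q1 Q.
  by apply: coprime_prodX => x /ho x1; apply/negP => /hi; rewrite ltNge ltW.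
have [[e1 e2] /= he] := Bezout_eq1_coprimepP _ _ cop.
have Q0 : Q != 0 by rewrite /Q /prodX monic_neq0 // monic_prod_XsubC.
(* Reducing the Bezout coefficient modulo [Q] keeps the degree of [s0] below the number of inner
   roots; the quotient moves into [sm]. *)
pose s0 := (pt * e1) %% Q; pose sm := pt * e2 + ((pt * e1) %/ Q) * q1.
have ptE : pt = s0 * q1 + sm * Q.
  have := divp_eq (pt * e1) Q; rewrite -/s0 => dE.
  rewrite -[pt in LHS]mulr1 -he mulrDr !mulrA dE /sm; ring.
have ss : (size s0 <= size ins)%N by rewrite -ltnS -(size_prod_XsubC ins id) ltn_modp.
clearbody s0 sm pt.
have [v1 gv1 hv1] := geo_inv_prod outs (introT allP ho); rewrite -/(prodX outs) -/q1 in hv1.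
have gs1 : geo (fp sm * v1) by apply: geoM => //; exact: geo_fp.
have [E [E' [gE gE' dE dE' EE']]] := geo_expP _ gs1.
(* Substituting G = [E'] H cancels the [sm] terms and leaves the common factor [E' * fp q1], which
   is [u]; [v] is its inverse. *)
exists s0, sm, E, E', (E' * fp q1), (E * v1); split; first by split => //; apply: geoM => //; exact: geo_fp.
split => //; first by rewrite -[1]mulr1 -{1}EE' -hv1; ring.
move=> a; have -> : dn a = E' * (E * dn a) by rewrite mulrA [E' * E]mulrC EE' mul1r.
set H := E * dn a.
have := LopE P lam a; rewrite -ptd => ->; have -> : dn a = E' * H by rewrite /H mulrA [E' * E]mulrC EE' mul1r.
rewrite dfsM dE' qE fpM {1}ptE fpD !fpM /Bop.
have -> : E * (E' * H) = H by rewrite mulrA EE' mul1r.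
have hs : fp sm = fp sm * v1 * fp q1 by rewrite -mulrA [v1 * _]mulrC hv1 mulr1.
have alg (q q' e h dh t0 : fps C) tm : tm = tm * v1 * q' ->
    q * q' * (- (tm * v1) * e * h + e * dh) + (t0 * q' + tm * q) * (e * h) = e * q' * (q * dh + t0 * h).
  by move=> ht; rewrite {2}ht; ring.
exact: alg.
Qed.

Lemma wle_up1 : wle (up (1 : fps C)) 1.
Proof.
move=> M; case: M => [|M]; first by rewrite /wsum big_ord0.
rewrite /wsum big_ord_recl big1 => [|i _]; last by rewrite /up fps1E mulr0 cm0 expr0n mul0r.
by rewrite /up fps1E mulr1 cm1 expr1n divr1 addr0.
Qed.

Definition V H := W (up H).

Lemma geo_memV e : geo e -> V e.
Proof. by move=> /geo_V[M hM]; exists (M * 1); rewrite -[e]mulr1; apply: hM; exact: wle_up1. Qed.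

Lemma VM e H : geo e -> V H -> V (e * H).
Proof. by move=> /geo_V[M hM] [B wH]; exists (M * B); exact: hM. Qed.

Lemma WM e a : geo e -> W a -> W (e * a).
Proof. by move=> /geo_W[M hM] [B wH]; exists (M * B); exact: hM. Qed.

Lemma V_dn a : W a -> V (dn a).
Proof. by rewrite /V dnK. Qed.

Lemma dfs_fp (h : {poly C}) : dfs (fp h) = fp h^`().
Proof. by apply/funext => n; rewrite /dfs /fp coef_deriv mulr_natl. Qed.

(** A polynomial solution [h] of the gauged equation yields the kernel element [up (E' * fp h)]. The
    hypothesis covers every admissible [s0], because [conj_form] provides it only existentially. *)
Lemma not_invertible_kernel P lam ins outs : qpoly P lam = prodX ins * prodX outs ->
  all (fun x => cm x < 1) ins -> all (fun x => 1 < cm x) outs ->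
  (forall s0 sm : {poly C}, (size s0 <= size ins)%N -> P - lam%:P = s0 * prodX outs + sm * prodX ins ->
    exists2 h : {poly C}, h != 0 & prodX ins * h^`() + s0 * h = 0) ->
  ~ invertible_on_Bergman (Toeplitz_shift (fun z => conjc z + P.[z]) lam).
Proof.
move=> qE hi ho hh /coef_invertible[[M hM] _].
have [s0 [sm [E [E' [u [v [[gE gE' gu gv] [EE' uv ss pE LE]]]]]]]] := conj_form _ _ _ _ qE hi ho.
have [h h0 hz] := hh _ _ ss pE.
pose a : fps C := up (E' * fp h).
have wa : W a by apply: VM => //; apply: geo_memV; exact: geo_fp.
have L0 : Lop P lam a = (0 : fps C).
  by rewrite LE /a upK mulrA EE' mul1r /Bop dfs_fp -!fpM -fpD hz fp0 mulr0.
have : wle a (M * 0).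
  by apply: hM => //; rewrite L0 => N; rewrite /wsum big1 // => i _; rewrite cm0 expr0n mul0r.
rewrite mulr0 => /wle0_eq0 a0.
have : fp h = 0.
  rewrite -[fp h]mul1r -EE' -mulrA -[E' * fp h]upK -/a a0.
  by apply/funext => n; rewrite fpsM big1 // => i _; rewrite /dn mul0r mulr0.
move=> fh0; move/eqP: h0; apply; apply/polyP => i; rewrite coef0.
exact: (congr1 (fun F => F i) fh0).
Qed.

Lemma wle_shiftl a B : wle a B -> wle (fun n => a n.+1) (2 * B).
Proof.
move=> wa M; apply: (@le_trans _ _ (2 * wsum a M.+1)); last by rewrite ler_wpM2l.
rewrite /wsum big_ord_recl mulrDr -[leLHS]add0r; apply: lerD; first by rewrite mulr_ge0 ?divr_ge0 ?sqr_ge0.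
rewrite mulr_sumr; apply: ler_sum => n _; rewrite lift0.
rewrite mulrCA ler_wpM2l ?sqr_ge0 // ler_pdivlMr ?ltr0Sn // mulrC ler_pdivrMr ?ltr0Sn //.
by rewrite -natrM ler_nat; lia.
Qed.

Lemma count_block (n M : nat) :
  (\sum_(j < M) ((n <= j) && (j < n.*2)) = minn M n.*2 - minn M n)%N.
Proof. elim: M => [|M IH]; first by rewrite big_ord0; lia. rewrite big_ord_recr /= IH; lia. Qed.

Lemma count_point (n M : nat) : (\sum_(j < M) (j == n :> nat) <= 1)%N.
Proof.
suff -> : (\sum_(j < M) (j == n :> nat) = (n < M))%N by case: (_ < _)%N.
elim: M => [|M IH]; first by rewrite big_ord0. by rewrite big_ord_recr /= IH; lia.
Qed.

(* The test sequences z^-j, n <= j < 2 n, are annihilated by X - z up to two boundary terms. *)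
Lemma not_invertible_circle P lam z : cm z = 1 -> root (qpoly P lam) z ->
  ~ invertible_on_Bergman (Toeplitz_shift (fun z => conjc z + P.[z]) lam).
Proof.
move=> z1 /factor_theorem[r qE] /coef_invertible[[M0 hM] _].
have [M hr] := geo_W _ (geo_fp r).
have zn0 : z != 0 by rewrite -cm_gt0 z1.
(* The test sequence has squared norm at least 1/2 and its image has squared norm O(1/n), so the
   lower bound fails for large [n]. *)
have key n : (0 < n)%N -> 2^-1 <= `|M0| * ((8 * `|M| + 4) / n%:R).
  move=> n0; have nR : 0 < n%:R :> R by rewrite ltr0n.
  pose a : fps C := fun j => if ((n <= j) && (j < n.*2))%N then z ^- j else 0.
  have ca j : cm (a j) = ((n <= j) && (j < n.*2))%N%:R.
    by rewrite /a; case: ifP => _; rewrite ?cm0 // cmV cmX z1 expr1n invr1.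
  have wa : wle a 1.
    move=> N; apply: (@le_trans _ _ (\sum_(j < N) ((n <= j) && (j < n.*2))%N%:R / n%:R)).
      apply: ler_sum => j _; rewrite ca; case: andP => [[h1 h2]|_]; last by rewrite expr0n !mul0r.
      by rewrite expr1n !mul1r lef_pV2 ?posrE ?ltr0Sn // ler_nat ltnW.
    rewrite -mulr_suml ler_pdivrMr // mul1r -natr_sum ler_nat count_block; lia.
  have la : 2^-1 <= wsum a n.*2.
    apply: (@le_trans _ _ (\sum_(j < n.*2) ((n <= j) && (j < n.*2))%N%:R / n.*2%:R)).
      rewrite -mulr_suml -natr_sum count_block (_ : (_ - _ = n)%N); last by lia.
      by rewrite -mul2n natrM invfM mulrCA mulfV ?gt_eqF // mulr1.
    apply: ler_sum => -[j /= jn] _; rewrite ca; case: andP => [[h1 h2]|_]; last by rewrite expr0n !mul0r.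
    by rewrite expr1n !mul1r lef_pV2 ?posrE ?ltr0Sn ?ltr0n ?double_gt0 // ler_nat.
  pose b : fps C := fp ('X - z%:P) * a.
  have bE m : b m = (if m is m'.+1 then a m' else 0) - z * a m.
    by rewrite /b fpD mulrDl fpsD fpXM -polyCN fpCM mulNr.
  have cb m : cm (b m) <= ((m == n) + (m == n.*2))%N%:R.
    rewrite bE; case: m => [|m].
      by rewrite /a leqNgt n0 /= mulr0 subr0 cm0.
    have : cm (a m - z * a m.+1) <= ((m.+1 == n) + (m.+1 == n.*2))%N%:R.
      have [e|ne] := boolP ((n <= m) && (m.+1 < n.*2))%N.
        have -> : a m - z * a m.+1 = 0.
          rewrite /a !ifT; [|lia|lia].
          by rewrite exprS invfM mulrA mulfV // mul1r subrr.
        by rewrite cm0.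
      apply: le_trans (cmB _ _) _; rewrite cmM z1 mul1r !ca -natrD ler_nat; lia.
    by [].
  have wb : wle b (2 / n%:R).
    move=> N; apply: (@le_trans _ _ (\sum_(j < N) ((j == n :> nat) + (j == n.*2 :> nat))%N%:R / n%:R)).
      apply: ler_sum => j _; have := cb j; case: (boolP ((j == n :> nat) || (j == n.*2 :> nat))) => h c.
        have {}c : cm (b j) <= 1 by apply: le_trans c _; rewrite lern1; lia.
        apply: (@le_trans _ _ (1 / n%:R)); last by rewrite ler_wpM2r ?invr_ge0 // ler1n; lia.
        apply: ler_pM; rewrite ?sqr_ge0 ?invr_ge0 //; first by rewrite expr_le1 ?cm_ge0.
        by rewrite lef_pV2 ?posrE ?ltr0Sn // ler_nat; lia.
      have {}c : cm (b j) <= 0 by apply: le_trans c _; rewrite (_ : (_ + _ = 0)%N) //; lia.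
      have -> : cm (b j) = 0 by apply/eqP; rewrite eq_le c cm_ge0.
      by rewrite expr0n mul0r divr_ge0.
    rewrite -mulr_suml ler_wpM2r ?invr_ge0 // -natr_sum ler_nat big_split /=.
    by apply: (@leq_add _ _ 1 1); exact: count_point.
  have wq : wle (fp (qpoly P lam) * a) (`|M| * (2 / n%:R)).
    move=> N; apply: (@le_trans _ _ (M * (2 / n%:R))); last by rewrite ler_wpM2r ?divr_ge0 // ler_norm.
    by rewrite qE fpM -mulrA; apply: hr.
  (* [Tbar] is the backward shift minus a division by [m + 2]; the shift combines with [P - lam] to
     [qpoly], and [c] is the remainder, small because [a] is supported on indices [>= n]. *)
  pose c : fps C := fun m => - (a m.+1 / m.+2%:R).
  have wc : wle c (2 / n%:R).
    have := wleZ (n%:R^-1) _ _ (wle_shiftl _ _ wa) => wz.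
    have wz' : wle c (cm (n%:R^-1 : C) ^+ 2 * (2 * 1)).
      apply: (wle_sub_le _ _ _ _ wz) => m; rewrite /c cmN !cmM cmV cm_nat cmV cm_nat mulrC ca.
      case: andP => [[h1 h2]|_]; last by rewrite !mulr0.
      by rewrite !mulr1 lef_pV2 ?posrE ?ltr0Sn // ler_nat ltnW.
    move=> N; apply: le_trans (wz' N) _; rewrite cmV cm_nat mulr1 mulrC ler_wpM2l //.
    by rewrite expr2 ler_piMl ?invr_ge0 // invf_le1 // ler1n.
  have LE m : Lop P lam a m = (fp (qpoly P lam) * a) m.+1 + c m.
    rewrite /Lop /Top /c /qpoly fpD fp1 mulrDl mul1r fpsD fpM -mulrA fpXM fpD mulrDl fpsD -polyCN fpCM /Tbar.
    rewrite -[pconv P a m]/((fp P * a) m).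
    have h : (m.+2%:R : C) != 0 by rewrite pnatr_eq0.
    have : (m.+1%:R : C) = m.+2%:R - 1 by rewrite -[m.+2%:R]natr1 addrK.
    by move: (m.+2%:R) h => p p0 ->; field.
  have wL := wleD _ _ _ _ (wle_shiftl _ _ wq) wc.
  have := hM a _ (ex_intro _ 1 wa) (_ : wle (Lop P lam a) _).
  move=> /(_ (2 * (2 * (`|M| * (2 / n%:R)) + 2 / n%:R))) H.
  apply: le_trans la _; apply: le_trans (H _ n.*2) _.
    by rewrite (_ : Lop P lam a = fun m => (fp (qpoly P lam) * a) m.+1 + c m) //; apply/funext.
  rewrite (_ : 2 * _ = (8 * `|M| + 4) / n%:R); last by ring.
  by rewrite ler_wpM2r ?ler_norm // divr_ge0 // addr_ge0 // mulr_ge0.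
pose K := `|M0| * (8 * `|M| + 4); have K0 : 0 <= K by rewrite mulr_ge0 // addr_ge0 // mulr_ge0.
pose n := (Num.trunc (2 * K)).+1.
have K20 : 0 <= 2 * K by rewrite mulr_ge0.
have nK : 2 * K < n%:R by have /andP[] := truncn_itv K20.
have := key n (ltn0Sn _); rewrite mulrA -/K ler_pdivlMr ?ltr0Sn //.
by move: nK; move: (n%:R : R) => t; clear; lra.
Qed.

End Conjugation.

(** * Two or more inner roots: failure of surjectivity *)

Section TwoRoots.
Context {R : realType}.
Notation C := (complex R).
Implicit Types (a b H u v w : fps C) (P : {poly C}) (z x lam : C) (r s t B S U : R).

Definition tbnd t v := exists S, forall n, cm (v n) * t ^+ n <= S.

Lemma lin_coef x v n : (fp ('X - x%:P) * v) n.+1 = v n - x * v n.+1.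
Proof. by rewrite fpD mulrDl fpsD fpXM -polyCN fpCM mulNr. Qed.

Lemma tbnd_prod t (rs : seq C) v : 0 < t < 1 -> tbnd t v -> tbnd t (fp (prodX rs) * v).
Proof.
move=> /andP[t0 t1] hv; elim: rs => [|x rs IH]; first by rewrite /prodX big_nil fp1 mul1r.
rewrite /prodX big_cons -/(prodX rs) fpM -mulrA; case: IH => S; move: (fp (prodX rs) * v) => {hv}v hv.
have S0 : 0 <= S by apply: le_trans (hv 0%N); rewrite mulr_ge0 ?cm_ge0.
exists (S + cm x * S) => -[|n].
  rewrite fpsM0 expr0 mulr1 /fp coefB coefX coefC /= sub0r cmM cmN.
  apply: (@le_trans _ _ (cm x * S)); last by rewrite lerDr.
  by rewrite ler_wpM2l ?cm_ge0 //; have := hv 0%N; rewrite expr0 mulr1.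
rewrite lin_coef; apply: (@le_trans _ _ ((cm (v n) + cm x * cm (v n.+1)) * t ^+ n.+1)).
  by rewrite ler_wpM2r ?exprn_ge0 ?(ltW t0) //; apply: le_trans (cmB _ _) _; rewrite cmM.
rewrite mulrDl; apply: lerD; last by rewrite -mulrA ler_wpM2l ?cm_ge0.
apply: le_trans (hv n); rewrite ler_wpM2l ?cm_ge0 // exprS ler_piMl ?exprn_ge0 ?ltW //.
Qed.

(* A root inside the disk gives a backward recursion that contracts in the norm sup t^n |v_n|. *)
Lemma back_one t x v M U : 0 < t -> cm x < t -> tbnd t v ->
  (forall n, (M < n)%N -> cm ((fp ('X - x%:P) * v) n) * t ^+ n <= U) ->
  forall m, (M <= m)%N -> cm (v m) * t ^+ m <= U / (t - cm x).
Proof.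
move=> t0 xt [S0 hS] hU m Mm.
have tx : 0 < t - cm x by rewrite subr_gt0.
have U0 : 0 <= U by apply: le_trans (hU M.+1 _); rewrite // mulr_ge0 ?cm_ge0 ?exprn_ge0 ?ltW.
have S00 : 0 <= S0 by apply: le_trans (hS 0%N); rewrite mulr_ge0 ?cm_ge0.
pose q := cm x / t; have q0 : 0 <= q by rewrite divr_ge0 ?cm_ge0 ?ltW.
have q1 : q < 1 by rewrite ltr_pdivrMr // mul1r.
have key k : forall m, (M <= m)%N -> cm (v m) * t ^+ m <= U / (t - cm x) + q ^+ k * S0.
  elim: k => [|k IH] {Mm}m Mm.
    by rewrite expr0 mul1r; apply: le_trans (hS m) _; rewrite lerDr divr_ge0 // ltW.
  have E : v m = (fp ('X - x%:P) * v) m.+1 + x * v m.+1 by rewrite lin_coef subrK.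
  have h1 := hU m.+1 Mm; have h2 := IH m.+1 (leqW Mm).
  rewrite -(ler_pM2r t0) -mulrA -exprSr {1}E.
  apply: (@le_trans _ _ (cm ((fp ('X - x%:P) * v) m.+1) * t ^+ m.+1 + cm x * (cm (v m.+1) * t ^+ m.+1))).
    rewrite [leRHS](_ : _ = (cm ((fp ('X - x%:P) * v) m.+1) + cm (x * v m.+1)) * t ^+ m.+1); last first.
      by rewrite cmM; move: (t ^+ m.+1) => y; ring.
    by rewrite ler_wpM2r ?exprn_ge0 ?(ltW t0) ?cmD.
  apply: (@le_trans _ _ (U + cm x * (U / (t - cm x) + q ^+ k * S0))).
    by apply: lerD => //; rewrite ler_wpM2l ?cm_ge0.
  rewrite le_eqVlt; apply/orP; left; apply/eqP; rewrite exprS /q.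
  have h3 : t - cm x != 0 by rewrite gt_eqF.
  have h4 : t != 0 by rewrite gt_eqF.
  by move: (_ ^+ k) => y; field; rewrite h3 h4.
apply: real_le_eps => e e0; have e1 : 0 < e / (S0 + 1) by rewrite divr_gt0 // ltr_wpDl.
have [N hN] := exprn_lt_eps q _ ltac:(by rewrite q0) e1.
apply: le_trans (key N m Mm) _; rewrite lerD2l.
apply: (@le_trans _ _ (e / (S0 + 1) * (S0 + 1))); last by rewrite divfK // gt_eqF // ltr_wpDl.
by apply: ler_pM; rewrite ?exprn_ge0 ?(ltW (hN _ _)) // lerDl.
Qed.

(** [back_one] removes one root at a time; each removal lowers the starting index by one, hence
    [M + size rs]. *)
Lemma back_prod t (rs : seq C) : 0 < t < 1 -> all (fun x => cm x < t) rs ->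
  exists2 K, 0 <= K & forall v M U, tbnd t v ->
    (forall n, (M + size rs <= n)%N -> cm ((fp (prodX rs) * v) n) * t ^+ n <= U) ->
    forall m, (M <= m)%N -> cm (v m) * t ^+ m <= K * U.
Proof.
move=> t01; elim: rs => [_|x rs IH /= /andP[xt /IH[K K0 hK]]].
  exists 1 => // v M U _; rewrite /prodX big_nil fp1 mul1r addn0 => h m Mm.
  by rewrite mul1r; exact: h.
case/andP: (t01) => t0 t1.
exists (K / (t - cm x)); first by rewrite divr_ge0 // subr_ge0 ltW.
move=> v M U hv; rewrite /prodX big_cons -/(prodX rs) fpM -mulrA => hU m Mm.
rewrite mulrAC -mulrA; apply: (hK v M) => // n Mn.
by apply: (back_one _ _ _ (M + size rs)) => //; [exact: tbnd_prod|move=> j Mj; apply: hU; rewrite addnS].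
Qed.

Lemma V_tbnd t H : 0 < t < 1 -> V H -> tbnd t (dfs H).
Proof.
move=> t01 [B wH]; have : W (dfs H).
  exists (2 * B); apply: (wle_sub_le _ _ _ _ (wle_shiftl _ _ wH)) => n.
  by rewrite /dfs /up !cmM !cm_nat ler_wpM2r ?cm_ge0 // ler_nat.
by move=> /W_tempered/(_ t t01).
Qed.

(** Where the right-hand side vanishes, Q H' = - s0 H, and dividing by Q with [back_prod] bounds the
    tail of H' by that of H. The latter is smaller than the tail of H' by a factor [1 / (M + 1)], so
    for large [M] the tail of H' is at most half of itself. The threshold does not depend on [H]. *)
Lemma bop_vanish (ins : seq C) (s0 : {poly C}) : all (fun x => cm x < 1) ins ->
  (size s0 <= size ins)%N -> exists M0 : nat, forall M H, (M0 <= M)%N -> V H ->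
  (forall n, (M + size ins <= n)%N -> Bop (prodX ins) s0 H n = 0) ->
  forall i, (M < i)%N -> H i = 0.
Proof.
move=> hin ss.
have [t /andP[t0 t1] ht] : exists2 t, 0 < t < 1 & all (fun x => cm x < t) ins.
  elim: ins hin {ss} => [_|x rs IH /= /andP[x1 /IH[t t01 ht]]].
    by exists 2^-1 => //; rewrite invr_gt0 ltr0n invf_lt1 ?ltr0n ?ltr1n.
  exists (Num.max t ((1 + cm x) / 2)).
    by case/andP: t01 => t0 t1; rewrite lt_max t0 gt_max t1; lra.
  apply/andP; split; first by rewrite lt_max; apply/orP; right; lra.
  by apply/allP => y /(allP ht) yt; rewrite lt_max yt.
have t01 : 0 < t < 1 by rewrite t0.
have [K K0 hK] := back_prod t ins t01 ht.
have [Ks [s [Ks0 /andP[sp s1] hs]]] := geo_fp s0.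
pose Cs := Ks / (1 - s); have Cs0 : 0 <= Cs by rewrite divr_ge0 // subr_ge0 ltW.
(* [L <= M.+1] makes the contraction factor [K * Cs / M.+1] at most 1/2. *)
pose L := 2 * (K * Cs); have L0 : 0 <= L by rewrite mulr_ge0 // mulr_ge0.
exists (Num.trunc L).+1 => M H M0M VH hz i Mi.
have LM : L <= M.+1%:R.
  by have /andP[_ h] := truncn_itv L0; apply: le_trans (ltW h) _; rewrite ler_nat leqW.
have [S0 hS0] := V_tbnd t H t01 VH.
have half S : (forall m, (M <= m)%N -> cm (dfs H m) * t ^+ m <= S) ->
    forall m, (M <= m)%N -> cm (dfs H m) * t ^+ m <= S / 2.
  move=> hS m Mm.
  have S0' : 0 <= S by apply: le_trans (hS M _); rewrite // mulr_ge0 ?cm_ge0 ?exprn_ge0 ?ltW.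
  have Hi j : (M < j)%N -> cm (H j) * t ^+ j <= S / M.+1%:R.
    case: j => // j Mj; have h := hS j Mj.
    have j0 : (j.+1%:R : R) != 0 by rewrite pnatr_eq0.
    have -> : cm (H j.+1) * t ^+ j.+1 = t * (cm (dfs H j) * t ^+ j) / j.+1%:R.
      by rewrite /dfs cmM cm_nat exprS; move: (j.+1%:R : R) j0 (t ^+ j) => q q0 y; field.
    apply: ler_pM; rewrite ?invr_ge0 //; first by rewrite mulr_ge0 ?mulr_ge0 ?cm_ge0 ?exprn_ge0 ?ltW.
      by apply: le_trans h; rewrite ler_piMl ?mulr_ge0 ?cm_ge0 ?exprn_ge0 ?ltW.
    by rewrite lef_pV2 ?posrE ?ltr0Sn // ler_nat.
  have := hK (dfs H) M (Cs * (S / M.+1%:R)) (ex_intro _ S0 hS0).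
  have hh : forall n, (M + size ins <= n)%N -> cm ((fp (prodX ins) * dfs H) n) * t ^+ n <= Cs * (S / M.+1%:R).
    move=> n Mn; have -> : (fp (prodX ins) * dfs H) n = - (fp s0 * H) n.
      by apply/eqP; rewrite -addr_eq0; apply/eqP; exact: hz n Mn.
    rewrite cmN fpsM; apply: (@le_trans _ _ (\sum_(i < n.+1) (Ks * s ^+ i) * (S / M.+1%:R))); last first.
      rewrite -mulr_suml -mulr_sumr ler_wpM2r ?divr_ge0 // ler_wpM2l //.
      by apply: geom_sum_le; rewrite ltW.
    apply: (@le_trans _ _ (\sum_(i < n.+1) cm (fp s0 i * H (n - i)%N) * t ^+ n)).
      rewrite -mulr_suml; apply: ler_wpM2r; [by rewrite exprn_ge0 // ltW | exact: cm_sum].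
    apply: ler_sum => -[j /= jn] _; have [js|js] := leqP (size s0) j.
      rewrite /fp nth_default // mul0r cm0 mul0r mulr_ge0 ?mulr_ge0 ?divr_ge0 ?exprn_ge0 ?(ltW sp) //.
    rewrite cmM -[leLHS]mulrA; apply: ler_pM; rewrite ?cm_ge0 ?hs ?mulr_ge0 ?cm_ge0 ?exprn_ge0 ?(ltW t0) //.
    apply: (@le_trans _ _ (cm (H (n - j)%N) * t ^+ (n - j))).
      by rewrite ler_wpM2l ?cm_ge0 // ler_wiXn2l ?leq_subr ?ltW.
    by apply: Hi; move: Mn js ss jn; clear; lia.
  move=> /(_ hh m Mm) h; apply: le_trans h _.
  have M1 : 0 < M.+1%:R :> R by rewrite ltr0Sn.
  rewrite (_ : K * _ = S * (K * Cs / M.+1%:R)); last by ring.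
  rewrite ler_wpM2l // ler_pdivrMr //; move: LM; rewrite /L; move: (M.+1%:R : R) (K * Cs); clear => p q; lra.
have all0 m : (M <= m)%N -> dfs H m = 0.
  move=> Mm; apply: cm_eps0 => e e0.
  have pw k : forall m, (M <= m)%N -> cm (dfs H m) * t ^+ m <= S0 * 2^-1 ^+ k.
    elim: k => [|k IH] j Mj; first by rewrite expr0 mulr1.
    by rewrite exprSr mulrA; exact: half.
  have S00 : 0 <= S0 by apply: le_trans (hS0 0%N); rewrite mulr_ge0 ?cm_ge0.
  have tm : 0 < t ^+ m by rewrite exprn_gt0.
  have e1 : 0 < e * t ^+ m / (S0 + 1) by rewrite divr_gt0 ?mulr_gt0 // ltr_wpDl.
  have h2 : 0 <= (2^-1 : R) < 1 by rewrite invr_ge0 ler0n invf_lt1 ?ltr0n ?ltr1n.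
  have [N hN] := exprn_lt_eps _ _ h2 e1.
  rewrite -(ler_pM2r tm); apply: le_trans (pw N m Mm) _.
  apply: (@le_trans _ _ ((S0 + 1) * (e * t ^+ m / (S0 + 1)))); last by rewrite mulrC divfK // gt_eqF // ltr_wpDl.
  by apply: ler_pM; rewrite ?exprn_ge0 ?invr_ge0 ?(ltW (hN _ _)) // lerDl.
case: i Mi => // i Mi; have /eqP := all0 i Mi; rewrite /dfs mulf_eq0 pnatr_eq0 /= => /eqP //.
Qed.

Lemma fps_sumE (I : finType) (F : I -> fps C) n : (\sum_i F i) n = \sum_i F i n.
Proof. by elim/big_rec2: _ => [//|i y1 y2 _ <-]; rewrite fpsD. Qed.

Lemma dfs_sum (I : finType) (F : I -> fps C) : dfs (\sum_i F i) = \sum_i dfs (F i).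
Proof.
elim/big_rec2: _ => [|i y1 y2 _ <-]; last by rewrite dfsD.
by apply/funext => n; rewrite /dfs fps0E mulr0.
Qed.

Lemma dfsZ (c : C) H : dfs (fp c%:P * H) = fp c%:P * dfs H.
Proof. by rewrite dfsM dfs_fp derivC fp0 mul0r add0r. Qed.

Lemma Bop_sum (Q s0 : {poly C}) n (c : 'I_n -> C) (F : 'I_n -> fps C) :
  Bop Q s0 (\sum_i fp (c i)%:P * F i) = \sum_i fp (c i)%:P * Bop Q s0 (F i).
Proof.
rewrite /Bop dfs_sum !mulr_sumr -big_split; apply: eq_bigr => i _ /=.
by rewrite dfsZ; ring.
Qed.

(* If all monomials of degree < e had preimages, these would be e independent polynomials of degree < e - 1. *)
Lemma not_invertible_two P lam ins outs : qpoly P lam = prodX ins * prodX outs ->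
  all (fun x => cm x < 1) ins -> all (fun x => 1 < cm x) outs -> (2 <= size ins)%N ->
  ~ invertible_on_Bergman (Toeplitz_shift (fun z => conjc z + P.[z]) lam).
Proof.
move=> qE hi ho s2 /coef_invertible[_ surj].
have [s0 [sm [E [E' [u [v [[gE gE' gu gv] [EE' uv ss pE LE]]]]]]]] := conj_form _ _ _ _ qE hi ho.
have pre (i : nat) : exists H, V H /\ Bop (prodX ins) s0 H = fp 'X^i.
  have wb : W (u * fp 'X^i).
    apply: WM => //; have [B wB] := geo_memV _ (geo_fp ('X^i : {poly C})); exists B.
    apply: (wle_sub_le _ _ _ _ wB) => n.
    by rewrite /up cmM cm_nat ler_peMl ?cm_ge0 // ler1n.
  have [a wa La] := surj _ wb; exists (E * dn a); split; first by apply: VM => //; exact: V_dn.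
  have : v * (u * Bop (prodX ins) s0 (E * dn a)) = v * (u * fp 'X^i) by rewrite -LE La.
  by rewrite !mulrA [v * u]mulrC uv !mul1r.
have /choice[F hF] := pre.
have [M0 hM] := bop_vanish ins s0 hi ss.
(* The preimages of [X^0, ..., X^e] have degree at most [M0], and [M0 < e] because there are two
   inner roots: [e + 1] rows of length [e] are dependent. *)
pose e := (M0 + (size ins).-1)%N.
pose A : 'M[C]_(e.+1, e) := \matrix_(i, j) F i j.
have : kermx A != 0.
  by rewrite kermx_eq0 /row_free; apply/negP => /eqP h; have := rank_leq_col A; rewrite h ltnn.
move=> /rowV0Pn[c /sub_kermxP cA c0].
pose G : fps C := \sum_i fp (c 0 i)%:P * F i.
have G0 : G = 0.
  apply/funext => j; rewrite /G fps_sumE fps0E; have [je|je] := ltnP j e.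
    have := congr1 (fun X : 'rV_e => X 0 (Ordinal je)) cA; rewrite !mxE => {2}<-.
    by apply: eq_bigr => i _; rewrite fpCM mxE.
  apply: big1 => i _; rewrite fpCM; have [VF BF] := hF i.
  rewrite (hM M0 _ (leqnn _) VF) ?mulr0 //; last by rewrite /e in je; lia.
  move=> n Mn; rewrite BF /fp coefXn; case: eqP => // ni; move: (ltn_ord i); rewrite -ni /e; lia.
have : Bop (prodX ins) s0 G = 0.
  by rewrite G0 /Bop (_ : dfs 0 = 0) ?mulr0 ?addr0 //; apply/funext => n; rewrite /dfs fps0E mulr0.
rewrite Bop_sum => BG; move/eqP: c0; apply; apply/rowP => i; rewrite mxE.
have := congr1 (fun X => X (i : nat)) BG; rewrite fps_sumE (bigD1 i) //= big1 ?addr0.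
  by rewrite fpCM (hF i).2 /fp coefXn eqxx mulr1.
by move=> j ji; rewrite fpCM (hF j).2 /fp coefXn eq_sym (_ : _ == _ = false) ?mulr0 //; exact: negbTE ji.
Qed.

End TwoRoots.

(** * One inner root: explicit bounded inverse *)

Section OneRoot.
Context {R : realType}.
Notation C := (complex R).
Implicit Types (a b H : fps C) (P : {poly C}) (z lam : C) (r t B U : R).

Lemma eventually_bounded (f : nat -> R) i0 A : (forall i, (i0 <= i)%N -> f i <= A) ->
  exists2 B, 0 <= B & forall i, f i <= B.
Proof.
move=> h; have s0 (F : pred 'I_i0) : 0 <= \sum_(i < i0 | F i) `|f i| by apply: sumr_ge0.
exists (`|A| + \sum_(i < i0) `|f i|); first by rewrite addr_ge0.
move=> i; have [hi|hi] := leqP i0 i.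
  by apply: le_trans (h i hi) _; apply: le_trans (ler_norm A) _; rewrite lerDl.
apply: le_trans (ler_norm _) _; rewrite (bigD1 (Ordinal hi)) //= addrCA lerDl addr_ge0 //.
Qed.

Lemma nat_ge (x : R) : exists n : nat, x <= n%:R.
Proof.
exists (Num.trunc `|x|).+1; apply: le_trans (ler_norm _) _; apply: ltW.
by have /andP[] := truncn_itv (normr_ge0 x).
Qed.

(** The factor 2 comes from [(x + y)^2 <= 2 x^2 + 2 y^2]; it is harmless for boundedness. *)
Lemma wsum_lim a (f : nat -> fps C) N B : (forall L, wsum (f L) N <= B) ->
  (forall n e, 0 < e -> exists L0 : nat, forall L, (L0 <= L)%N -> cm (a n - f L n) <= e) ->
  wsum a N <= 2 * B.
Proof.
move=> hB hl.
have common M e : 0 < e -> exists L0 : nat, forall L, (L0 <= L)%N -> forall n, (n < M)%N -> cm (a n - f L n) <= e.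
  move=> e0; elim: M => [|M [L1 h1]]; first by exists 0%N.
  have [L2 h2] := hl M e e0; exists (maxn L1 L2) => L; rewrite geq_max => /andP[/h1 k1 /h2 k2] n.
  by rewrite ltnS leq_eqVlt => /orP[/eqP ->//|]; exact: k1.
apply: real_le_eps => e e0; pose d := Num.min 1 (e / (2 * N%:R + 1)).
have p : 0 < 2 * N%:R + 1 :> R by rewrite ltr_wpDl // mulr_ge0.
have d0 : 0 < d by rewrite lt_min ltr01 divr_gt0.
have [L hL] := common N d d0.
apply: (@le_trans _ _ (2 * wsum (f L) N + \sum_(n < N) 2 * d)); last first.
  apply: lerD; first by rewrite ler_wpM2l.
  rewrite sumr_const card_ord -[_ *+ N]mulr_natr.
  have : d <= e / (2 * N%:R + 1) by rewrite /d ge_min lexx orbT.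
  by rewrite ler_pdivlMr // (_ : 2 * d * N%:R = d * (2 * N%:R)); [move: d0; clear; lra | ring].
rewrite /wsum mulr_sumr -big_split; apply: ler_sum => -[n /= nN] _.
have h := hL L (leqnn L) n nN.
have d1 : d <= 1 by rewrite /d ge_min lexx.
have n1 : n.+1%:R^-1 <= 1 :> R by rewrite invf_le1 ?ltr0Sn // ler1n.
apply: (@le_trans _ _ ((2 * cm (f L n) ^+ 2 + 2 * cm (a n - f L n) ^+ 2) / n.+1%:R)).
  rewrite ler_wpM2r ?invr_ge0 //; apply: (@le_trans _ _ ((cm (f L n) + cm (a n - f L n)) ^+ 2)).
    rewrite lerXn2r ?nnegrE ?addr_ge0 ?cm_ge0 //.
    by rewrite -{1}[a n](subrK (f L n)) addrC; exact: cmD.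
  by move: (cm _) (cm _); clear => x y; have := sqr_ge0 (x - y); nra.
rewrite mulrDl mulrA lerD2l -mulrA ler_wpM2l //.
apply: (@le_trans _ _ (cm (a n - f L n) ^+ 2)); first by rewrite ler_piMr ?sqr_ge0.
by rewrite expr2; move: h d0 d1 (cm_ge0 (a n - f L n)); move: (cm _); clear => c; nra.
Qed.

Section Recursion.
Variables (x c : C).
Hypothesis x1 : cm x < 1.
Hypothesis cN : forall n : nat, n%:R + c != 0.

Lemma bopE H n : Bop (prodX [:: x]) c%:P H n = (n%:R + c) * H n - x * (n.+1%:R * H n.+1).
Proof.
rewrite /Bop /prodX big_seq1 fpsD fpCM fpD mulrDl fpsD fpXM -polyCN fpCM /dfs.
by case: n => [|n]; ring.
Qed.

(** Solved for the lower index, the equation [Bop H = g] reads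
    [H n = g n / (n + c) + ratio n * H n.+1]. The ratios tend to [x], so iterating it towards
    infinity converges. *)
Definition ratio (i : nat) : C := x * i.+1%:R / (i%:R + c).
Definition wprod n j : C := \prod_(i < j) ratio (n + i).

Lemma wprodS n j : wprod n j.+1 = ratio n * wprod n.+1 j.
Proof.
rewrite /wprod big_ord_recl addn0; congr (_ * _); apply: eq_bigr => i _.
by rewrite lift0 addSnnS.
Qed.

Lemma cm_shift_ge i : i%:R - cm c <= cm (i%:R + c).
Proof. by apply: le_trans (cmD_ge _ _); rewrite cm_nat. Qed.

Lemma ratio_bound : exists s i0, [/\ 0 < s < 1 & forall i, (i0 <= i)%N -> cm (ratio i) <= s].
Proof.
pose s := (1 + cm x) / 2; have x0 := cm_ge0 x; have c0 := cm_ge0 c.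
have [s0 sx _] := sq_mid (cm x) ltac:(by rewrite x0).
rewrite -/s in s0 sx; clearbody s; have {}sx : 0 < s - cm x by rewrite subr_gt0.
have [i0 hi0] := nat_ge ((cm x + s * cm c) / (s - cm x) + cm c + 1).
exists s, i0; split => // i hi.
have ii : (cm x + s * cm c) / (s - cm x) + cm c + 1 <= i%:R.
  by apply: le_trans hi0 _; rewrite ler_nat.
have q0 : 0 <= (cm x + s * cm c) / (s - cm x).
  apply: divr_ge0; last exact: ltW.
  by apply: addr_ge0 => //; apply: mulr_ge0 => //; case/andP: s0 => /ltW.
have p0 : 0 < i%:R - cm c by move: ii q0; clear -x1 cN; lra.
have h2 : cm x + s * cm c <= i%:R * (s - cm x).
  by rewrite -ler_pdivrMr //; move: ii c0; clear -x1 cN; lra.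
rewrite /ratio !cmM cmV cm_nat ler_pdivrMr; last by apply: lt_le_trans (cm_shift_ge i).
apply: (@le_trans _ _ (s * (i%:R - cm c))); last first.
  by rewrite ler_wpM2l ?cm_shift_ge //; case/andP: s0 => /ltW.
by move: h2; rewrite -[i.+1%:R]natr1; move: (i%:R : R) => n; clear -x1 cN; lra.
Qed.

Lemma wprod_bound : exists K s, [/\ 0 <= K, 0 < s < 1 & forall n j, cm (wprod n j) <= K * s ^+ j].
Proof.
have [s [i0 [s01 hs]]] := ratio_bound; case/andP: (s01) => s0 s1.
have [M M0 hM] := eventually_bounded _ _ _ hs.
pose Mx := M / s + 1; have Mx1 : 1 <= Mx by rewrite lerDr divr_ge0 // ltW.
have Mx0 : 0 <= Mx by apply: le_trans Mx1.
exists (Mx ^+ i0), s; split; [by rewrite exprn_ge0|by []|].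
(* A potential with one factor [Mx] for each index from [n] up to [i0], where the ratio may exceed
   [s]; measured with it, every step contracts by [s]. *)
pose ph n := Mx ^+ (i0 - n).
have ph1 n : 1 <= ph n by rewrite exprn_ege1.
have step i : cm (ratio i) * ph i.+1 <= s * ph i.
  rewrite /ph; have [hi|hi] := leqP i0 i.
    by rewrite (_ : (i0 - i = 0)%N) 1?(_ : (i0 - i.+1 = 0)%N) ?expr0 ?mulr1 ?hs //; move: hi; clear -x1 cN; lia.
  rewrite (_ : (i0 - i = (i0 - i.+1).+1)%N); last by move: hi; clear -x1 cN; lia.
  rewrite exprS mulrA ler_wpM2r ?exprn_ge0 //; apply: le_trans (hM i) _.
  by rewrite /Mx mulrDr mulr1 mulrCA mulfV ?gt_eqF // mulr1 lerDl ltW.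
have main j : forall n, cm (wprod n j) * ph (n + j)%N <= s ^+ j * ph n.
  elim: j => [|j IH] n; first by rewrite /wprod big_ord0 cm1 expr0 addn0.
  rewrite wprodS cmM exprS -addSnnS -mulrA.
  apply: (@le_trans _ _ (cm (ratio n) * (s ^+ j * ph n.+1))).
    by rewrite ler_wpM2l ?cm_ge0.
  rewrite mulrCA [s * _ * _]mulrAC mulrC; apply: ler_wpM2r => //.
  by rewrite exprn_ge0 // ltW.
move=> n j; apply: (@le_trans _ _ (cm (wprod n j) * ph (n + j)%N)).
  by rewrite ler_peMr ?cm_ge0.
apply: le_trans (main j n) _; rewrite mulrC ler_wpM2r ?exprn_ge0 ?(ltW s0) //.
by rewrite /ph ler_weXn2l ?leq_subr.
Qed.

Lemma div_bound : exists2 D, 0 <= D & forall n : nat, cm ((n%:R + c)^-1) <= D / n.+1%:R.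
Proof.
have c0 := cm_ge0 c.
have [n0 hn0] := nat_ge (2 * cm c + 1).
have [|D D0 hD] := eventually_bounded (fun n => n.+1%:R * cm ((n%:R + c)^-1)) n0 2.
  move=> i hi; have ii : 2 * cm c + 1 <= i%:R by apply: le_trans hn0 _; rewrite ler_nat.
  have := cm_shift_ge i => h.
  rewrite cmV ler_pdivrMr; last by apply: lt_le_trans h; move: ii c0; clear -x1 cN; lra.
  by rewrite -[i.+1%:R]natr1; move: ii h c0; clear -x1 cN; lra.
by exists D => // n; rewrite ler_pdivlMr ?ltr0Sn // mulrC.
Qed.

Definition sterm (g : fps C) n j : C := wprod n j * (g (n + j)%N / ((n + j)%:R + c)).
(** The recursion iterated infinitely often, with no contribution from infinity. *)
Definition hsol (g : fps C) : fps C := fun n => csum (sterm g n).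

Lemma sterm_summable g : W g -> exists B, forall n, summable (sterm g n) B.
Proof.
move=> [B wg]; have [K [s [K0 /andP[s0 s1] hK]]] := wprod_bound; have [D D0 hD] := div_bound.
have s01 : 0 <= s < 1 by rewrite ltW.
exists (K * ((B + 1) * D) / (1 - s)) => n; apply: geom_summable => // j.
rewrite /sterm 2!cmM mulrAC; apply: ler_pM; rewrite ?mulr_ge0 ?cm_ge0 //.
set m := (n + j)%N; have B0 := wle_ge0 _ _ wg.
have gm : cm (g m) <= (B + 1) * m.+1%:R.
  rewrite -(ler_pXn2r (n := 2)) ?nnegrE ?cm_ge0 ?mulr_ge0 ?addr_ge0 //.
  apply: le_trans (wle_coef _ _ m wg) _; rewrite exprMn expr2 [m.+1%:R ^+ 2]expr2.
  apply: ler_pM => //; last by rewrite ler_peMr // ler1n.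
  by have : 0 <= B * B by [rewrite mulr_ge0]; move: B0; clear -x1 cN; lra.
apply: (@le_trans _ _ (((B + 1) * m.+1%:R) * (D / m.+1%:R))).
  by apply: ler_pM; rewrite ?cm_ge0.
by rewrite mulrACA mulfV ?pnatr_eq0 // mulr1.
Qed.

Lemma hsol_rec g n : W g -> hsol g n = g n / (n%:R + c) + ratio n * hsol g n.+1.
Proof.
move=> wg; have [B sB] := sterm_summable g wg.
rewrite /hsol (csumS _ _ (sB n)) /sterm {1}/wprod big_ord0 addn0 mul1r; congr (_ + _).
rewrite -(csumZ _ _ (ratio n) (sB n.+1)); congr csum; apply/funext => j.
by rewrite wprodS /sterm -addSnnS mulrA.
Qed.

Lemma Bop_hsol g : W g -> Bop (prodX [:: x]) c%:P (hsol g) = g.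
Proof.
move=> wg; apply/funext => n; rewrite bopE (hsol_rec g n wg) /ratio.
have := cN n; move: (n%:R + c) (hsol g n.+1) (n.+1%:R : C) => p y q p0.
by field.
Qed.

(** The division by [n + c] gains [1 / (n + 1)], so [up (hsol g)] is dominated by the kernel
    [s ^ |n - i|] applied to [g], and [young] applies. This is done for truncated sums, then passed
    to the limit by [wsum_lim]. *)
Lemma hsol_bound : exists M, forall g B, wle g B -> wle (up (hsol g)) (M * B).
Proof.
have [K [s [K0 /andP[s0 s1] hK]]] := wprod_bound; have [D D0 hD] := div_bound.
have KD : 0 <= K * D by rewrite mulr_ge0.
have [M M0 hM] := young (K * D) s KD ltac:(by rewrite s0).
exists (2 * M) => g B wg N; rewrite -mulrA.
have Wg : W g by exists B.
have [Bs sB] := sterm_summable g Wg.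
apply: (wsum_lim _ (fun L n => n.+1%:R * \sum_(j < L) sterm g n j)); last first.
  move=> n e e0; have e1 : 0 < e / n.+1%:R by rewrite divr_gt0.
  have [L0 hL] := csum_cvg _ _ (sB n) _ e1; exists L0 => L /hL h.
  rewrite /up -mulrBr cmM cm_nat mulrC -ler_pdivlMr ?ltr0Sn //; exact: ltW.
move=> L.
have om0 n : 0 <= (n.+1%:R^-1 : R) by rewrite invr_ge0.
(* The first [N] truncated sums of length [L] involve [g] at indices below [N + L]. *)
have := hM (fun n => n.+1%:R^-1) (fun n => cm (g n)) (fun n => cm (n.+1%:R * \sum_(j < L) sterm g n j)) (N + L)%N N om0 (fun n => cm_ge0 _).
have -> : \sum_(n < N) n.+1%:R^-1 * cm (n.+1%:R * \sum_(j < L) sterm g n j) ^+ 2 =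
    wsum (fun n => n.+1%:R * \sum_(j < L) sterm g n j) N.
  by apply: eq_bigr => n _; rewrite mulrC.
have -> : \sum_(n < N + L) n.+1%:R^-1 * cm (g n) ^+ 2 = wsum g (N + L)%N.
  by apply: eq_bigr => n _; rewrite mulrC.
move=> Hy; apply: le_trans (Hy _ _) _; last by rewrite ler_wpM2l.
- move=> n i; rewrite ler_pdivlMr ?ltr0Sn // mulrC ler_pdivrMr ?ltr0Sn //.
  by rewrite -natrM ler_nat; have := dist_weight i n; rewrite /dist; lia.
move=> n nN; rewrite cm_ge0 /= cmM cm_nat.
apply: (@le_trans _ _ (\sum_(j < L) K * D * (s ^+ j * cm (g (n + j)%N)))).
  apply: (@le_trans _ _ (\sum_(j < L) n.+1%:R * cm (sterm g n j))).
    by rewrite -mulr_sumr ler_wpM2l // cm_sum.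
  apply: ler_sum => j _; rewrite /sterm 2!cmM.
  apply: (@le_trans _ _ (n.+1%:R * ((K * s ^+ j) * (cm (g (n + j)%N) * (D / (n + j).+1%:R))))).
    rewrite ler_wpM2l //; apply: ler_pM; rewrite ?mulr_ge0 ?cm_ge0 //.
    by rewrite ler_wpM2l ?cm_ge0.
  rewrite (_ : n.+1%:R * _ = K * D * (s ^+ j * cm (g (n + j)%N)) * (n.+1%:R / (n + j).+1%:R)); last by ring.
  rewrite ler_piMr ?mulr_ge0 ?cm_ge0 ?exprn_ge0 ?(ltW s0) //.
  by rewrite ler_pdivrMr ?ltr0Sn // mul1r ler_nat ltnS leq_addr.
rewrite -mulr_sumr ler_wpM2l //.
have pos i : 0 <= s ^+ dist n i * cm (g i) by rewrite mulr_ge0 ?cm_ge0 ?exprn_ge0 ?ltW.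
have -> : (N + L = n + (L + (N - n)))%N by move: nN; clear -x1 cN; lia.
rewrite big_split_ord /= [X in _ <= _ + X]big_split_ord /= addrCA.
have -> : \sum_(j < L) s ^+ j * cm (g (n + j)%N) = \sum_(i < L) s ^+ dist n (n + i) * cm (g (n + i)%N).
  by apply: eq_bigr => i _; congr (_ ^+ _ * _); rewrite /dist; lia.
by rewrite lerDl addr_ge0 // sumr_ge0.
Qed.

(** Iteration gives [H n = wprod n j * H (n + j)]. The products decay like [s ^+ j], while an
    element of [V] grows slower than [t ^- j] for some [t > s]. *)
Lemma bop_kernel0 H : V H -> Bop (prodX [:: x]) c%:P H = 0 -> H = 0.
Proof.
move=> VH BH; have [K [s [K0 /andP[s0 s1] hK]]] := wprod_bound.
have rec n : H n = ratio n * H n.+1.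
  have := congr1 (fun F => F n) BH; rewrite bopE fps0E => /eqP; rewrite subr_eq0 => /eqP h.
  apply: (mulfI (cN n)); rewrite h /ratio; have := cN n; move: (n%:R + c) => p p0; field.
  by rewrite p0.
have iter j : forall n, H n = wprod n j * H (n + j)%N.
  elim: j => [|j IH] n; first by rewrite /wprod big_ord0 mul1r addn0.
  by rewrite wprodS -mulrA -addSnnS -IH -rec.
have [t01 st _] := sq_mid s ltac:(by rewrite ltW).
set t := (1 + s) / 2 in t01 st; clearbody t.
case/andP: (t01) => t0 t1.
have [T hT] := W_tempered _ VH t t01.
have {}hT n : cm (H n) * t ^+ n <= T.
  apply: le_trans (hT n); rewrite ler_wpM2r ?exprn_ge0 ?(ltW t0) //.
  by rewrite /up cmM cm_nat ler_peMl ?cm_ge0 // ler1n.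
have T0 : 0 <= T by apply: le_trans (hT 0%N); rewrite mulr_ge0 ?cm_ge0.
apply/funext => n; rewrite fps0E; apply: cm_eps0 => e e0.
have tn : 0 < t ^+ n by rewrite exprn_gt0.
have KT0 : 0 <= K * T by rewrite mulr_ge0.
have e1 : 0 < e * t ^+ n / (K * T + 1) by rewrite divr_gt0 ?mulr_gt0 // ltr_wpDl.
have q01 : 0 <= s / t < 1 by rewrite divr_ge0 ?ltW //= ltr_pdivrMr // mul1r.
have [N hN] := exprn_lt_eps _ _ q01 e1.
rewrite (iter N n) cmM -(ler_pM2r tn).
apply: (@le_trans _ _ ((K * T + 1) * (e * t ^+ n / (K * T + 1)))); last first.
  by rewrite mulrC divfK // gt_eqF // ltr_wpDl.
apply: (@le_trans _ _ (K * T * (s / t) ^+ N)); last first.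
  by apply: ler_pM; rewrite ?exprn_ge0 ?(ltW (hN _ _)) ?lerDl //; case/andP: q01.
rewrite expr_div_n.
have tN : t ^+ N != 0 by rewrite expf_neq0 // gt_eqF.
rewrite (_ : cm _ * _ * _ = cm (wprod n N) * (cm (H (n + N)%N) * t ^+ (n + N)) / t ^+ N); last first.
  by rewrite exprD; move: (t ^+ N) tN => y y0; field.
rewrite [leRHS]mulrA ler_wpM2r ?invr_ge0 ?exprn_ge0 ?(ltW t0) // [leRHS]mulrAC.
by apply: ler_pM; rewrite ?mulr_ge0 ?cm_ge0 ?exprn_ge0 ?(ltW t0).
Qed.

Lemma Bop_inj H H' : V H -> V H' ->
  Bop (prodX [:: x]) c%:P H = Bop (prodX [:: x]) c%:P H' -> H = H'.
Proof.
move=> VH VH' h; apply/eqP; rewrite -subr_eq0; apply/eqP/bop_kernel0.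
  rewrite /V (_ : up (H - H') = fun n => up H n - up H' n); first exact: WB.
  by apply/funext => n; rewrite /up fpsD fpsN mulrBr.
apply/funext => n; have := congr1 (fun F => F n) h; rewrite !bopE fps0E !fpsD !fpsN => e.
by move/eqP: e; rewrite -subr_eq0 => /eqP e; rewrite -[RHS]e; ring.
Qed.

End Recursion.

(** At [x] the equation [qpoly = 0] becomes [x * (c * q1(x)) = -1] with [q1 = prodX outs], so the
    hypothesis says that [n + c] never vanishes. The inverse is the gauge applied around [hsol]. *)
Lemma invertible_one P lam x outs : qpoly P lam = prodX [:: x] * prodX outs ->
  cm x < 1 -> all (fun y => 1 < cm y) outs ->
  (forall m : nat, m%:R * (x * (prodX outs).[x]) != 1) ->
  invertible_on_Bergman (Toeplitz_shift (fun z => conjc z + P.[z]) lam).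
Proof.
move=> qE x1 ho hm.
have hi : all (fun y => cm y < 1) [:: x] by rewrite /= x1.
have [s0 [sm [E [E' [u [v [[gE gE' gu gv] [EE' uv ss pE LE]]]]]]]] := conj_form _ _ _ _ qE hi ho.
have /size1_polyC s0E : (size s0 <= 1)%N by [].
set c := s0`_0 in s0E.
have xc : x * (c * (prodX outs).[x]) = -1.
  have := congr1 (fun p => p.[x]) qE; rewrite /qpoly pE s0E (_ : prodX [:: x] = 'X - x%:P); last by rewrite /prodX big_seq1.
  rewrite !(hornerD, hornerM, hornerX, hornerC, hornerN) subrr mulr0 mul0r addr0 => /eqP.
  by rewrite addrC addr_eq0 => /eqP.
have cN n : n%:R + c != 0.
  apply/eqP => /eqP; rewrite addrC addr_eq0 => /eqP cE.
  have := hm n; rewrite -[n%:R]opprK -cE mulNr mulrCA xc opprK eqxx //.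
have [M1 hM1] := geo_W _ gv; have [M2 hM2] := hsol_bound x c x1; have [M3 hM3] := geo_V _ gE'.
have LB a : Lop P lam a = u * Bop (prodX [:: x]) c%:P (E * dn a) by rewrite LE s0E.
apply: (invertible_coef P lam (fun a => up (E' * hsol x c (v * a))) (M3 * (M2 * M1))).
- move=> a B wa; rewrite -mulrA; apply: hM3; rewrite -mulrA; apply: hM2; exact: hM1.
- move=> a wa; rewrite LB upK mulrA EE' mul1r Bop_hsol //; last exact: WM.
  by rewrite mulrA uv mul1r.
- move=> a wa; have WL := W_Lop P lam _ wa.
  have vL : v * Lop P lam a = Bop (prodX [:: x]) c%:P (E * dn a).
    by rewrite LB mulrA [v * u]mulrC uv mul1r.
  have Wv : W (v * Lop P lam a) by exact: WM.
  have -> : hsol x c (v * Lop P lam a) = E * dn a.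
    apply: (Bop_inj x c x1 cN).
    + by case: Wv => B /hM2 h; exists (M2 * B).
    + by apply: VM => //; exact: V_dn.
    + by rewrite Bop_hsol.
  by rewrite mulrA [E' * E]mulrC EE' mul1r dnK.
Qed.

End OneRoot.

(** * Location of the roots *)

Section RootLocation.
Context {R : realType}.
Notation C := (complex R).
Implicit Types (P p : {poly C}) (al be x z w lam mu : C) (r s t B L e : R) (k : nat) (outs rs : seq C).

Lemma poly_lip p B : 0 <= B -> exists2 L, 0 <= L &
  forall z w, cm z <= B -> cm w <= B -> cm (p.[z] - p.[w]) <= L * cm (z - w).
Proof.
move=> B0; elim/poly_ind: p => [|p c [L L0 IH]].
  by exists 0 => // z w _ _; rewrite !horner0 subrr cm0 mul0r.
exists (L * B + (cm p.[0] + L * B)); first by rewrite !addr_ge0 ?mulr_ge0 ?cm_ge0.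
move=> z w zB wB; rewrite !hornerMXaddC.
rewrite (_ : _ - _ = (p.[z] - p.[w]) * z + p.[w] * (z - w)); last by ring.
apply: le_trans (cmD _ _) _; rewrite [leRHS]mulrDl !cmM; apply: lerD.
  rewrite mulrAC; apply: ler_pM; rewrite ?cm_ge0 //; exact: IH.
rewrite ler_wpM2r ?cm_ge0 //.
have := IH w 0 wB ltac:(by rewrite cm0); rewrite subr0 => h.
rewrite -[p.[w]](subrK p.[0]); apply: le_trans (cmD _ _) _; rewrite addrC lerD2l.
by apply: le_trans h _; rewrite ler_wpM2l.
Qed.

Lemma seq_isolated rs z : exists2 d : R, 0 < d & forall w, w \in rs -> w != z -> d <= cm (w - z).
Proof.
elim: rs => [|y rs [d d0 IH]]; first by exists 1.
have [->|yz] := eqVneq y z.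
  by exists d => // w; rewrite inE => /orP[/eqP ->|]; [rewrite eqxx|exact: IH].
exists (Num.min d (cm (y - z))); first by rewrite lt_min d0 cm_gt0 subr_eq0.
by move=> w; rewrite inE ge_min => /orP[/eqP ->|/IH h /h ->//]; rewrite lexx orbT.
Qed.

Lemma poly_roots p : p != 0 -> exists rs, forall w, root p w = (w \in rs).
Proof.
move=> p0; have [rs pE] := closed_field_poly_normal p; exists rs => w.
by rewrite pE rootZ ?lead_coef_eq0 // root_prod_XsubC.
Qed.

Lemma root_isolated p z : p != 0 -> exists2 d : R, 0 < d &
  forall w, cm (w - z) < d -> root p w -> w = z.
Proof.
move=> /poly_roots[rs hrs]; have [d d0 hd] := seq_isolated rs z; exists d => // w wd.
rewrite hrs => wr; apply/eqP; apply: contraTT wd => wz; rewrite -leNgt; exact: hd.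
Qed.

Lemma prodX_cons x rs : prodX (x :: rs) = ('X - x%:P) * prodX rs.
Proof. by rewrite /prodX big_cons. Qed.

Lemma prodX_filter (a : pred C) rs : prodX rs = prodX (seq.filter a rs) * prodX (seq.filter (predC a) rs).
Proof.
elim: rs => [|x rs IH] /=; first by rewrite /prodX !big_nil mulr1.
by case: (a x) => /=; rewrite !prodX_cons IH; ring.
Qed.

Lemma prodX_nseq n x : prodX (nseq n x) = ('X - x%:P) ^+ n.
Proof. by elim: n => [|n IH] /=; rewrite ?prodX_cons ?IH ?exprS // /prodX big_nil expr0. Qed.

(** What the root analysis needs to know about alpha, beta and p. [d_half] amounts to D(al) = 1/2;
    [d_albe] serves the lower bound for D near the circle. *)
Record datum k al be P : Prop := Datum {
  d_k : (2 <= k)%N;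
  d_q : forall lam, qpoly P lam = ('X - al%:P) * ('X + be%:P) ^+ k - lam%:P * 'X;
  d_be : 1 < cm be;
  d_al : cm al < 1;
  d_albe : cm (al * be) < 1;
  d_al0 : al != 0;
  d_half : al * (al + be) ^+ k = 2^-1 }.

Section Datum.
Variables (k : nat) (al be : C) (P : {poly C}).

Lemma qpoly0 lam : (qpoly P lam).[0] = 1.
Proof. by rewrite /qpoly !(hornerD, hornerM, hornerX, hornerC) mul0r addr0. Qed.

Lemma qpolyE (h : datum k al be P) lam z :
  (qpoly P lam).[z] = (z - al) * (z + be) ^+ k - lam * z.
Proof.
by rewrite (d_q _ _ _ _ h) !(hornerD, hornerM, hornerX, hornerC, hornerN, hornerXsubC, horner_exp).
Qed.

Lemma qpoly_diff lam mu z : (qpoly P mu).[z] = (qpoly P lam).[z] - (mu - lam) * z.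
Proof.
rewrite /qpoly !(hornerD, hornerM, hornerX, hornerC, hornerN, hornerXsubC); ring.
Qed.

Lemma qmain : ('X - al%:P) * ('X + be%:P) ^+ k = prodX (al :: nseq k (- be)).
Proof. by rewrite prodX_cons prodX_nseq polyCN opprK. Qed.

Lemma qpoly_split (h : datum k al be P) lam : (forall z, root (qpoly P lam) z -> cm z != 1) ->
  exists ins outs, [/\ qpoly P lam = prodX ins * prodX outs, all (fun x => cm x < 1) ins,
    all (fun x => 1 < cm x) outs & (size ins + size outs = k.+1)%N].
Proof.
move=> nc; have [rs qE] := closed_field_poly_normal (qpoly P lam).
have sX : (size (- (lam%:P * 'X)) < size (prodX (al :: nseq k (- be))))%N.
  rewrite size_polyN /prodX size_prod_XsubC /= size_nseq mul_polyC.
  by apply: leq_ltn_trans (size_scale_leq _ _) _; rewrite size_polyX; have := d_k _ _ _ _ h; lia.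
have lc : lead_coef (qpoly P lam) = 1.
  by rewrite (d_q _ _ _ _ h) qmain lead_coefDl // /prodX (monicP (monic_prod_XsubC _ _ _)).
rewrite lc scale1r -/(prodX rs) in qE.
have rn x : x \in rs -> cm x != 1 by move=> xr; apply: nc; rewrite qE root_prodX.
exists (seq.filter (fun x => cm x < 1) rs), (seq.filter (predC (fun x => cm x < 1)) rs); split.
- by rewrite -prodX_filter.
- exact: filter_all.
- apply/allP => x; rewrite mem_filter /= -leNgt => /andP[h1 h2].
  by rewrite lt_neqAle eq_sym rn.
- rewrite !size_filter count_predC; have : (size (prodX rs) = k.+2)%N.
    rewrite -qE (d_q _ _ _ _ h) qmain size_polyDl //.
    by rewrite /prodX size_prod_XsubC /= size_nseq.
  by rewrite /prodX size_prod_XsubC => -[].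
Qed.

Definition spec : set C := [set lam | ~ invertible_on_Bergman (Toeplitz_shift (fun z => conjc z + P.[z]) lam)].

(* Exactly one root x in the closed disk, and it is inside. *)
Definition one lam x outs : Prop :=
  [/\ qpoly P lam = prodX [:: x] * prodX outs, cm x < 1, all (fun y => 1 < cm y) outs & size outs = k].

(* x q_lam'(x) after eliminating lam by means of q_lam(x) = 0. *)
Definition Dp : {poly C} := ('X + be%:P) ^+ k.-1 *
  (k%:R%:P * 'X ^+ 2 - (k.-1%:R * al)%:P * 'X + (al * be)%:P).

Lemma DpE x : Dp.[x] = (x + be) ^+ k.-1 * (k%:R * x ^+ 2 - k.-1%:R * al * x + al * be).
Proof. by rewrite /Dp !(hornerD, hornerM, hornerX, hornerC, hornerN, hornerXn, horner_exp). Qed.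

(** Differentiating the factorization at [x] gives [q1(x) = q'(x)]; then [lam * x] is replaced by
    [(x - al) * (x + be) ^+ k]. *)
Lemma Dp_formula (h : datum k al be P) lam x (q1 : {poly C}) :
  qpoly P lam = ('X - x%:P) * q1 -> x * q1.[x] = Dp.[x].
Proof.
move=> qE; have k2 := d_k _ _ _ _ h.
have r0 : (x - al) * (x + be) ^+ k - lam * x = 0.
  by rewrite -qpolyE // qE hornerM hornerXsubC subrr mul0r.
have E := congr1 (fun p => (p^`()).[x]) qE; rewrite (d_q _ _ _ _ h) /= in E.
rewrite !(derivE, deriv_exp, derivM, derivD, derivN, derivX, derivC, derivXsubC) in E.
rewrite !(hornerE, horner_exp, hornerMn, hornerXsubC) in E.
have kE : (k%:R : C) = k.-1%:R + 1 by rewrite natr1 prednK //; apply: leq_trans k2.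
have eE : (x + be) ^+ k = (x + be) * (x + be) ^+ k.-1 by rewrite -exprS prednK //; apply: leq_trans k2.
rewrite DpE; rewrite -mulr_natr eE kE in E; rewrite eE in r0; rewrite kE.
move: E r0; move: (_ ^+ k.-1) (k.-1%:R : C) => y n E r0.
have {}E : q1.[x] = (x + be) * y + (x - al) * (y * (n + 1)) - lam.
  by apply/esym; move: E; rewrite !subr0 !mul1r subrr mul0r addr0.
have lx : lam * x = (x - al) * ((x + be) * y) by apply/esym/eqP; rewrite -subr_eq0 r0.
rewrite E (_ : x * _ = x * ((x + be) * y + (x - al) * (y * (n + 1))) - lam * x); last by ring.
by rewrite lx; ring.
Qed.

Lemma one_Dp (h : datum k al be P) lam x outs : one lam x outs -> x * (prodX outs).[x] = Dp.[x].
Proof. by move=> [qE _ _ _]; apply: (Dp_formula h lam); rewrite qE /prodX big_seq1. Qed.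

Lemma spec_circle lam z : cm z = 1 -> root (qpoly P lam) z -> spec lam.
Proof. exact: not_invertible_circle. Qed.

(** Every other root pattern forces [lam] into the spectrum. *)
Lemma not_spec_one (h : datum k al be P) lam : ~ spec lam -> exists x outs, one lam x outs.
Proof.
move=> ns; have [ins [outs [qE hi ho sz]]] : exists ins outs, [/\ qpoly P lam = prodX ins * prodX outs,
    all (fun x => cm x < 1) ins, all (fun x => 1 < cm x) outs & (size ins + size outs = k.+1)%N].
  by apply: qpoly_split => // z rz; apply/eqP => z1; apply: ns; exact: spec_circle z1 rz.
case: ins qE hi sz => [|x [|y ins]] qE hi sz.
- case: ns; apply: (not_invertible_kernel P lam [::] outs qE hi ho) => s0 sm s0s _.
  (* Without inner roots the gauged operator is plain differentiation, which kills constants. *)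
  exists 1; first exact: oner_neq0.
  by move: s0s; rewrite leqn0 size_poly_eq0 => /eqP ->; rewrite derivC; ring.
- exists x, outs; split => //; last by case: sz.
  by move: hi => /= /andP[].
- by case: ns; apply: (not_invertible_two P lam _ outs qE hi ho).
Qed.

Lemma spec_one (h : datum k al be P) lam x outs : one lam x outs -> spec lam ->
  exists m : nat, m%:R * Dp.[x] = 1.
Proof.
move=> o sp; have oD := one_Dp h _ _ _ o; case: o => qE x1 ho _.
apply: contrapT => hm; apply: sp; apply: (invertible_one P lam x outs) => // m.
by rewrite oD; apply/eqP => hh; apply: hm; exists m.
Qed.

Lemma prodX_lower r n outs z : 0 <= r -> all (fun y => 1 < cm y) outs -> cm z <= 1 - r ->
  size outs = n -> r ^+ n <= cm (prodX outs).[z].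
Proof.
move=> r0 + zr; elim: outs n => [|y outs IH] n.
  by move=> _ <-; rewrite expr0 /prodX big_nil hornerC cm1.
move=> /= /andP[y1 ho] <-; rewrite prodX_cons hornerM hornerXsubC cmM exprS.
apply: ler_pM; rewrite ?exprn_ge0 //; last exact: IH.
by rewrite cmBC; apply: le_trans (cmB_ge _ _); move: y1 zr; lra.
Qed.

Lemma prodX_lower_out outs : all (fun y => 1 < cm y) outs -> exists2 d : R, 0 < d &
  forall z, cm z <= 1 -> d <= cm (prodX outs).[z].
Proof.
elim: outs => [|y outs IH] /=; first by exists 1 => // z _; rewrite /prodX big_nil hornerC cm1.
move=> /andP[y1 /IH[d d0 hd]]; exists ((cm y - 1) * d); first by rewrite mulr_gt0 ?subr_gt0.
move=> z z1; rewrite prodX_cons hornerM hornerXsubC cmM; apply: ler_pM.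
- by rewrite subr_ge0 ltW.
- exact: ltW.
- by rewrite cmBC; apply: le_trans (cmB_ge _ _); move: z1; lra.
- exact: hd.
Qed.

(** For [|y| > 1] and [|x| <= 1 - r] one has [|x| <= (1 - r) |y|], hence [|x - y| >= r |y|]. *)
Lemma prodX_ratio r n outs x : 0 <= r -> all (fun y => 1 < cm y) outs -> cm x <= 1 - r ->
  size outs = n -> r ^+ n * cm (prodX outs).[0] <= cm (prodX outs).[x].
Proof.
move=> r0 + xr; elim: outs n => [|y outs IH] n.
  by move=> _ <-; rewrite expr0 mul1r /prodX big_nil !hornerC.
move=> /= /andP[y1 ho] <-; rewrite prodX_cons !hornerM !hornerXsubC !cmM exprS mulrACA.
apply: ler_pM; rewrite ?mulr_ge0 ?exprn_ge0 ?cm_ge0 //; last exact: IH.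
rewrite sub0r cmN cmBC; apply: le_trans (cmB_ge _ _).
have x0 := cm_ge0 x; have : (1 - r) * 1 <= (1 - r) * cm y by rewrite ler_wpM2l ?(ltW y1) // (le_trans x0).
by move: xr; lra.
Qed.

(* |x| times the product of the moduli of the outer roots is 1, so |D(x)| is a product of factors |1 - x / rho|. *)
Lemma one_lower lam x outs r : 0 <= r -> one lam x outs -> cm x <= 1 - r ->
  r ^+ k <= cm (x * (prodX outs).[x]).
Proof.
move=> r0 [qE x1 ho sz] xr.
have E : cm x * cm (prodX outs).[0] = 1.
  rewrite -cmN -cmM -cm1 -(qpoly0 lam) qE hornerM; congr (cm (_ * _)).
  by rewrite /prodX big_seq1 hornerXsubC sub0r.
rewrite cmM -[leLHS]mulr1 -E mulrCA; apply: ler_wpM2l; first exact: cm_ge0.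
exact: prodX_ratio.
Qed.

Lemma cm_addr_ge x y : cm x <= 1 -> cm y - 1 <= cm (x + y).
Proof. by move=> x1; rewrite [x + y]addrC; apply: le_trans (cmD_ge _ _); rewrite lerD2l lerN2. Qed.

(** Two regimes, separated by a radius [r < 1] with [A < r^2]. For [|x| <= r] the bound is
    [one_lower]. For [|x| > r] the leading term of the quadratic factor dominates: the rest is at
    most [k A], where [A < 1] by the bounds on [al] and [al * be]. *)
Lemma Dp_lower (h : datum k al be P) : exists2 e : R, 0 < e &
  forall lam x outs, one lam x outs -> e <= cm Dp.[x].
Proof.
have k2 := d_k _ _ _ _ h; have be1 := d_be _ _ _ _ h; have al1 := d_al _ _ _ _ h.
have ab1 := d_albe _ _ _ _ h.
have kp : 0 < k%:R :> R by rewrite ltr0n; apply: leq_trans k2.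
have kE : (k%:R : R) = k.-1%:R + 1 by rewrite natr1 prednK //; apply: leq_trans k2.
pose A := (k.-1%:R * cm al + cm (al * be)) / k%:R.
have A0 : 0 <= A by rewrite divr_ge0 ?addr_ge0 ?mulr_ge0 ?cm_ge0.
have A1 : A < 1.
  rewrite ltr_pdivrMr // mul1r kE; apply: ler_ltD => //.
  by rewrite ler_piMr // ltW.
have [t01 _ At] := sq_mid A ltac:(by rewrite A0); set t := (1 + A) / 2 in t01 At.
have [r01 tr _] := sq_mid t ltac:(by case/andP: t01 => /ltW -> ->); set r := (1 + t) / 2 in r01 tr.
case/andP: t01 => t0 t1; case/andP: r01 => r0 r1.
clearbody r t.
have rA : A < r ^+ 2 by apply: le_lt_trans At _; rewrite ltrXn2r ?nnegrE ?(ltW t0) ?(ltW r0) // tr.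
have e2 : 0 < (cm be - 1) ^+ k.-1 * (k%:R * (r ^+ 2 - A)).
  by rewrite mulr_gt0 ?exprn_gt0 ?mulr_gt0 ?subr_gt0.
have e1 : 0 < (1 - r) ^+ k by rewrite exprn_gt0 // subr_gt0.
exists (Num.min ((1 - r) ^+ k) ((cm be - 1) ^+ k.-1 * (k%:R * (r ^+ 2 - A)))).
  by rewrite lt_min e1.
move=> lam x outs o; rewrite ge_min; have [xr|xr] := leP (cm x) r; apply/orP.
  left; rewrite -(one_Dp h _ _ _ o); apply: (one_lower lam) => //; last by rewrite opprB addrC subrK.
  by rewrite subr_ge0 ltW.
right; rewrite DpE cmM cmX.
have x1 : cm x < 1 by case: o.
apply: ler_pM; rewrite ?exprn_ge0 ?mulr_ge0 ?subr_ge0 ?(ltW be1) ?(ltW rA) //.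
  by rewrite lerXn2r ?nnegrE ?subr_ge0 ?(ltW be1) ?cm_ge0 // cm_addr_ge // ltW.
rewrite mulrBr (_ : k%:R * A = k.-1%:R * cm al + cm (al * be)); last by rewrite /A mulrC divfK ?gt_eqF.
apply: (@le_trans _ _ (k%:R * cm x ^+ 2 - (k.-1%:R * cm al + cm (al * be)))).
  rewrite lerD2r ler_wpM2l // lerXn2r ?nnegrE ?(ltW r0) ?cm_ge0 // ltW //.
rewrite -addrA [- _ + _]addrC; apply: le_trans (cmD_ge _ _).
rewrite [cm (k%:R * _)]cmM cmX cm_nat lerD2l lerN2; apply: le_trans (cmB _ _) _.
rewrite addrC; apply: lerD => //; rewrite !cmM cm_nat -[leRHS]mulr1.
by apply: ler_wpM2l; [rewrite mulr_ge0 ?cm_ge0 | exact: ltW].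
Qed.

Lemma circle_points z d : cm z = 1 -> 0 < d -> exists w, [/\ cm w = 1, w != z & cm (w - z) < d].
Proof.
move=> z1 d0; pose t := Num.min 1 (d / 5).
have t0 : 0 < t by rewrite lt_min ltr01 divr_gt0.
have t1 : t <= 1 by rewrite /t ge_min lexx.
have td : t <= d / 5 by rewrite /t ge_min lexx orbT.
clearbody t; have q0 : 0 < 1 + t ^+ 2 by rewrite ltr_wpDr ?sqr_ge0.
have q1 : 1 <= 1 + t ^+ 2 by rewrite lerDl sqr_ge0.
have qn : 1 + t ^+ 2 != 0 by rewrite gt_eqF.
(* The point [(1 + i t) / (1 - i t)] of the unit circle; its distance from 1 is at most
   [4 t < d]. *)
pose u : C := ((1 - t ^+ 2) / (1 + t ^+ 2)) +i* (2 * t / (1 + t ^+ 2)).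
have u1 : cm u = 1.
  apply/eqP; rewrite -(eqrXn2 (n := 2)) ?cm_ge0 // cm_sqr /= expr1n.
  by apply/eqP; field.
have z0 : z != 0 by rewrite -cm_gt0 z1.
exists (z * u); split; first by rewrite cmM z1 u1 mulr1.
  apply/eqP => E; have : u = 1 by apply: (mulfI z0); rewrite E mulr1.
  move/(congr1 (@complex.Im R)) => /= /eqP; rewrite mulf_eq0 invr_eq0 (negbTE qn) orbF mulf_eq0 pnatr_eq0 /=.
  by rewrite gt_eqF.
rewrite (_ : z * u - z = z * (u - 1)); last by ring.
rewrite cmM z1 mul1r; apply: le_lt_trans (cm_le_ReIm _) _.
rewrite ReB ImB /= subr0.
have -> : (1 - t ^+ 2) / (1 + t ^+ 2) - 1 = - (2 * t ^+ 2 / (1 + t ^+ 2)) by field.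
rewrite normrN !ger0_norm ?divr_ge0 ?mulr_ge0 ?sqr_ge0 ?(ltW t0) ?(ltW q0) // -mulrDl.
rewrite ltr_pdivrMr //; apply: (@lt_le_trans _ _ (d * 1)); last by rewrite ler_wpM2l // ltW.
have : t ^+ 2 <= t by rewrite expr2 ler_piMl // ltW.
by move: td d0; lra.
Qed.

Definition iso lam : Prop := spec lam /\
  exists2 r : R, 0 < r & forall mu, spec mu -> cm (mu - lam) < r -> mu = lam.

Lemma qpoly_neq0 lam : qpoly P lam != 0.
Proof. by apply/eqP => E; have := qpoly0 lam; rewrite E horner0 => /eqP; rewrite eq_sym oner_eq0. Qed.

(** If [z] is such a root, take [w] near [z] on the circle. Then [mu = lam + q(w) / w] has the root
    [w], so it is spectral and close to [lam]; it differs from [lam] because the roots of [q] are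
    isolated. *)
Lemma iso_no_circle lam : iso lam -> forall z, root (qpoly P lam) z -> cm z != 1.
Proof.
move=> [_ [r r0 hr]] z rz; apply/eqP => z1.
have [d d0 hd] := root_isolated _ z (qpoly_neq0 lam).
have [L L0 hL] := poly_lip (qpoly P lam) 1 ler01.
have [w [w1 wz wd]] := circle_points z (Num.min d (r / (L + 1))) z1
  ltac:(by rewrite lt_min d0 divr_gt0 // ltr_wpDl).
move: wd; rewrite lt_min => /andP[wd wr].
have w0 : w != 0 by rewrite -cm_gt0 w1.
pose mu := lam + (qpoly P lam).[w] / w.
have ml : mu - lam = (qpoly P lam).[w] / w by rewrite /mu addrC addKr.
have smu : spec mu.
  by apply: (spec_circle mu w w1); rewrite rootE (qpoly_diff lam) ml divfK // subrr.
have : mu = lam.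
  apply: hr => //; rewrite ml cmM cmV w1 invr1 mulr1.
  have := hL w z ltac:(by rewrite w1) ltac:(by rewrite z1); rewrite (eqP rz) subr0 => h.
  apply: le_lt_trans h _; move: wr; rewrite ltr_pdivlMr ?ltr_wpDl // => h.
  by apply: le_lt_trans h; rewrite mulrC ler_wpM2l ?cm_ge0 // lerDl.
move/eqP; rewrite -subr_eq0 ml mulf_eq0 invr_eq0 (negbTE w0) orbF => qw.
by move: wz; rewrite (hd w wd qw) eqxx.
Qed.

(** A quantitative substitute for Hurwitz's theorem: where [qpoly P mu] is small inside the disk,
    its single inner root is near. *)
Lemma cm_root_in mu x outs z : one mu x outs -> cm z < 1 ->
  cm (z - x) * (1 - cm z) ^+ k <= cm (qpoly P mu).[z].
Proof.
move=> [qE x1 ho sz] z1; rewrite qE hornerM {1}/prodX big_seq1 hornerXsubC cmM.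
rewrite ler_wpM2l ?cm_ge0 //; apply: prodX_lower => //; first by rewrite subr_ge0 ltW.
by rewrite opprB addrC subrK.
Qed.

(** Points [mu] near [lam] lie outside the spectrum and have one inner root [x]. With no inner root
    for [lam], its polynomial is bounded below on the disk but small at [x]. Two distinct inner
    roots would both be close to [x]. A repeated root [a] has D(a) = 0, whereas D(x) stays away from
    0 as [x] approaches [a]. *)
Lemma iso_one (h : datum k al be P) lam : iso lam -> exists x outs, one lam x outs.
Proof.
move=> il; have nc := iso_no_circle lam il; case: il => sl [r r0 hr].
have near e : 0 < e -> exists mu x outs, one mu x outs /\ 0 < cm (mu - lam) < e.
  move=> e0; pose d := Num.min r e / 2.
  have m0 : 0 < Num.min r e by rewrite lt_min r0.
  have d0 : 0 < d by rewrite divr_gt0.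
  have md : d < Num.min r e by rewrite /d; lra.
  have cd : cm (lam + d%:C - lam) = d by rewrite addrC addKr cm_real ger0_norm // ltW.
  have [|x [outs o]] := not_spec_one h (lam + d%:C).
    move=> /hr; rewrite cd => E; have := E ltac:(by apply: lt_le_trans md _; rewrite ge_min lexx).
    move/eqP; rewrite -subr_eq0 -cm_eq0 cd => /eqP d00; by rewrite d00 ltxx in d0.
  exists (lam + d%:C), x, outs; split => //; rewrite cd d0.
  by apply: lt_le_trans md _; rewrite ge_min lexx orbT.
have [ins [outs [qE hi ho sz]]] := qpoly_split h lam nc.
case: ins qE hi sz => [|a [|b ins]] qE hi sz.
- have [d d0 hd] := prodX_lower_out outs ho.
  have [mu [x [outs' [[qmu x1 _ _] /andP[_ md]]]]] := near d d0.
  have : (qpoly P lam).[x] = (mu - lam) * x.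
    apply/eqP; rewrite -subr_eq0 -qpoly_diff qmu hornerM /prodX big_seq1 hornerXsubC subrr mul0r //.
  rewrite qE /prodX big_nil mul1r => /(congr1 (@cm R)); rewrite cmM => E.
  have := hd x (ltW x1); rewrite /prodX E leNgt => /negP[]; apply: le_lt_trans md.
  by rewrite ler_piMr ?cm_ge0 // ltW.
- by exists a, outs; split => //; [case/andP: hi|case: sz].
have /and3P[a1 b1 _] := hi.
have close z : cm z < 1 -> root (qpoly P lam) z -> forall mu x outs', one mu x outs' ->
    cm (z - x) * (1 - cm z) ^+ k <= cm (mu - lam).
  move=> z1 rz mu x outs' o; apply: le_trans (cm_root_in mu x outs' z o z1) _.
  by rewrite (qpoly_diff lam) (eqP rz) sub0r cmN cmM ler_piMr ?cm_ge0 // ltW.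
have ra : root (qpoly P lam) a by rewrite qE rootM root_prodX mem_head.
have rb : root (qpoly P lam) b by rewrite qE rootM root_prodX !inE eqxx orbT.
have pa : 0 < (1 - cm a) ^+ k by rewrite exprn_gt0 // subr_gt0.
have pb : 0 < (1 - cm b) ^+ k by rewrite exprn_gt0 // subr_gt0.
have [ab|ab] := eqVneq a b.
  have Da : Dp.[a] = 0.
    rewrite -(Dp_formula h lam a (prodX (b :: ins) * prodX outs)); last by rewrite qE prodX_cons mulrA.
    by rewrite hornerM prodX_cons hornerM hornerXsubC ab subrr !mul0r mulr0.
  have [e e0 he] := Dp_lower h; have [L L0 hL] := poly_lip Dp 1 ler01.
  have [mu [x [outs' [ o /andP[_ md]]]]] := near (e / (L + 1) * (1 - cm a) ^+ k)
    ltac:(by rewrite mulr_gt0 // divr_gt0 // ltr_wpDl).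
  have := le_lt_trans (close a a1 ra mu x outs' o) md; rewrite ltr_pM2r // ltr_pdivlMr ?ltr_wpDl // => h1.
  have x1 : cm x < 1 by case: o.
  have := hL x a (ltW x1) (ltW a1); rewrite Da subr0 => h2.
  have := le_trans (he mu x outs' o) h2; rewrite leNgt => /negP[]; apply: le_lt_trans h1.
  by rewrite cmBC mulrC ler_wpM2l ?cm_ge0 // lerDl.
have dab : 0 < cm (a - b) by rewrite cm_gt0 subr_eq0.
have dd : 0 < cm (a - b) / 2 by rewrite divr_gt0.
have [mu [x [outs' [ o /andP[_ md]]]]] := near (Num.min (cm (a - b) / 2 * (1 - cm a) ^+ k) (cm (a - b) / 2 * (1 - cm b) ^+ k))
  ltac:(by rewrite lt_min !mulr_gt0).
move: md; rewrite lt_min => /andP[m1 m2].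
have := le_lt_trans (close a a1 ra mu x outs' o) m1; rewrite ltr_pM2r // => h1.
have := le_lt_trans (close b b1 rb mu x outs' o) m2; rewrite ltr_pM2r // => h2.
have := cmB (a - x) (b - x); rewrite (_ : a - x - (b - x) = a - b); last by ring.
by move: h1 h2; lra.
Qed.

Lemma Dp_shiftE (m x : C) : (m%:P * Dp - 1).[x] = m * Dp.[x] - 1.
Proof. by rewrite hornerD hornerM hornerN !hornerC. Qed.

(** D vanishes at [- be] since [k - 1 > 0], so the value there is -1. *)
Lemma Dp_shift_neq0 (h : datum k al be P) (m : C) : m%:P * Dp - 1 != 0.
Proof.
apply/eqP => /(congr1 (fun p => p.[- be])); rewrite Dp_shiftE DpE horner0.
have k2 := d_k _ _ _ _ h; rewrite addNr expr0n (_ : (k.-1 == 0)%N = false); last by lia.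
by rewrite mul0r mulr0 sub0r => /eqP; rewrite oppr_eq0 oner_eq0.
Qed.

(** The lower bound on D leaves finitely many [m], each [m] finitely many roots [x] of [m D - 1],
    and [f] recovers [lam] from [x]. *)
Lemma iso_finite (h : datum k al be P) : finite_set [set lam | iso lam].
Proof.
have [e e0 he] := Dp_lower h; have [M hM] := nat_ge (e^-1).
pose f (x : C) := (x - al) * (x + be) ^+ k / x.
apply: (@sub_finite_set _ _ (f @` \bigcup_(m in `I_M.+1) [set x : C | root (m%:R%:P * Dp - 1) x])); last first.
  apply: finite_image; apply: bigcup_finite; first exact: finite_II.
  move=> m _; have [rs hrs] := poly_roots _ (Dp_shift_neq0 h m%:R).
  by apply: (@sub_finite_set _ _ [set` rs]) => [x /=|]; [rewrite hrs|exact: finite_seq].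
move=> lam /= il; have [x [outs o]] := iso_one h lam il.
have [m mD] := spec_one h lam x outs o il.1.
exists x.
  exists m => /=; last by rewrite rootE Dp_shiftE mD subrr.
  have := congr1 (@cm R) mD; rewrite cmM cm_nat cm1 => E.
  have : m%:R * e <= 1 by rewrite -[leRHS]E ler_wpM2l // (he lam x outs).
  by rewrite -ler_pdivlMr // mul1r => /le_trans/(_ hM); rewrite ler_nat ltnS.
have r0 : (qpoly P lam).[x] = 0.
  by case: o => -> _ _ _; rewrite hornerM /prodX big_seq1 hornerXsubC subrr mul0r.
have x0 : x != 0 by apply/eqP => xx; move: r0; rewrite xx qpoly0 => /eqP; rewrite oner_eq0.
move: r0; rewrite qpolyE // => /eqP; rewrite subr_eq0 /f => /eqP ->.
by rewrite mulfK.
Qed.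

Lemma spec0 (h : datum k al be P) : spec 0.
Proof.
have be1 := d_be _ _ _ _ h; have al1 := d_al _ _ _ _ h.
have qE : qpoly P 0 = prodX [:: al] * prodX (nseq k (- be)).
  by rewrite (d_q _ _ _ _ h) qmain prodX_cons /prodX big_seq1 polyC0 mul0r subr0.
apply: (not_invertible_kernel P 0 [:: al] (nseq k (- be)) qE).
- by rewrite /= al1.
- by apply/allP => y; rewrite mem_nseq => /andP[_ /eqP ->]; rewrite cmN.
move=> s0 sm /= /size1_polyC s0E pE; set c := s0`_0 in s0E.
have q1 : (prodX (nseq k (- be))).[al] = (al + be) ^+ k by rewrite prodX_nseq horner_exp hornerXsubC opprK.
have ac : al * (c * (al + be) ^+ k) = -1.
  have := congr1 (fun p => p.[al]) qE; rewrite /qpoly pE s0E (_ : prodX [:: al] = 'X - al%:P); last by rewrite /prodX big_seq1.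
  rewrite !(hornerD, hornerM, hornerX, hornerC, hornerN) q1 subrr mulr0 mul0r addr0 => /eqP.
  by rewrite addrC addr_eq0 => /eqP.
have c2 : c = -2.
  move: ac; rewrite mulrCA (d_half _ _ _ _ h) => hc.
  have h2 : (2 : C) != 0 by rewrite pnatr_eq0.
  by rewrite -[c](divfK h2) hc mulN1r.
(* With [c = -2] the gauged equation is [(X - al) h' = 2 h]. *)
exists (('X - al%:P) ^+ 2).
  by rewrite expf_neq0 // polyXsubC_eq0.
rewrite /prodX big_seq1 s0E c2 deriv_exp derivXsubC mul1r expr1 rmorphN /= polyC_natr; ring.
Qed.

(** For small [mu] every root in the closed disk is within [|mu| / U] of [al]. A nonzero spectral
    [mu] would need exactly one inner root [x] with D(x) = 1/m; closeness to [al] forces [m = 2] and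
    then [x = al], which is not a root. *)
Lemma iso0 (h : datum k al be P) : iso 0.
Proof.
split; first exact: spec0.
have be1 := d_be _ _ _ _ h; have al1 := d_al _ _ _ _ h; have al0 := d_al0 _ _ _ _ h.
have k2 := d_k _ _ _ _ h.
pose U := (cm be - 1) ^+ k; have U0 : 0 < U by rewrite exprn_gt0 // subr_gt0.
have [L L0 hL] := poly_lip (('X + be%:P) ^+ k) 1 ler01.
have [L' L'0 hL'] := poly_lip Dp 1 ler01.
have [d d0 hd] := root_isolated _ al (Dp_shift_neq0 h 2).
have Dal : Dp.[al] = 2^-1.
  have -> : Dp.[al] = al * (al + be) ^+ k.
    rewrite DpE; have -> : (al + be) ^+ k = (al + be) * (al + be) ^+ k.-1 by rewrite -exprS prednK //; apply: leq_trans k2.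
    have -> : (k%:R : C) = k.-1%:R + 1 by rewrite natr1 prednK //; apply: leq_trans k2.
    by move: (_ ^+ k.-1) (k.-1%:R : C) => y n; ring.
  exact: d_half h.
(* [r1] excludes roots on the circle, [r2] the absence of inner roots, [r3] two distinct ones. [r4]
   gives [|D - 1/2| < 1/6], where 1/6 is the distance from 1/2 to 1/3, so that [m = 2]; it also
   excludes a repeated root. [r5] separates [al] from the other roots of [2 D - 1]. *)
pose r1 := (1 - cm al) * U; pose r2 := (1 - cm al) ^+ k.+1.
pose r3 := U / (1 + L / U); pose r4 := U / (6 * (L' + 1)); pose r5 := d * U.
have p1 : 0 < r1 by rewrite mulr_gt0 // subr_gt0.
have p2 : 0 < r2 by rewrite exprn_gt0 // subr_gt0.
have pLU : 0 < 1 + L / U by rewrite ltr_wpDr // divr_ge0 // ltW.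
have p3 : 0 < r3 by rewrite divr_gt0.
have p4 : 0 < r4 by rewrite divr_gt0 // mulr_gt0 // ltr_wpDl.
have p5 : 0 < r5 by rewrite mulr_gt0.
exists (Num.min r1 (Num.min r2 (Num.min r3 (Num.min r4 r5)))).
  by rewrite !lt_min p1 p2 p3 p4.
move=> mu smu; rewrite subr0 !lt_min => /and5P[m1 m2 m3 m4 m5].
have near z : cm z <= 1 -> root (qpoly P mu) z -> cm (z - al) * U <= cm mu.
  move=> z1 /eqP rz; have : (z - al) * (z + be) ^+ k = mu * z.
    by apply/eqP; rewrite -subr_eq0 -qpolyE // rz.
  move/(congr1 (@cm R)); rewrite !cmM cmX => E.
  apply: (@le_trans _ _ (cm mu * cm z)); last by rewrite ler_piMr ?cm_ge0.
  rewrite -E ler_wpM2l ?cm_ge0 // /U lerXn2r ?nnegrE ?cm_ge0 ?subr_ge0 ?(ltW be1) //.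
  exact: cm_addr_ge.
have nearD z : cm z <= 1 -> root (qpoly P mu) z -> cm (Dp.[z] - 2^-1) < 6^-1.
  move=> z1 rz; rewrite -Dal; apply: le_lt_trans (hL' z al z1 (ltW al1)) _.
  have := le_lt_trans (near z z1 rz) m4; rewrite /r4 mulrC -ltr_pdivlMl //.
  rewrite mulrA mulVf ?gt_eqF // mul1r => hz.
  apply: (@le_lt_trans _ _ ((L' + 1) * cm (z - al))); first by rewrite ler_wpM2r ?cm_ge0 // lerDl.
  by rewrite mulrC -ltr_pdivlMr ?ltr_wpDl // -invfM.
have nc z : root (qpoly P mu) z -> cm z != 1.
  move=> rz; apply/eqP => z1; have := le_lt_trans (near z ltac:(by rewrite z1) rz) m1.
  rewrite ltr_pM2r //; have := cmB_ge z al; rewrite z1; lra.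
have [ins [outs [qE hi ho sz]]] := qpoly_split h mu nc.
case: ins qE hi sz => [|a [|b ins]] qE hi sz.
- exfalso; have : (qpoly P mu).[al] = - (mu * al) by rewrite qpolyE // subrr mul0r sub0r.
  rewrite qE {1}/prodX big_nil mul1r => /(congr1 (@cm R)); rewrite cmN cmM => E.
  have : (1 - cm al) ^+ k.+1 <= cm (prodX outs).[al].
    by apply: prodX_lower => //; [rewrite subr_ge0 ltW | rewrite opprB addrC subrK].
  rewrite E -/r2 leNgt => /negP[]; apply: le_lt_trans m2.
  by rewrite ler_piMr ?cm_ge0 // ltW.
- have o : one mu a outs by split => //; [case/andP: hi|case: sz].
  have a1 : cm a < 1 by case: o.
  have ra : root (qpoly P mu) a by rewrite qE rootM root_prodX mem_head.
  have [m mD] := spec_one h mu a outs o smu.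
  have m0 : (m%:R : C) != 0 by apply/eqP => m0; move: mD; rewrite m0 mul0r => /eqP; rewrite eq_sym oner_eq0.
  have DE : Dp.[a] = m%:R^-1 by apply: (mulfI m0); rewrite mD mulfV.
  have m2' : m = 2%N.
    have := nearD a (ltW a1) ra; rewrite DE.
    have -> : (m%:R^-1 - 2^-1 : C) = (m%:R^-1 - 2^-1 : R)%:C by rewrite rmorphB !fmorphV !rmorph_nat.
    rewrite cm_real ltr_norml => /andP[].
    case: m m0 {mD DE} => [|[|[|m]]] m0 //; first by rewrite eqxx in m0.
      by rewrite invr1 => h1 h2; exfalso; lra.
    have : (m.+3%:R^-1 : R) <= 3^-1 by rewrite lef_pV2 ?posrE ?ltr0Sn // ler_nat.
    by move=> h1 h2 h3; exfalso; move: h1 h2 h3; move: (m.+3%:R^-1 : R) => y; lra.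
  have aal : a = al.
    apply: hd; last by rewrite m2' in mD; rewrite rootE Dp_shiftE mD subrr.
    by have := le_lt_trans (near a (ltW a1) ra) m5; rewrite ltr_pM2r.
  move/eqP: ra; rewrite aal qpolyE // subrr mul0r sub0r => /eqP.
  by rewrite oppr_eq0 mulf_eq0 (negbTE al0) orbF => /eqP.
- exfalso; have /and3P[a1 b1 _] := hi.
  have ra : root (qpoly P mu) a by rewrite qE rootM root_prodX mem_head.
  have rb : root (qpoly P mu) b by rewrite qE rootM root_prodX !inE eqxx orbT.
  have [ab|ab] := eqVneq a b.
    have Da : Dp.[a] = 0.
      rewrite -(Dp_formula h mu a (prodX (b :: ins) * prodX outs)); last by rewrite qE prodX_cons mulrA.
      by rewrite hornerM prodX_cons hornerM hornerXsubC ab subrr !mul0r mulr0.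
    have := nearD a (ltW a1) ra; rewrite Da sub0r cmN cmV cm_nat; lra.
  (* The difference of the two root equations; dividing by [a - b] and using the Lipschitz bound [L]
     gives [U <= |mu| (1 + L / U)]. *)
  have E : (a - b) * (a + be) ^+ k + (b - al) * ((a + be) ^+ k - (b + be) ^+ k) = mu * (a - b).
    move/eqP: ra; move/eqP: rb; rewrite !qpolyE // => /eqP; rewrite subr_eq0 => /eqP eb /eqP.
    rewrite subr_eq0 => /eqP ea.
    by rewrite [RHS]mulrBr -ea -eb; ring.
  have dab : 0 < cm (a - b) by rewrite cm_gt0 subr_eq0.
  have := hL a b (ltW a1) (ltW b1); rewrite !horner_exp !hornerD !hornerX !hornerC => h1.
  have h2 : U <= cm ((a + be) ^+ k).
    rewrite cmX /U lerXn2r ?nnegrE ?cm_ge0 ?subr_ge0 ?(ltW be1) //.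
    by apply: cm_addr_ge; exact: ltW.
  have h3 : cm (b - al) <= cm mu / U by rewrite ler_pdivlMr // near // ltW.
  have h4 : U * cm (a - b) <= cm mu * cm (a - b) + (cm mu / U) * (L * cm (a - b)).
    apply: (@le_trans _ _ (cm ((a - b) * (a + be) ^+ k))).
      by rewrite cmM mulrC ler_wpM2l ?cm_ge0.
    rewrite (_ : (a - b) * (a + be) ^+ k = mu * (a - b) - (b - al) * ((a + be) ^+ k - (b + be) ^+ k)); last first.
      by rewrite -E addrK.
    apply: le_trans (cmB _ _) _; rewrite !cmM lerD2l.
    by apply: ler_pM; rewrite ?cm_ge0.
  have h5 : U <= cm mu * (1 + L / U).
    rewrite -(ler_pM2r dab); apply: le_trans h4 _.
    by rewrite le_eqVlt; apply/orP; left; apply/eqP; move: (U^-1) => y; ring.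
  by move: m3; rewrite /r3 ltr_pdivlMr // ltNge h5.
Qed.

End Datum.
End RootLocation.

(** * The concrete alpha, beta and p *)

Section Instance.
Context {R : realType}.
Notation C := (complex R).
Implicit Types (k : nat) (be : C).

(* 4 c^3 - 3 c + 1 = (c + 1) (2 c - 1)^2 *)
Lemma cos_pi3 : cos (pi / 3) = 2^-1 :> R.
Proof.
have p0 := pi_gt0 R.
pose t : R := pi / 3; have E : t *+ 3 = pi by rewrite -(mulr_natr t) /t divfK // pnatr_eq0.
have c0 : 0 < cos t by apply: cos_gt0_pihalf; rewrite /t; lra.
have : cos (t *+ 2 + t) = -1 by rewrite -mulrSr E cospi.
rewrite cosD cos_mulr2n sin_mulr2n.
have : sin t ^+ 2 = 1 - cos t ^+ 2 by exact: sin2cos2.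
rewrite -/t; move: (cos t) (sin t) c0 => c s c0 hs h.
have : (c + 1) * (2 * c - 1) ^+ 2 = 0.
  rewrite (_ : _ * _ = ((c ^+ 2 *+ 2 - 1) * c - (c * s) *+ 2 * s) + 1 + 2 * c * (s ^+ 2 - (1 - c ^+ 2))); last by ring.
  by rewrite h hs subrr mulr0 addr0 addNr.
move/eqP; rewrite mulf_eq0 gt_eqF ?addr_gt0 //= sqrf_eq0 => /eqP; lra.
Qed.

Lemma cos_pi_div_ge k : (3 <= k)%N -> 2^-1 <= cos (pi / k%:R) :> R.
Proof.
move=> k3; have p0 := pi_ge0 R; rewrite -cos_pi3 leNgt.
have k1 n : (0 < n)%N -> (pi / n%:R : R) \in `[0, pi]%R.
  move=> n0; rewrite in_itv /= divr_ge0 //= ler_pdivrMr ?ltr0n // ler_peMr // ler1n //.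
rewrite (ltr_cos (k1 3%N _) (k1 k _)) //; last by apply: leq_trans k3.
rewrite -leNgt; apply: ler_wpM2l => //.
by rewrite lef_pV2 ?posrE ?ltr0n ?ler_nat //; apply: leq_trans k3.
Qed.

Section Data.
Variables (k : nat) (be : C).
Hypothesis k3 : (3 <= k)%N.
Hypothesis beE : be ^+ k.+1 = (1 - c_k R k)^-1.

Let r : R := (2^-1 : R) `^ (k%:R^-1).

Lemma k_gt0 : (0 < k)%N. Proof. exact: leq_trans k3. Qed.

Lemma r_pow : r ^+ k = 2^-1.
Proof.
rewrite -powR_mulrn ?powR_ge0 // -powRrM mulVf ?powRr1 ?invr_ge0 //.
by rewrite pnatr_eq0 -lt0n k_gt0.
Qed.

Lemma r_gt0 : 0 < r. Proof. by rewrite powR_gt0 // invr_gt0. Qed.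

Lemma r_lt1 : r < 1.
Proof.
rewrite ltNge; apply/negP => h; have := exprn_ege1 k h; rewrite r_pow; lra.
Qed.

Lemma c_kE : c_k R k = r%:C * expi (pi / k%:R). Proof. by []. Qed.

Lemma c_k_pow : c_k R k ^+ k = - 2^-1.
Proof.
have kn : k%:R != 0 :> R by rewrite pnatr_eq0 -lt0n k_gt0.
rewrite c_kE exprMn -rmorphXn r_pow expiX [k%:R * _]mulrC divfK // /expi cospi sinpi.
by apply/eqP; rewrite eq_complex /=; apply/andP; split; apply/eqP; field.
Qed.

(** [|1 - c|^2 = 1 - r (2 cos (pi / k) - r)] and [r < 1 <= 2 cos (pi / k)], the last bound being
    where [k >= 3] enters. This puts beta outside the closed disk. *)
Lemma cm_1Bc : 0 < cm (1 - c_k R k) < 1.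
Proof.
apply/andP; split.
  rewrite cm_gt0 subr_eq0; apply/eqP => h; have := c_k_pow; rewrite -h expr1n => /(congr1 (@cm R)).
  by rewrite cm1 cmN cmV cm_nat; lra.
rewrite -(ltr_pXn2r (n := 2)) ?nnegrE ?cm_ge0 // cm_sqr expr1n c_kE /expi /=.
have := cos_pi_div_ge k k3; have := sin2cos2 (pi / k%:R : R).
move: r_gt0 r_lt1; move: (cos _) (sin _) => c s r0 r1 hs hc.
rewrite (_ : _ + _ = 1 - 2 * r * c + r ^+ 2 * c ^+ 2 + r ^+ 2 * s ^+ 2); last by ring.
rewrite hs; nra.
Qed.

Lemma datum_p_of : datum k (alpha_of k be) be (p_of k be).
Proof.
have /andP[c0 c1] := cm_1Bc; have kp := k_gt0.
have cn : 1 - c_k R k != 0 by rewrite -cm_gt0.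
have b0 : be != 0.
  by apply/eqP => b0; have := beE; rewrite b0 expr0n /= => /esym/eqP; rewrite invr_eq0 (negbTE cn).
have bk0 : be ^+ k != 0 by rewrite expf_neq0.
have be1 : 1 < cm be.
  rewrite ltNge; apply/negP => h; have := exprn_ile1 k.+1 (cm_ge0 be) h.
  by rewrite -cmX beE cmV leNgt invf_gt1 // c1.
have bp n : (0 < n)%N -> 1 < cm be ^+ n by move=> n0; rewrite exprn_egt1 // -lt0n.
have al_cm : cm (alpha_of k be) = (cm be ^+ k)^-1 by rewrite /alpha_of cmN cmV cmX.
(* The defining equation of beta rewritten as [c = 1 - be^-(k+1)]; it makes [al * (al + be) ^+ k]
   equal to [- c ^+ k = 1/2]. *)
have sumE : alpha_of k be + be = be * c_k R k.
  have -> : c_k R k = 1 - (be ^+ k.+1)^-1 by rewrite beE invrK; ring.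
  rewrite /alpha_of exprS; move: (be ^+ k) bk0 => y y0; field.
  by rewrite b0 y0.
split => //.
- exact: leq_trans k3.
- move=> lam; set num := ('X - (alpha_of k be)%:P) * ('X + be%:P) ^+ k.
  have : 'X %| num - 1.
    rewrite -['X]subr0 -polyC0 dvdp_XsubCl rootE /num.
    rewrite hornerD hornerM hornerXsubC horner_exp hornerD hornerX hornerN !hornerC /alpha_of.
    by rewrite sub0r opprK add0r mulVf // subrr.
  move=> /divpK; rewrite -/(p_of k be) /qpoly => E.
  by rewrite mulrBr ['X * p_of k be]mulrC E; ring.
- by rewrite al_cm invf_lt1 ?bp // (lt_trans ltr01) // bp.
(* The modulus of [al * be] is [|be|^-(k-1)]. *)
- rewrite cmM al_cm -{2}[cm be]expr1 -(prednK kp) exprS.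
  have := bp k.-1 ltac:(by have := k3; lia); have cb : cm be != 0 by rewrite cm_eq0.
  move: (cm be ^+ k.-1) => y y1; have y0 : 0 < y by apply: lt_trans y1.
  by rewrite expr1 invfM mulrAC mulVf // mul1r invf_lt1.
- by rewrite oppr_eq0 invr_eq0.
- rewrite sumE exprMn c_k_pow /alpha_of mulrA mulNr mulVf // mulrN mulN1r opprK //.
Qed.

End Data.

Lemma isolated_pointE (S : set C) lam : isolated_point S lam <->
  (S lam /\ exists2 r : R, 0 < r & forall mu, S mu -> cm (mu - lam) < r -> mu = lam).
Proof.
by split=> -[sl [r r0 h]]; split => //; exists r => // mu smu; move: (h mu smu); rewrite cmE ltcR.
Qed.

End Instance.

Theorem theorem4p3 (R : realType) (k : nat) (beta : complex R) :
  (3 <= k)%N ->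
  beta ^+ k.+1 = (1 - c_k R k)^-1 ->
  isolated_point (spectrum_Toeplitz (symbol_of k beta)) 0 /\
  finite_set [set lam | isolated_point (spectrum_Toeplitz (symbol_of k beta)) lam].
Proof.
move=> k3 hb; have d := datum_p_of k beta k3 hb.
have sE : spectrum_Toeplitz (symbol_of k beta) = spec (p_of k beta) by [].
split; first by apply/isolated_pointE; rewrite sE; exact: (iso0 _ _ _ _ d).
apply: (@sub_finite_set _ _ [set lam | iso (p_of k beta) lam]); last exact: (iso_finite _ _ _ _ d).
by move=> lam /= /isolated_pointE; rewrite sE.
Qed.
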